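(* Consider the interconnected system described in the context, with a partition $\{1,\dots,n\}=I_\Sigma\cup I_{\max}$, and assume each subsystem $i$ has an ISS Lyapunov function $V_i$ (in the mixed sense defined in the context) with gains $\gamma_{ij}\in\mathcal{K}_\infty\cup\{0\}$, $\gamma_i\in\mathcal{K}$. Let $\Gamma$ be the gain operator built from $(\gamma_{ij})$. If $\Gamma$ is irreducible and there exists $\alpha\in\mathcal{K}_\infty$ such that $\Gamma\circ D_\alpha(s)\not\ge s$ for all $s\in\mathbb{R}^n_+\setminus\{0\}$, then the whole system $\dot x=f(x,u)$ is ISS and, for an arbitrary $\Omega$-path $\sigma\in\mathcal{K}_\infty^n$ with respect to $D_\alpha\circ\Gamma$, the function $V(x)=\max_{i=1,\dots,n}\sigma_i^{-1}(V_i(x_i))$ is an ISS Lyapunov function for the whole system.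
   Context: The interconnection is $\dot x_i=f_i(x_1,\dots,x_n,u_i)$, $i=1,\dots,n$, $x_i\in\mathbb{R}^{N_i}$, $u_i\in\mathbb{R}^{m_i}$, each $f_i$ continuous and, for every $r$, locally Lipschitz in $x=(x_1^T,\dots,x_n^T)^T$ uniformly in $|u_i|\le r$; written as $\dot x=f(x,u)$. $\mathcal{K}$: continuous strictly increasing functions $\mathbb{R}_+\to\mathbb{R}_+$ vanishing at $0$; $\mathcal{K}_\infty$: unbounded ones. A continuous $\rho:\mathbb{R}_+\to\mathbb{R}_+$ is positive definite if $\rho(r)=0\iff r=0$. $V:\mathbb{R}^N\to\mathbb{R}_+$ is proper and positive definite if $\psi_1(\|x\|)\le V(x)\le\psi_2(\|x\|)$ for some $\psi_1,\psi_2\in\mathcal{K}_\infty$. An ISS Lyapunov function for $\dot x=f(x,u)$ is a continuous $V$, proper, positive definite, locally Lipschitz on $\mathbb{R}^N\setminus\{0\}$, such that for some $\gamma\in\mathcal{K}$ and positive definite $\alpha$, at all points of differentiability, $V(x)\ge\gamma(\|u\|)\Rightarrow\nabla V(x)f(x,u)\le-\alpha(\|x\|)$. $V_i:\mathbb{R}^{N_i}\to\mathbb{R}_+$ is an ISS Lyapunov function for subsystem $i$ if it is continuous, proper, positive definite, locally Lipschitz on $\mathbb{R}^{N_i}\setminus\{0\}$, and there are $\gamma_{ij}\in\mathcal{K}_\infty\cup\{0\}$ ($\gamma_{ii}\equiv0$), $\gamma_i\in\mathcal{K}$ and positive definite $\alpha_i$ such that at all points of differentiability of $V_i$: for $i\in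 I_\Sigma$, $V_i(x_i)\ge\sum_j\gamma_{ij}(V_j(x_j))+\gamma_i(\|u\|)\Rightarrow\nabla V_i(x_i)f_i(x,u)\le-\alpha_i(\|x_i\|)$; for $i\in I_{\max}$, $V_i(x_i)\ge\max\{\max_j\gamma_{ij}(V_j(x_j)),\gamma_i(\|u\|)\}\Rightarrow\nabla V_i(x_i)f_i(x,u)\le-\alpha_i(\|x_i\|)$. $\Gamma(s)=(\Gamma_i(s))_i$ with $\Gamma_i(s)=\sum_j\gamma_{ij}(s_j)$ ($i\in I_\Sigma$), $\Gamma_i(s)=\max_j\gamma_{ij}(s_j)$ ($i\in I_{\max}$); $D_\alpha(s)=(D_i(s_i))_i$ with $D_i=\mathrm{id}+\alpha$ for $i\in I_\Sigma$, $D_i=\mathrm{id}$ for $i\in I_{\max}$. For $x,y\in\mathbb{R}^n$: $x<y$ iff $x_i<y_i$ for all $i$; $x\not\ge y$ iff $x_i<y_i$ for some $i$. $\Gamma$ is irreducible if the directed graph on $\{1,\dots,n\}$ with an edge $(i,j)$ whenever $\gamma_{ij}\ne0$ is strongly connected. A continuous $\sigma=(\sigma_1,\dots,\sigma_n)$ with $\sigma_i\in\mathcal{K}_\infty$ is an $\Omega$-path with respect to a map $M:\mathbb{R}^n_+\to\mathbb{R}^n_+$ if (i) each $\sigma_i^{-1}$ is locally Lipschitz on $(0,\infty)$; (ii) for every compact $P\subset(0,\infty)$ there are constants $0<c\le C$ with $c\le(\sigma_i^{-1})'(r)\le C$ for all $r\in P$ at which $\sigma_i^{-1}$ is differentiable,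 $i=1,\dots,n$; (iii) $M(\sigma(r))<\sigma(r)$ for all $r>0$. *)

(* Defs.v *)
From HB Require Import structures.
From mathcomp Require Import all_boot all_order all_algebra.
From mathcomp Require Import all_classical all_reals all_analysis.
From Stdlib Require Import Relations.
Import Order.TTheory GRing.Theory Num.Theory.
Import numFieldNormedType.Exports.

Set Implicit Arguments.
Unset Strict Implicit.
Unset Printing Implicit Defensive.

Local Open Scope classical_set_scope.
Local Open Scope ring_scope.

(* Functions R_+ -> R_+ are represented as functions R -> R; only their
   values on [0, +oo[ matter. *)

Definition isK (R : realType) (g : R -> R) : Prop :=
  g 0 = 0 /\ {within `[0, +oo[, continuous g} /\
  (forall r s : R, 0 <= r -> r < s -> g r < g s).

Definition isKinf (R : realType) (g : R -> R) : Prop :=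
  isK g /\ (forall M : R, exists r : R, 0 <= r /\ M < g r).

Definition isKinf0 (R : realType) (g : R -> R) : Prop :=
  isKinf g \/ (forall r : R, 0 <= r -> g r = 0).

Definition is_zero_gain (R : realType) (g : R -> R) : Prop :=
  forall r : R, 0 <= r -> g r = 0.

Definition posdef (R : realType) (rho : R -> R) : Prop :=
  {within `[0, +oo[, continuous rho} /\
  (forall r : R, 0 <= r -> 0 <= rho r) /\
  (forall r : R, 0 <= r -> (rho r = 0 <-> r = 0)).

Definition isKL (R : realType) (beta : R -> R -> R) : Prop :=
  {within [set p : R * R | 0 <= p.1 /\ 0 <= p.2],
     continuous (fun p : R * R => beta p.1 p.2)} /\
  (forall t : R, 0 <= t -> isK (fun r => beta r t)) /\
  (forall r : R, 0 <= r ->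
     (forall s t : R, 0 <= s -> s <= t -> beta r t <= beta r s) /\
     beta r t @[t --> +oo] --> (0 : R)).

(* proper and positive definite (norm: the MathComp-Analysis norm on row
   vectors, i.e. the max norm; all norms on R^k are equivalent) *)
Definition proper_pd (R : realType) (k : nat) (V : 'rV[R]_k -> R) : Prop :=
  exists psi1 psi2 : R -> R, isKinf psi1 /\ isKinf psi2 /\
    forall x : 'rV[R]_k, psi1 `|x| <= V x /\ V x <= psi2 `|x|.

Definition loc_lipschitz_nz (R : realType) (k : nat) (V : 'rV[R]_k -> R) : Prop :=
  forall x : 'rV[R]_k, x != 0 -> exists delta L : R, 0 < delta /\
    forall y z : 'rV[R]_k, `|y - x| < delta -> `|z - x| < delta ->
      `|V y - V z| <= L * `|y - z|.

(* The interconnection.  n subsystems, x_i in R^(Ni i), u_i in R^(mi i).   *)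
(* The state x is in R^N with N = \sum_i Ni i, x_i = submxrow x i; the     *)
(* input u = (u_1,...,u_n) is in R^(\sum_i mi i), u_i = submxrow u i.      *)

Definition regular_rhs (R : realType) (N m k : nat)
    (fi : 'rV[R]_N -> 'rV[R]_m -> 'rV[R]_k) : Prop :=
  continuous (fun p : 'rV[R]_N * 'rV[R]_m => fi p.1 p.2) /\
  forall (r : R) (x0 : 'rV[R]_N), exists delta L : R, 0 < delta /\
    forall (y z : 'rV[R]_N) (w : 'rV[R]_m),
      `|y - x0| < delta -> `|z - x0| < delta -> `|w| <= r ->
      `|fi y w - fi z w| <= L * `|y - z|.

Definition whole_rhs (R : realType) n (Ni mi : 'I_n -> nat)
    (fs : forall i : 'I_n, 'rV[R]_(\sum_(j < n) Ni j) -> 'rV[R]_(mi i) -> 'rV[R]_(Ni i))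
    (x : 'rV[R]_(\sum_(j < n) Ni j)) (u : 'rV[R]_(\sum_(j < n) mi j))
    : 'rV[R]_(\sum_(j < n) Ni j) :=
  \mxrow_(i < n) fs i x (submxrow u i).

(* gain operator Gamma; I_Sigma = {i | isSum i}, I_max = {i | ~~ isSum i} *)
Definition Gamma_op (R : realType) n (isSum : 'I_n -> bool)
    (gam : 'I_n -> 'I_n -> R -> R) (s : 'I_n -> R) : 'I_n -> R :=
  fun i => if isSum i then \sum_(j < n) gam i j (s j)
           else \big[Num.max/0]_(j < n) gam i j (s j).

Definition D_op (R : realType) n (isSum : 'I_n -> bool) (alpha : R -> R)
    (s : 'I_n -> R) : 'I_n -> R :=
  fun i => if isSum i then s i + alpha (s i) else s i.

Definition irreducible_gains (R : realType) n (gam : 'I_n -> 'I_n -> R -> R) : Prop :=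
  forall i j : 'I_n,
    clos_refl_trans 'I_n (fun a b => ~ is_zero_gain (gam a b)) i j.

Definition iss_lyap_sub (R : realType) n (Ni mi : 'I_n -> nat)
    (fs : forall i : 'I_n, 'rV[R]_(\sum_(j < n) Ni j) -> 'rV[R]_(mi i) -> 'rV[R]_(Ni i))
    (isSum : 'I_n -> bool) (V : forall i : 'I_n, 'rV[R]_(Ni i) -> R)
    (gam : 'I_n -> 'I_n -> R -> R) (gi : 'I_n -> R -> R) (i : 'I_n) : Prop :=
  continuous (V i) /\ proper_pd (V i) /\ loc_lipschitz_nz (V i) /\
  exists alpha_i : R -> R, posdef alpha_i /\
    forall (x : 'rV[R]_(\sum_(j < n) Ni j)) (u : 'rV[R]_(\sum_(j < n) mi j)),
      differentiable (V i) (submxrow x i) ->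
      (if isSum i then
         \sum_(j < n) gam i j (V j (submxrow x j)) + gi i `|u| <= V i (submxrow x i)
       else
         Num.max (\big[Num.max/0]_(j < n) gam i j (V j (submxrow x j))) (gi i `|u|)
           <= V i (submxrow x i)) ->
      'd (V i) (submxrow x i) (fs i x (submxrow u i)) <= - alpha_i `|submxrow x i|.

Definition iss_lyap (R : realType) (N m : nat)
    (F : 'rV[R]_N -> 'rV[R]_m -> 'rV[R]_N) (V : 'rV[R]_N -> R) : Prop :=
  continuous V /\ proper_pd V /\ loc_lipschitz_nz V /\
  exists (g a : R -> R), isK g /\ posdef a /\
    forall (x : 'rV[R]_N) (u : 'rV[R]_m),
      differentiable V x -> g `|u| <= V x -> 'd V x (F x u) <= - a `|x|.

Definition admissible_input (R : realType) (m : nat) (u : R -> 'rV[R]_m) : Prop :=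
  (forall k : 'I_m, measurable_fun setT (fun t : R => u t 0 k)) /\
  exists c : R, forall t : R, 0 <= t -> `|u t| <= c.

Definition is_solution (R : realType) (N m : nat)
    (F : 'rV[R]_N -> 'rV[R]_m -> 'rV[R]_N) (u : R -> 'rV[R]_m)
    (x0 : 'rV[R]_N) (x : R -> 'rV[R]_N) : Prop :=
  x 0 = x0 /\
  forall t : R, 0 <= t -> forall k : 'I_N,
    (@lebesgue_measure R).-integrable `[0, t]
        (fun s : R => (F (x s) (u s) 0 k)%:E) /\
    x t 0 k = x0 0 k + Rintegral (@lebesgue_measure R) `[0, t]
                         (fun s : R => F (x s) (u s) 0 k).

Definition ISS (R : realType) (N m : nat)
    (F : 'rV[R]_N -> 'rV[R]_m -> 'rV[R]_N) : Prop :=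
  exists (beta : R -> R -> R) (g : R -> R), isKL beta /\ isK g /\
    forall (u : R -> 'rV[R]_m) (x0 : 'rV[R]_N), admissible_input u ->
      (exists x : R -> 'rV[R]_N, is_solution F u x0 x) /\
      forall (x : R -> 'rV[R]_N) (c : R), is_solution F u x0 x ->
        (forall t : R, 0 <= t -> `|u t| <= c) ->
        forall t : R, 0 <= t -> `|x t| <= beta `|x0| t + g c.

Definition omega_path (R : realType) n (M : ('I_n -> R) -> ('I_n -> R))
    (sigma sinv : 'I_n -> R -> R) : Prop :=
  (forall i, isKinf (sigma i)) /\
  (forall i (r : R), 0 <= r -> sinv i (sigma i r) = r /\ sigma i (sinv i r) = r) /\
  (forall i (r : R), 0 < r -> exists delta L : R, 0 < delta /\
     forall a b : R, `|a - r| < delta -> `|b - r| < delta ->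
       `|sinv i a - sinv i b| <= L * `|a - b|) /\
  (forall P : set R, P `<=` `]0, +oo[ -> compact P ->
     exists c C : R, 0 < c /\ c <= C /\
       forall i (r : R), P r -> derivable (sinv i) r 1 ->
         c <= derive1 (sinv i) r /\ derive1 (sinv i) r <= C) /\
  (forall r : R, 0 < r -> forall i, M (fun j => sigma j r) i < sigma i r).

(* Main.v *)
Require Import Defs.
From HB Require Import structures.
From mathcomp Require Import all_boot all_order all_algebra.
From mathcomp Require Import all_classical all_reals all_analysis.
From mathcomp Require Import measurable_realfun ring lra.
Import Order.TTheory GRing.Theory Num.Theory.
Import numFieldNormedType.Exports.

Set Implicit Arguments.
Unset Strict Implicit.
Unset Printing Implicit Defensive.

Local Open Scope classical_set_scope.
Local Open Scope ring_scope.

(* ISS is proved without an Omega-path.  At an index whose own value dominates its gain bound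
   with a strict margin, the Lyapunov inequality, known only at differentiability points, holds
   as a Dini estimate at every point: by (a form of) Rademacher's theorem a Lipschitz function is
   controlled along a segment by its differentials at nearby points.  Along a trajectory,
   [V_i (x_i)] therefore decreases at a uniform rate while it exceeds its gain bound.
   Taking suprema over a time interval, and then infima of eventual uniform bounds, yields vectors
   [v] with [v_i <= Gamma_i v + r] (resp. [max (Gamma_i v) r]); the small-gain condition bounds
   such [v] by a function of [r] alone.  This gives uniform global stability and uniform
   attractivity, hence a KL estimate, and the a priori bound turns Picard iteration for a clipped
   right-hand side into global existence.
   For the second claim, at a maximising index [i] of [V = max_i sigma_i^-1 (V_i)] one has
   [V_i = sigma_i (V)] and [V_j <= sigma_j (V)], so the Omega-path inequality makes index [i]
   dominate its gain bound and the same Dini estimate applies. *)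

(** The exceptional set of [V_i] is null in the state space, but a trajectory may run inside it, so
    no chain rule holds along trajectories; this is why the inequality is first moved to every
    point, as a bound on increments along rays with frozen velocity. Such increments pass to a
    trajectory at the times where it has a right derivative, because [V_i] is Lipschitz away from
    the origin. The transfer uses the hypothesis at neighbouring states, so the gain inequality must
    be strict to survive there; neighbours differ in block [i] only, and the bound of index [i] does
    not see that block because [gam i i] vanishes. In the ISS part the strictness is bought with an
    arbitrarily small [e]; in the second part it comes from the path. The role of [alpha] is to
    absorb an additive input: at an index with [D (Gamma v) < v] and [v <= Gamma v + r] one gets
    [alpha (Gamma v) < r], hence a bound by [r] alone. Such an index is removed and its influence is
    moved into the input, until none is left. *)

Lemma real_induction (R : realType) (P : R -> Prop) (a b : R) :
  a <= b -> P a ->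
  (forall t, a <= t -> t < b -> P t ->
     exists d : R, 0 < d /\ forall s, t < s -> s < t + d -> s <= b -> P s) ->
  (forall t, a < t -> t <= b -> (forall s, a <= s -> s < t -> P s) -> P t) ->
  P b.
Proof.
move=> ab Pa Pr Pl.
(* Asking for [P] on all of [[a, t]], and not at [t] alone, makes the left-limit hypothesis
   applicable at the supremum of this set. *)
pose E := [set t | a <= t /\ t <= b /\ forall s, a <= s -> s <= t -> P s].
have Ea : E a.
  by split => //; split => // s as_ sa; have -> : s = a by lra.
have supE : has_sup E by split; [exists a|exists b => t [_ []]].
set c := sup E.
have ac : a <= c by apply: ub_le_sup => //; case: supE.
have cb : c <= b by apply: ge_sup; [exists a|move=> t [_ []]].
have Plt s : a <= s -> s < c -> P s.
  move=> as_ sc.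
  have [e Ee se] : exists2 e, E e & s < e.
    have := sup_adherent (eps := c - s) _ supE; rewrite subr_gt0 => /(_ sc)[e Ee].
    by rewrite -/c => h; exists e => //; lra.
  by case: Ee => _ [_]; apply => //; exact: ltW.
have Pc : P c.
  have [ac'|] := ltP a c; first exact: Pl.
  by move=> ca; have -> : c = a by lra.
have [cb'|bc] := ltP c b; last by have <- : c = b by lra.
have [d [d0 hd]] := Pr c ac cb' Pc.
pose m := Num.min (d / 2) (b - c).
have m0 : 0 < m by rewrite lt_min; apply/andP; split; lra.
have md : m < d by rewrite gt_min; apply/orP; left; lra.
have mb : m <= b - c by rewrite ge_min lexx orbT.
have Em : E (c + m).
  split; first lra; split; first lra.
  move=> s as_ sm; have [sc|cs|->//] := ltgtP s c; first exact: Plt.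
  by apply: hd => //; lra.
have : c + m <= c by apply: ub_le_sup => //; case: supE.
lra.
Qed.

(** * Increments of Lipschitz functions from Dini bounds outside a null set *)

Section dini.
Context {R : realType}.
Notation mu := (@lebesgue_measure R).

Lemma le_lebesgue_measure (A B : set R) : measurable A -> measurable B ->
  A `<=` B -> (mu A <= mu B)%E.
Proof. by move=> mA mB AB; apply: le_measure => //; rewrite inE. Qed.

Lemma negligible_open_cover (N : set R) (e : R) : mu.-negligible N -> 0 < e ->
  exists U, [/\ open U, N `<=` U & (mu U < e%:E)%E].
Proof.
move=> [A [mA A0 NA]] e0.
have Aoo : (mu A < +oo)%E by rewrite A0.
have [U [oU AU hU]] := lebesgue_regularity_outer mA Aoo e0.
exists U; split => //; first exact: subset_trans AU.
have -> : U = A `|` (U `\` A) by rewrite setDUK.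
rewrite measureU //; last 2 first.
- by apply: measurableD => //; exact: open_measurable.
- by rewrite setDE setIA setIAC setICr set0I.
by rewrite [X in (X + _)%E]A0 add0e.
Qed.

(** On [N] only the Lipschitz bound is available. It is paid for by the measure of an open cover [U]
    of [N]: near a point of [N], the measure [psi t] of the part of [U] in [[a, t]] grows at unit
    speed, while [psi b] stays below [e]. *)
Lemma dini_ae_le (g : R -> R) (a b c L : R) (N : set R) : a <= b ->
  (forall s t, a <= s -> s <= b -> a <= t -> t <= b ->
     `|g s - g t| <= L * `|s - t|) ->
  mu.-negligible N ->
  (forall t, a <= t -> t < b -> ~ N t -> forall e : R, 0 < e ->
     exists d : R, 0 < d /\ forall h : R, 0 < h -> h < d -> t + h <= b ->
       g (t + h) - g t <= (c + e) * h) ->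
  g b - g a <= c * (b - a).
Proof.
move=> ab lip NN dini.
apply/ler_addgt0Pr => /= e0 e0_gt0.
have [L0 lip0] : exists L' : R, 0 <= L' /\ forall s t, a <= s -> s <= b -> a <= t -> t <= b ->
     `|g s - g t| <= L' * `|s - t|.
  exists `|L|; split => // s t *; apply: le_trans (lip s t _ _ _ _) _ => //.
  by rewrite ler_wpM2r // ler_norm.
move: lip0 => [L0_ge0 lip0].
(* [K] outweighs [L0 - c], the excess of the Lipschitz slope over the target slope; the total error
   [e * (b - a) + K * e] is then at most [e0]. *)
pose K := L0 + `|c|.
have K0 : 0 <= K by rewrite addr_ge0.
pose e := e0 / (b - a + K + 1).
have D0 : 0 < b - a + K + 1 by lra.
have e_gt0 : 0 < e by rewrite divr_gt0.
have [U [oU NU Ue]] := negligible_open_cover NN e_gt0.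
have mU : measurable U by exact: open_measurable.
pose psi t := fine (mu (U `&` `[a, t])).
have mI t : measurable (U `&` `[a, t]) by exact: measurableI.
have fin t : mu (U `&` `[a, t]) \is a fin_num.
  rewrite ge0_fin_numE//; apply: le_lt_trans (lt_trans Ue (ltry _)).
  by apply: le_lebesgue_measure => //; exact: subIsetl.
have psi_mono s t : s <= t -> psi s <= psi t.
  move=> st; apply: fine_le => //; apply: le_lebesgue_measure => //.
  by apply: setIS; apply: subset_itvl; rewrite bnd_simp.
have psi_ge0 t : 0 <= psi t by rewrite fine_ge0.
have psib : psi b <= e.
  rewrite -lee_fin fineK//; apply: le_trans (ltW Ue).
  by apply: le_lebesgue_measure => //; exact: subIsetl.
have main : g b - g a <= (c + e) * (b - a) + K * psi b.
  apply: (@real_induction R (fun t => g t - g a <= (c + e) * (t - a) + K * psi t) a b ab).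
  - by rewrite !subrr mulr0 add0r mulr_ge0.
  - move=> t at_ tb IH.
    have [Nt|nNt] := pselect (N t); last first.
      have [d [d0 hd]] := dini t at_ tb nNt e e_gt0.
      exists d; split => // s ts sd sb.
      have := hd (s - t); rewrite subr_gt0 => /(_ ts).
      have -> : t + (s - t) = s by ring.
      move=> /(_ ltac:(lra) sb) h1.
      have := ler_wpM2l K0 (psi_mono t s (ltW ts)).
      lra.
    have /NU Ut := Nt.
    have [d /= d0 hd] := open_subball oU Ut.
    exists (d / 2); split; first by lra.
    move=> s ts sd sb.
    have psis : psi s >= psi t + (s - t).
      rewrite /psi -lee_fin EFinD !fineK//.
      have -> : (s - t)%:E = mu `]t, s].
        by rewrite lebesgue_measure_itv/= lte_fin ts.
      rewrite -measureU//; last first.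
        apply/seteqP; split => // x [[_ /=]]; rewrite !in_itv/= => /andP[_ xt] /andP[tx _].
        by move: (le_lt_trans xt tx); rewrite ltxx.
        exact: mI.
      apply: le_lebesgue_measure => //; first exact: measurableU.
      move=> x [[Ux]|]/=; rewrite !in_itv/= => /andP[h1 h2].
        by split => //=; rewrite h1 (le_trans h2 (ltW ts)).
      split => /=; last by rewrite h2 andbT; apply: ltW; exact: le_lt_trans h1.
      apply: (hd (s - t + d/2)) => //=.
        rewrite /ball_/= sub0r normrN gtr0_norm; lra.
        lra.
      rewrite /ball /= /ball_; rewrite ltr_norml; apply/andP; split; lra.
    have := lip0 s t ltac:(lra) ltac:(lra) ltac:(lra) ltac:(lra).
    rewrite (gtr0_norm (x := s - t)); last lra.
    have := ler_norm (g s - g t).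
    have := ler_wpM2l K0 psis.
    have h1 : 0 <= (`|c| + c) * (s - t).
      apply: mulr_ge0; last lra.
      by have := lerNnormlW (lexx `|c|); lra.
    have h2 : 0 <= e * (s - t) by apply: mulr_ge0; lra.
    rewrite /K in IH *; nra.
  - move=> t at_ tb IH.
    apply/ler_addgt0Pr => /= r r0.
    pose M := L0 + `|c + e| + 1.
    have M0 : 0 < M by rewrite /M; have := normr_ge0 (c + e); lra.
    pose s := Num.max a (t - r / M).
    have rM : 0 < r / M by rewrite divr_gt0.
    have as_ : a <= s by rewrite le_max lexx.
    have st : s < t by rewrite gt_max at_ /=; lra.
    have rs : t - r / M <= s by rewrite le_max lexx orbT.
    have sr : t - s <= r / M by lra.
    have := IH s as_ st.
    have := lip0 t s ltac:(lra) ltac:(lra) ltac:(lra) ltac:(lra).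
    rewrite (gtr0_norm (x := t - s)); last lra.
    have := ler_norm (g t - g s).
    have := ler_wpM2l K0 (psi_mono s t (ltW st)).
    have h3 : M * (t - s) <= r.
      by rewrite mulrC -ler_pdivlMr.
    have h4 : 0 <= (`|c + e| + (c + e)) * (t - s).
      apply: mulr_ge0; last lra.
      by have := lerNnormlW (lexx `|c + e|); lra.
    rewrite /M in h3; nra.
apply: le_trans main _.
have : K * psi b <= K * e by rewrite ler_wpM2l.
have : e * (b - a + K) <= e0.
  have -> : e0 = e * (b - a + K + 1) by rewrite /e mulfVK// gt_eqF.
  by rewrite ler_wpM2l; lra.
lra.
Qed.

End dini.

(** * Almost everywhere differentiability on the line, and density points *)

Section lip.
Context {R : realType}.
Notation mu := (@lebesgue_measure R).

Lemma lebesgue_stieltjes_oc (F : cumulative R R) (a b : R) : a <= b ->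
  lebesgue_stieltjes_measure F `]a, b] = (F b - F a)%:E.
Proof.
move=> ab; have mX : R.-ocitv.-measurable `]a, b]%classic by exists (a, b).
rewrite -[LHS]/((wlength F)^*%mu `]a, b]%classic) measurable_mu_extE//.
exact: wlength_itv_bnd.
Qed.

(** The two Stieltjes measures add up to [L] times Lebesgue measure, as comparison on half-open
    intervals shows, so each vanishes on Lebesgue-null sets. *)
Lemma lebesgue_stieltjes_dominates (F G : cumulative R R) (L : R) : 0 <= L ->
  (forall x, F x + G x = L * x) ->
  lebesgue_stieltjes_measure F `<< mu.
Proof.
move=> L0 FG; apply/null_content_dominatesP => A mA A0.
pose H (x : R) := L * x.
have ndH : {homo H : x y / x <= y} by move=> x y xy; rewrite ler_wpM2l.
have rcH : right_continuous H.
  by apply: right_continuousW => x; apply: cvgM; [exact: cvg_cst|exact: cvg_id].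
pose H' : cumulative R R := HB.pack H (isCumulative.Build _ _ _ H ndH rcH).
pose LN : {nonneg R} := NngNum L0.
have e1 : lebesgue_stieltjes_measure H' A = mscale LN mu A.
  apply: lebesgue_stieltjes_measure_unique => // _ /ocitvP[->|[x x12 ->]].
    by rewrite !measure0.
  transitivity (L%:E * mu `]x.1, x.2]%classic)%E; last by [].
  rewrite lebesgue_stieltjes_oc ?(ltW x12)// lebesgue_measure_itv/= lte_fin x12.
  by rewrite -EFinB -EFinM /H mulrBr.
have e2 : lebesgue_stieltjes_measure H' A =
   measure_add (lebesgue_stieltjes_measure F) (lebesgue_stieltjes_measure G) A.
  apply: lebesgue_stieltjes_measure_unique => // _ /ocitvP[->|[x x12 ->]].
    by rewrite !measure0.
  transitivity (lebesgue_stieltjes_measure F `]x.1, x.2]%classic +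
    lebesgue_stieltjes_measure G `]x.1, x.2]%classic)%E; last first.
    by symmetry; exact: measure_addE.
  rewrite !lebesgue_stieltjes_oc ?(ltW x12)// -EFinD; congr EFin.
  by rewrite /= /H -!FG; ring.
move: e2; rewrite e1 measure_addE /mscale/= [X in (_ * X)%E]A0 mule0 => /esym/eqP.
by rewrite padde_eq0// => /andP[/eqP -> _].
Qed.

(* [L x + f x] is monotone and its Stieltjes measure is dominated by Lebesgue measure, so it is
   the integral of its Radon-Nikodym density. *)
Lemma lipschitz_ae_derivable (f : R -> R) (L : R) :
  (forall x y, `|f x - f y| <= L * `|x - y|) ->
  {ae mu, forall x, derivable f x 1}.
Proof.
move=> lip.
have L0 : 0 <= L.
  have := lip 1 0; rewrite subr0 normr1 mulr1; exact: le_trans.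
have cf : continuous f.
  move=> x; apply/cvgrPdist_le => /= e e0.
  have L1 : 0 < L + 1 by lra.
  exists (e / (L + 1)); rewrite /= ?divr_gt0// => y /= /ltW.
  rewrite ler_pdivlMr// => h; apply: le_trans h.
  by apply: le_trans (lip _ _) _; rewrite mulrC ler_wpM2l//; lra.
pose F0 x := L * x + f x; pose G0 x := L * x - f x.
have cL : continuous (fun x : R => L * x).
  by move=> x; apply: cvgM; [exact: cvg_cst|exact: cvg_id].
have ndF : {homo F0 : x y / x <= y}.
  move=> x y xy; have := lip x y; rewrite ler_norml => /andP[_].
  by rewrite distrC ger0_norm ?subr_ge0// /F0; lra.
have ndG : {homo G0 : x y / x <= y}.
  move=> x y xy; have := lip x y; rewrite ler_norml => /andP[].
  by rewrite distrC ger0_norm ?subr_ge0// /G0; lra.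
have rcF : right_continuous F0.
  by apply: right_continuousW => x; apply: cvgD; [exact: cL|exact: cf].
have rcG : right_continuous G0.
  by apply: right_continuousW => x; apply: cvgB; [exact: cL|exact: cf].
pose F : cumulative R R := HB.pack F0 (isCumulative.Build _ _ _ F0 ndF rcF).
pose G : cumulative R R := HB.pack G0 (isCumulative.Build _ _ _ G0 ndG rcG).
have dom : lebesgue_stieltjes_measure F `<< mu.
  apply: (@lebesgue_stieltjes_dominates F G (2 * L)); first lra.
  by move=> x; rewrite /= /F0 /G0; ring.
pose D (k : nat) : set R := `]- k%:R, k%:R]%classic.
have k0 (k : nat) : - k%:R <= k%:R :> R by rewrite (@le_trans _ _ 0)// oppr_le0.
have Dfin k : (lebesgue_stieltjes_measure F (D k) < +oo)%E.
  by rewrite lebesgue_stieltjes_oc// ltry.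
have mD k : (R.-ocitv.-measurable).-sigma.-measurable (D k) by exact: measurable_itv.
(* Densities are taken on []-k, k]], where the Stieltjes measure is finite; the exceptional sets are
   then united over [k]. *)
have main k : mu.-negligible [set x | - k%:R < x /\ x < k%:R /\ ~ derivable f x 1].
  pose nu : {finite_measure set (measurableTypeR R) -> \bar R} := mfrestr (mD k) (Dfin k).
  have numu : nu `<< mu.
    apply/null_content_dominatesP => A mA A0.
    move/null_content_dominatesP : dom => dom.
    rewrite /nu /= /mfrestr /mrestr; apply: dom; first exact: measurableI.
    apply/eqP; rewrite -measure_le0 -[leRHS]A0; apply: le_lebesgue_measure => //.
    exact: (measurableI _ _ mA (mD k)).
  have [phi [phi0 phifin iphi phiE]] := radon_nikodym_sigma_finite numu.
  pose f0 := fine \o phi.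
  have phiE0 : phi = EFin \o f0 by apply/funext => x; rewrite /f0/= fineK.
  have if0 : mu.-integrable setT (EFin \o f0) by rewrite -phiE0.
  have FE x : - k%:R < x -> x < k%:R ->
      F0 x - F0 (- k%:R) = \int[mu]_(t in [set` `]- k%:R, x]]) f0 t.
    move=> kx xk.
    have : nu `]- k%:R, x]%classic = (F0 x - F0 (- k%:R))%:E.
      rewrite /nu/= /mfrestr /mrestr setIidl; last first.
        by apply: subset_itvl; rewrite bnd_simp ltW.
      by rewrite lebesgue_stieltjes_oc// ltW.
    by rewrite phiE// phiE0 /Rintegral => ->.
  have int0 y : mu.-integrable [set` Interval (BRight (- k%:R)) (BRight y)] (EFin \o f0).
    by apply: integrableS if0.
  have loc0 : locally_integrable [set: R] f0.
    by apply: open_integrable_locally => //; exact: openT.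
  have := FTC1 int0 loc0.
  apply: negligibleS => x /= [kx [xk ndf]] /= h; apply: ndf.
  have [|dF _] := h; first by rewrite lte_fin.
  have dF0 : derivable (fun x => F0 x - F0 (- k%:R)) x 1.
    apply: near_eq_derivable dF; near=> y; apply/esym/FE.
      by near: y; exact: lt_nbhsr.
    by near: y; exact: lt_nbhsl.
  have -> : f = (fun x => F0 x - F0 (- k%:R)) \- (fun x => L * x - F0 (- k%:R)).
    by apply/funext => y; rewrite /= /F0; ring.
  have dl : derivable (fun x : R => L * x - F0 (- k%:R)) x 1.
    apply: (@derivableB _ _ _ (fun x : R => L * x) (cst (F0 (- k%:R)))).
      by apply: (@derivableM _ _ (cst L) id); [exact: derivable_cst|exact: derivable_id].
    exact: derivable_cst.
  exact: (derivableB dF0 dl).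
have : mu.-negligible (\bigcup_k [set x | - k%:R < x /\ x < k%:R /\ ~ derivable f x 1]).
  exact: negligible_bigcup.
apply: negligibleS => x /= nd; exists (Num.bound `|x|) => //=.
by have := archi_boundP (normr_ge0 x); rewrite ltr_norml => /andP[? ?].
Unshelve. all: by end_near. Qed.

(** If no point of [A] were within [e * p] of [t], with [p] the distance from [t] to [x], the ball
    of radius [e * p] around [t] would be a hole in [A] filling the fraction [e / 2] of the ball of
    radius [2 * p] around [x], against density [1] at [x]. *)
Lemma density_pt_approx (A : set R) : measurable A ->
  {ae mu, forall x, A x -> forall e : R, 0 < e -> exists d : R, 0 < d /\
     forall t, `|t - x| < d -> exists s, A s /\ `|t - s| <= e * `|t - x|}.
Proof.
move=> mA; have := lebesgue_density mA.
apply: filterS; first exact: (ae_filter_ringOfSetsType mu).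
move=> x /= + Ax e0 e0_gt0.
rewrite indicE mem_set// => cv.
(* With [e <= 1] the hole stays inside the ball of radius [2 * p]. *)
pose e := Num.min e0 1.
have e_gt0 : 0 < e by rewrite lt_min e0_gt0 ltr01.
have e_le1 : e <= 1 by rewrite ge_min lexx orbT.
have e_le : e <= e0 by rewrite ge_min lexx.
have : \forall r \near 0^'+, ((1 - e / 2)%:E < mu (A `&` ball x r) * (mu (ball x r))^-1)%E.
  apply: (cv [set y | ((1 - e / 2)%:E < y)%E]); apply: open_nbhs_nbhs; split.
    exact: open_ereal_gt_ereal.
  by rewrite /= lte_fin; lra.
rewrite near_withinE => -[d /= d0 hd].
exists (d / 2); split; first lra.
move=> t td; have [->|tx] := eqVneq t x.
  by exists x; rewrite !subrr normr0 mulr0.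
apply: contrapT => /forallNP nA.
set p : R := `|t - x| in td nA *.
have p0 : 0 < p by rewrite normr_gt0 subr_eq0.
have := hd (2 * p); rewrite /= sub0r normrN gtr0_norm; last lra.
move=> /(_ ltac:(lra) ltac:(lra)).
apply/negP; rewrite -leNgt.
have mB (y r : R) : measurable (ball y r) by exact: measurable_ball.
have sub : ball t (e * p) `<=` ball x (2 * p).
  move=> y; rewrite /ball/= => h; apply: le_lt_trans (ler_distD t _ _) _.
  have : `|x - t| = p by rewrite distrC.
  have : e * p <= p by rewrite ler_piMl// ltW.
  lra.
have mAB : measurable (A `&` ball x (2 * p)) by exact: measurableI.
have dis : [disjoint (A `&` ball x (2 * p)) & ball t (e * p)].
  apply/disj_setPS => y /= [[Ay _]]; rewrite /ball/= => h.
  apply: (nA y); split => //; apply: le_trans (ltW h) _.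
  by rewrite ler_wpM2r// ltW.
have le1 : (mu (A `&` ball x (2 * p)) + mu (ball t (e * p)) <= mu (ball x (2 * p)))%E.
  rewrite -measureU.
  - apply: le_lebesgue_measure; last by move=> y [[]//|]; exact: sub.
    + by apply: measurableU; [exact: mAB|exact: mB].
    + exact: mB.
  - exact: mAB.
  - exact: mB.
  - exact/disj_set2P.
move: le1; rewrite !lebesgue_measure_ball; [|lra|by rewrite mulr_ge0; lra].
set m := mu _.
have mfin : m \is a fin_num.
  have mle : (m <= (2 * p *+ 2)%:E)%E.
    rewrite -(lebesgue_measure_ball x); last lra.
    by apply: le_lebesgue_measure; [exact: mAB|exact: mB|exact: subIsetr].
  by rewrite ge0_fin_numE ?measure_ge0//; exact: le_lt_trans mle (ltry _).
rewrite -(fineK mfin) -EFinD lee_fin => h.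
have q0 : 0 < 2 * p *+ 2 by lra.
rewrite inver gt_eqF//.
rewrite -EFinM lee_fin ler_pdivrMr; last lra.
lra.
Qed.
End lip.


(** * Row vectors in the max norm; measurability of preimages *)

Section rV_norm.
Context {R : realType}.

Lemma rV_coord_le k (z : 'rV[R]_k) j : `|z 0 j| <= `|z|.
Proof.
rewrite [leRHS]mx_normrE.
exact: (le_bigmax _ (fun i : 'I_1 * 'I_k => `|z i.1 i.2|) (0, j)).
Qed.

Lemma rV_norm_le k (z : 'rV[R]_k) (e : R) : 0 <= e ->
  (forall j, `|z 0 j| <= e) -> `|z| <= e.
Proof.
move=> e0 h; rewrite [leLHS]mx_normrE; apply: bigmax_le => // -[i j] _ /=.
by rewrite (ord1 i).
Qed.

Lemma rV_norm_lt k (z : 'rV[R]_k) (e : R) : 0 < e ->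
  (forall j, `|z 0 j| < e) -> `|z| < e.
Proof.
move=> e0 h; rewrite [ltLHS]mx_normrE; apply: bigmax_lt => // -[i j] _ /=.
by rewrite (ord1 i).
Qed.

Lemma rV_mulmx_le k (z : 'rV[R]_k) (q : 'cV[R]_k) (e : R) :
  (forall j, `|q j 0| <= e) -> `|(z *m q) 0 0| <= k%:R * e * `|z|.
Proof.
move=> h; rewrite mxE; apply: le_trans (ler_norm_sum _ _ _) _.
apply: (@le_trans _ _ (\sum_(j < k) e * `|z|)).
  apply: ler_sum => j _; rewrite normrM mulrC.
  by apply: ler_pM => //; exact: rV_coord_le.
by rewrite sumr_const card_ord -[leLHS]mulr_natl mulrA.
Qed.

Lemma rat_approx_cV k (q : 'cV[R]_k) (e : R) : 0 < e ->
  exists r : 'cV[rat]_k, forall j, `|q j 0 - (map_mx ratr r : 'cV[R]_k) j 0| <= e.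
Proof.
move=> e0.
have h j : exists a : rat, `|q j 0 - ratr a| <= e.
  have [|a] := @rat_in_itvoo R (q j 0 - e) (q j 0 + e); first lra.
  rewrite in_itv/= => /andP[h1 h2]; exists a.
  by rewrite ler_norml; apply/andP; split; lra.
exists (\col_j sval (cid (h j))) => j; rewrite !mxE.
exact: (svalP (cid (h j))).
Qed.

Lemma rat_approx_rV k (q : 'rV[R]_k) (e : R) : 0 < e ->
  exists r : 'rV[rat]_k, `|q - map_mx ratr r| <= e.
Proof.
move=> e0; have [r hr] := rat_approx_cV q^T e0; exists r^T.
apply: rV_norm_le; first exact: ltW.
by move=> j; have := hr j; rewrite !mxE.
Qed.

Lemma lip_continuous (U : normedModType R) (f : U -> R) (L : R) :
  (forall x y, `|f x - f y| <= L * `|x - y|) -> continuous f.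
Proof.
move=> lip x; apply/cvgrPdist_le => /= e e0.
have L1 : 0 < `|L| + 1 by rewrite ltr_wpDl.
near=> y.
apply: le_trans (lip _ _) _; apply: (@le_trans _ _ ((`|L| + 1) * `|x - y|)).
  by rewrite ler_wpM2r// (le_trans (ler_norm _))// lerDl.
rewrite mulrC -ler_pdivlMr//.
near: y; apply: cvgr_dist_le; first exact: cvg_id.
by rewrite divr_gt0.
Unshelve. all: by end_near. Qed.

Lemma inv_nat_lt (e : R) : 0 < e -> exists m : nat, m.+1%:R^-1 < e.
Proof.
move=> e0; exists (Num.truncn e^-1).
by rewrite invf_plt ?posrE// truncnS_gt.
Qed.

End rV_norm.

Section measurable_rV.
Context {R : realType} d (T : measurableType d).

(** Measurability of [p] is assumed coordinatewise. An open set is a countable union of balls with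
    rational centre and radius [1 / (m + 1)], and a ball of the max norm is a finite intersection of
    conditions on coordinates. *)
Lemma measurable_preimage_open k (p : T -> 'rV[R]_k) (U : set 'rV[R]_k) :
  (forall j, measurable_fun setT (fun t => p t 0 j)) -> open U ->
  measurable (p @^-1` U).
Proof.
move=> mp oU.
pose B (qm : 'rV[rat]_k * nat) : set 'rV[R]_k :=
  [set y | `|map_mx ratr qm.1 - y| < qm.2.+1%:R^-1].
pose F (i : nat) : set T := match (unpickle i : option ('rV[rat]_k * nat)) with
  | Some qm => if pselect (B qm `<=` U) then p @^-1` (B qm) else set0
  | None => set0 end.
have -> : p @^-1` U = \bigcup_i F i.
  apply/seteqP; split => [t /= Ut|t [i _]]; last first.
    rewrite /F; case: (unpickle i) => // qm; case: pselect => //= BU Bt.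
    exact: BU.
  have [e /= e0 he] : exists2 e : R, 0 < e & forall y, `|p t - y| < e -> U y.
    have := open_nbhs_nbhs (conj oU Ut); rewrite -nbhs_ballE => -[e /= e0 he].
    exists e => // y ye; apply: he.
    by rewrite mx_norm_ball.
  have [m hm] : exists m : nat, m.+1%:R^-1 < e / 2 by apply: inv_nat_lt; lra.
  have m0 : 0 < m.+1%:R^-1 / 2 :> R by rewrite divr_gt0 ?invr_gt0.
  have [q hq] := rat_approx_rV (p t) m0.
  have BU : B (q, m) `<=` U.
    move=> y /= hy; apply: he; apply: le_lt_trans (ler_distD (map_mx ratr q) _ _) _.
    by move: hy hq hm m0; rewrite /B/=; set r := _.+1%:R^-1; lra.
  exists (pickle (q, m)) => //; rewrite /F pickleK; case: pselect => //= _.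
  by move: hq m0; rewrite /B/= distrC; set r := _.+1%:R^-1; lra.
apply: bigcupT_measurable => i; rewrite /F; case: (unpickle i) => // -[q m].
case: pselect => [_|_] /=; last exact: measurable0.
pose G (i : nat) : set T := match (insub i : option 'I_k) with
  | Some j => [set t | `|map_mx ratr q 0 j - p t 0 j| < m.+1%:R^-1 :> R]
  | None => setT end.
have -> : p @^-1` B (q, m) = \bigcap_i G i.
  apply/seteqP; split => [t /= Bt i' _|t /= h].
    rewrite /G; case: insubP => // j _ _ /=; apply: le_lt_trans Bt.
    by have := rV_coord_le (map_mx ratr q - p t) j; rewrite !mxE.
  rewrite /B/=; apply: rV_norm_lt; first by rewrite invr_gt0.
  by move=> j; have := h (val j) I; rewrite /G valK/= !mxE.
apply: bigcapT_measurable => i'; rewrite /G; case: insubP => // j _ _.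
have mf : measurable_fun setT (fun t => `|map_mx ratr q 0 j - p t 0 j| : R).
  by apply: measurableT_comp => //; apply: measurable_funB.
rewrite -[X in measurable X]setTI.
have := mf measurableT `]-oo, m.+1%:R^-1[%classic (measurable_itv _).
congr (measurable (_ `&` _)).
Qed.

Lemma measurable_preimage_closed k (p : T -> 'rV[R]_k) (C : set 'rV[R]_k) :
  (forall j, measurable_fun setT (fun t => p t 0 j)) -> closed C ->
  measurable (p @^-1` C).
Proof.
move=> mp cC; rewrite -[C]setCK preimage_setC; apply: measurableC.
by apply: (@measurable_preimage_open _ _ (~` C)) => //; exact: closed_openC.
Qed.

End measurable_rV.

(** * Affine approximation as a measurable condition *)

Section linapp.
Context {R : realType}.

(** [J] selects the directions that are tested: [id] for all of them, [emb] for the last [k]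
    coordinates only. *)
Definition linapp k m (J : 'rV[R]_k -> 'rV[R]_m) (W : 'rV[R]_m -> R)
    (q : 'cV[R]_k) (d e : R) (y : 'rV[R]_m) :=
  forall z : 'rV[R]_k, `|z| < d -> `|W (y + J z) - W y - (z *m q) 0 0| <= e * `|z|.

(** The slope [q] may depend on [e]. With [J = id] this weak form still yields differentiability,
    since the slopes converge, and for Lipschitz [W] it is a countable combination of closed
    conditions. *)
Definition adiff k m (J : 'rV[R]_k -> 'rV[R]_m) (W : 'rV[R]_m -> R) (y : 'rV[R]_m) :=
  forall e : R, 0 < e -> exists (q : 'cV[R]_k) (d : R), 0 < d /\ linapp J W q d e y.

Lemma linapp_closed k m (J : 'rV[R]_k -> 'rV[R]_m) (W : 'rV[R]_m -> R) q (d e L : R) :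
  (forall x y : 'rV[R]_m, `|W x - W y| <= L * `|x - y|) ->
  closed [set y | linapp J W q d e y].
Proof.
move=> lip.
have -> : [set y | linapp J W q d e y] = \bigcap_(z in [set z | `|z| < d])
   ((fun y => `|W (y + J z) - W y - (z *m q) 0 0|) @^-1` [set a | a <= e * `|z|]).
  by apply/seteqP; split => y /= h z; apply: h.
apply: closed_bigI => z _; apply: closed_comp; last exact: closed_le.
move=> y _; move: y.
apply: (@lip_continuous _ _ _ (L + L)) => x y.
apply: le_trans (ler_dist_dist _ _) _.
have -> : W (x + J z) - W x - (z *m q) 0 0 - (W (y + J z) - W y - (z *m q) 0 0) =
  (W (x + J z) - W (y + J z)) - (W x - W y) by ring.
apply: le_trans (ler_normB _ _) _; rewrite mulrDl; apply: lerD; last exact: lip.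
by apply: le_trans (lip _ _) _; rewrite opprD addrACA subrr addr0.
Qed.

(** Rational slopes and radii [1 / (m + 1)] suffice, because rounding [q] costs only half of the
    tolerance. This countable form is what [measurable_adiff] relies on. *)
Lemma adiffP k m (J : 'rV[R]_k -> 'rV[R]_m) W y :
  adiff J W y <-> forall n : nat, exists qm : 'cV[rat]_k * nat,
    linapp J W (map_mx ratr qm.1) qm.2.+1%:R^-1 n.+1%:R^-1 y.
Proof.
split => [h n|h e e0]; last first.
  have [n hn] := inv_nat_lt e0; have [[q m'] hq] := h n.
  exists (map_mx ratr q), m'.+1%:R^-1; split; first by rewrite invr_gt0.
  by move=> z zd; apply: le_trans (hq z zd) _; rewrite ler_wpM2r// ltW.
have n0 : 0 < n.+1%:R^-1 :> R by rewrite invr_gt0.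
have [q [d [d0 hq]]] := h (n.+1%:R^-1 / 2) ltac:(by rewrite divr_gt0).
have k0 : 0 < k.+1%:R :> R by [].
have [r hr] := @rat_approx_cV R k q (n.+1%:R^-1 / 2 / k.+1%:R)
   ltac:(by rewrite divr_gt0// divr_gt0).
have [m' hm] := inv_nat_lt d0.
exists (r, m') => z /= zd.
have -> : W (y + J z) - W y - (z *m map_mx ratr r) 0 0 =
  (W (y + J z) - W y - (z *m q) 0 0) + (z *m (q - map_mx ratr r)) 0 0.
  by rewrite mulmxBr !mxE; ring.
apply: le_trans (ler_normD _ _) _.
have h1 := hq z (lt_trans zd hm).
have h2 : `|(z *m (q - map_mx ratr r)) 0 0| <= k%:R * (n.+1%:R^-1 / 2 / k.+1%:R) * `|z|.
  by apply: rV_mulmx_le => j; have := hr j; rewrite !mxE.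
have h3 : k%:R * (n.+1%:R^-1 / 2 / k.+1%:R) <= n.+1%:R^-1 / 2 :> R.
  rewrite mulrA ler_pdivrMr// mulrC ler_pM2l; last by rewrite divr_gt0.
  by rewrite ler_nat.
apply: le_trans (lerD h1 (le_trans h2 (ler_wpM2r (normr_ge0 z) h3))) _.
by rewrite -mulrDl -splitr.
Qed.

Lemma measurable_adiff d (T : measurableType d) k m
    (J : 'rV[R]_k -> 'rV[R]_m) (W : 'rV[R]_m -> R) (L : R) (p : T -> 'rV[R]_m) :
  (forall x y : 'rV[R]_m, `|W x - W y| <= L * `|x - y|) ->
  (forall j, measurable_fun setT (fun t => p t 0 j)) ->
  measurable [set t | adiff J W (p t)].
Proof.
move=> lip mp.
pose A n (qm : 'cV[rat]_k * nat) : set T :=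
  p @^-1` [set y | linapp J W (map_mx ratr qm.1) qm.2.+1%:R^-1 n.+1%:R^-1 y].
have mA n qm : measurable (A n qm).
  by apply: measurable_preimage_closed => //; exact: linapp_closed lip.
pose F n (i : nat) : set T := match (unpickle i : option ('cV[rat]_k * nat)) with
  | Some qm => A n qm | None => set0 end.
have -> : [set t | adiff J W (p t)] = \bigcap_n \bigcup_i F n i.
  apply/seteqP; split => t /=.
    move=> /adiffP h n _; have [qm hqm] := h n.
    by exists (pickle qm) => //; rewrite /F pickleK.
  move=> h; apply/adiffP => n; have [i _] := h n I.
  by rewrite /F; case: (unpickle i) => // qm Aqm; exists qm.
apply: bigcapT_measurable => n; apply: bigcupT_measurable => i.
by rewrite /F; case: (unpickle i).
Qed.

Lemma derivable_approx (g : R -> R) (t : R) : derivable g t 1 ->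
  forall e : R, 0 < e -> exists d : R, 0 < d /\
    forall s, `|s| < d -> `|g (t + s) - g t - 'D_1 g t * s| <= e * `|s|.
Proof.
move=> dg e e0; have /cvgrPdist_le/(_ _ e0) := dg.
rewrite near_withinE => -[d /= d0 hd]; exists d; split => // s sd.
have [->|s0] := eqVneq s 0; first by rewrite addr0 subrr mulr0 subrr normr0 mulr0.
have := hd s; rewrite /= sub0r normrN => /(_ sd s0).
have -> : lim (s0^-1 *: (g (s0 *: 1 + t) - g t) @[s0 --> 0^']) = 'D_1 g t by [].
rewrite [_ *: 1]mulr1 => h.
have -> : g (t + s) - g t - 'D_1 g t * s = - ('D_1 g t - s^-1 *: (g (s + t) - g t)) * s.
  by rewrite -[_ *: (_ - _)]/(_ * (_ - _)) addrC opprB mulrBl mulrAC mulVf// mul1r (addrC s t); ring.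
by rewrite normrM normrN ler_wpM2r.
Qed.

End linapp.

(** * Adding one coordinate: density points and Fubini *)

Section glue.
Context {R : realType}.
Notation mu := (@lebesgue_measure R).

Definition pt k (t : R) (y : 'rV[R]_k) : 'rV[R]_(1 + k) := row_mx (const_mx t) y.
Definition emb k (z : 'rV[R]_k) : 'rV[R]_(1 + k) := row_mx 0 z.

Lemma pt_split k (Z : 'rV[R]_(1 + k)) : Z = pt (lsubmx Z 0 0) (rsubmx Z).
Proof.
rewrite -[LHS]hsubmxK; congr row_mx; apply/rowP => j.
by rewrite (ord1 j) !mxE.
Qed.

Lemma pt_addZ k (t s : R) (y z : 'rV[R]_k) : pt t y + pt s z = pt (t + s) (y + z).
Proof.
by rewrite /pt add_row_mx; congr row_mx; apply/rowP => j; rewrite !mxE.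
Qed.

Lemma pt_emb k (t : R) (y z : 'rV[R]_k) : pt t y + emb z = pt t (y + z).
Proof.
by rewrite /pt /emb add_row_mx addr0.
Qed.

Lemma pt_dist k (t s : R) (y : 'rV[R]_k) : `|pt t y - pt s y| <= `|t - s|.
Proof.
apply: rV_norm_le => // j; rewrite !mxE.
by case: (fintype.split j) => i; rewrite ?mxE// subrr normr0.
Qed.

Lemma lsubmx_norm k (Z : 'rV[R]_(1 + k)) : `|lsubmx Z 0 0| <= `|Z|.
Proof. by rewrite mxE; exact: rV_coord_le. Qed.

Lemma rsubmx_norm k (Z : 'rV[R]_(1 + k)) : `|rsubmx Z| <= `|Z|.
Proof. by apply: rV_norm_le => // j; rewrite mxE; exact: rV_coord_le. Qed.

(** The slope in [y] is not assumed to vary continuously with the first coordinate. It is enough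
    that one [q], valid on one radius [d], serves at points [s] approximating each [t] up to [e]
    times the distance from [t] to [t0]: by the Lipschitz bound, exchanging [t] for [s] is cheap.
    The first coordinate itself is handled by the derivative at [t0]. *)
Lemma adiff_glue k (W : 'rV[R]_(1 + k) -> R) (L : R) (y : 'rV[R]_k) (t0 : R) :
  0 <= L -> (forall x x' : 'rV[R]_(1 + k), `|W x - W x'| <= L * `|x - x'|) ->
  (forall e : R, 0 < e -> exists (q : 'cV[R]_k) (d d' : R), 0 < d /\ 0 < d' /\
     forall t : R, `|t - t0| < d' -> exists s : R,
       linapp (@emb k) W q d e (pt s y) /\ `|t - s| <= e * `|t - t0|) ->
  derivable (fun t => W (pt t y)) t0 1 ->
  adiff id W (pt t0 y).
Proof.
move=> L0 lip hd dg e0 e0_gt0.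
(* Two exchanges at cost [L * e] each, one error [e] in [y] and one in the first coordinate. *)
pose e := e0 / (2 * L + 2).
have e_gt0 : 0 < e by rewrite divr_gt0//; lra.
have [q [d [d' [d_gt0 [d'_gt0 hq]]]]] := hd e e_gt0.
have [D [d2 [d2_gt0 hD]]] : exists (D d2 : R), 0 < d2 /\ forall s, `|s| < d2 ->
    `|W (pt (t0 + s) y) - W (pt t0 y) - D * s| <= e * `|s|.
  by eexists; exact: derivable_approx dg e e_gt0.
exists (col_mx (const_mx D) q), (Num.min d (Num.min d' d2)).
split; first by rewrite !lt_min d_gt0 d'_gt0.
move=> Z; rewrite !lt_min => /andP[Zd /andP[Zd' Zd2]].
pose s := lsubmx Z 0 0; pose z := rsubmx Z.
have sZ : `|s| <= `|Z| := lsubmx_norm Z.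
have zZ : `|z| <= `|Z| := rsubmx_norm Z.
have ZE : Z = pt s z := pt_split Z.
have [s' [hs' ss']] := hq (t0 + s) ltac:(by rewrite addrC addKr; exact: le_lt_trans Zd').
have -> : (Z *m col_mx (const_mx D) q) 0 0 = D * s + (z *m q) 0 0.
  by rewrite {1}ZE mul_row_col mxE; congr (_ + _); rewrite mxE big_ord1 !mxE mulrC.
rewrite /= {1}ZE pt_addZ.
have h1 := hs' z (le_lt_trans zZ Zd); rewrite pt_emb in h1.
have h2 := hD s (le_lt_trans sZ Zd2).
have h3 := lip (pt (t0 + s) (y + z)) (pt s' (y + z)).
have h4 := lip (pt s' y) (pt (t0 + s) y).
have ds : `|t0 + s - s'| <= e * `|s|.
  by apply: le_trans ss' _; rewrite (addrC t0) addrK.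
have h3' : L * `|pt (t0 + s) (y + z) - pt s' (y + z)| <= L * (e * `|s|).
  by rewrite ler_wpM2l//; apply: le_trans ds; exact: pt_dist.
have h4' : L * `|pt s' y - pt (t0 + s) y| <= L * (e * `|s|).
  by rewrite ler_wpM2l//; apply: le_trans ds; rewrite distrC; exact: pt_dist.
have -> : W (pt (t0 + s) (y + z)) - W (pt t0 y) - (D * s + (z *m q) 0 0) =
  ((W (pt (t0 + s) (y + z)) - W (pt s' (y + z))) +
   (W (pt s' (y + z)) - W (pt s' y) - (z *m q) 0 0)) +
  ((W (pt s' y) - W (pt (t0 + s) y)) +
   (W (pt (t0 + s) y) - W (pt t0 y) - D * s)) by ring.
apply: le_trans (ler_normD _ _) _.
apply: le_trans (lerD (ler_normD _ _) (ler_normD _ _)) _.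
apply: le_trans (lerD (lerD (le_trans h3 h3') h1) (lerD (le_trans h4 h4') h2)) _.
have e1 : e0 * `|Z| = L * (e * `|Z|) + e * `|Z| + (L * (e * `|Z|) + e * `|Z|).
  have -> : e0 = e * (2 * L + 2) by rewrite /e mulfVK// gt_eqF//; lra.
  ring.
have ze := ler_wpM2l (ltW e_gt0) zZ.
have se := ler_wpM2l (ltW e_gt0) sZ.
have sL := ler_wpM2l L0 se.
rewrite e1; apply: lerD; exact: lerD.
Qed.

Lemma measurable_pt d (T : measurableType d) k (t : T -> R) (y : T -> 'rV[R]_k) :
  measurable_fun setT t -> (forall j, measurable_fun setT (fun x => y x 0 j)) ->
  forall j, measurable_fun setT (fun x => pt (t x) (y x) 0 j).
Proof.
move=> mt my j; rewrite /pt; case: (split_ordP j) => i ->.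
  by under eq_fun do rewrite row_mxEl mxE.
have -> : (fun x => row_mx (const_mx (t x)) (y x) 0 (rshift 1 i)) = (fun x => y x 0 i).
  by apply/funext => x; rewrite row_mxEr.
exact: my.
Qed.

(** There are countably many triples of tolerance, rational slope and radius, and almost every [t]
    is a density point of all the corresponding sets that contain it; this supplies the points [s]
    of [adiff_glue]. *)
Lemma ae_adiff_pt k (W : 'rV[R]_(1 + k) -> R) (L : R) (y : 'rV[R]_k) :
  0 <= L -> (forall x x' : 'rV[R]_(1 + k), `|W x - W x'| <= L * `|x - x'|) ->
  mu.-negligible [set t | ~ adiff (@emb k) W (pt t y)] ->
  mu.-negligible [set t | ~ adiff id W (pt t y)].
Proof.
move=> L0 lip N1.
have mpt j : measurable_fun setT (fun t : R => pt t y 0 j).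
  by apply: measurable_pt => // i; exact: measurable_cst.
pose A (nqm : nat * ('cV[rat]_k * nat)) : set R := (fun t => pt t y) @^-1`
  [set Y | linapp (@emb k) W (map_mx ratr nqm.2.1) nqm.2.2.+1%:R^-1 nqm.1.+1%:R^-1 Y].
have mA nqm : measurable (A nqm).
  by apply: measurable_preimage_closed => //; exact: linapp_closed lip.
pose dens (A : set R) (x : R) := A x -> forall e : R, 0 < e -> exists d : R, 0 < d /\
     forall t, `|t - x| < d -> exists s, A s /\ `|t - s| <= e * `|t - x|.
pose F (i : nat) : set R := match (unpickle i : option (nat * ('cV[rat]_k * nat))) with
  | Some nqm => [set t | ~ dens (A nqm) t] | None => set0 end.
have N2 : mu.-negligible (\bigcup_i F i).
  apply: negligible_bigcup => i; rewrite /F; case: unpickle => [nqm|]; last first.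
    exact: negligible_set0.
  exact: density_pt_approx.
have N3 : mu.-negligible [set t | ~ derivable (fun t => W (pt t y)) t 1].
  apply: (@lipschitz_ae_derivable _ _ L) => t s.
  by apply: le_trans (lip _ _) _; rewrite ler_wpM2l// pt_dist.
have := negligibleU (negligibleU N1 N2) N3.
apply: negligibleS => t /= nad; apply: contrapT => /not_orP[/not_orP[/contrapT h1 h2] /contrapT h3].
apply: nad; apply: (adiff_glue L0 lip) => // e e0.
have [n hn] := inv_nat_lt e0.
have /adiffP/(_ n)[qm hqm] := h1.
have dn : dens (A (n, qm)) t.
  apply: contrapT => nd; apply: h2; exists (pickle (n, qm)) => //.
  by rewrite /F pickleK.
have [d [d0 hd]] := dn hqm _ e0.
exists (map_mx ratr qm.1), qm.2.+1%:R^-1, d; split; first by rewrite invr_gt0.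
split => // s sd; have [s' [As' ss']] := hd s sd; exists s'; split => //.
move=> z zd; apply: le_trans (As' z zd) _; rewrite ler_wpM2r//; exact: ltW.
Qed.

Context d (T : measurableType d) (m : {sigma_finite_measure set T -> \bar R}).

(** Tonelli for the indicator of [B]: both iterated integrals vanish, so almost every section in the
    other direction is null. *)
Lemma null_ysection (B : set (T * measurableTypeR R)) : measurable B ->
  (forall t, m (ysection B t) = 0%E) -> m.-negligible [set x | mu (xsection B x) != 0%E].
Proof.
move=> mB h.
have int0 : (\int[m]_x (mu \o xsection B) x = 0)%E.
  rewrite -(indic_fubini_tonelli_FE mu mB) (indic_fubini_tonelli m mu mB).
  rewrite (indic_fubini_tonelli_GE m mB).
  by apply: integral0_eq => t _ /=; rewrite h.
have mF : measurable_fun setT (fun x => mu (xsection B x)).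
  exact: measurable_fun_xsection.
have : ae_eq m setT (fun x => mu (xsection B x)) (cst 0%E).
  apply/(ae_eq_integral_abs m measurableT mF).
  rewrite -[RHS]int0; apply: eq_integral => x _ /=.
  by rewrite gee0_abs.
by apply: negligibleS => x /= /eqP nx hx; apply: nx; exact: hx.
Qed.

Lemma null_xsection (B : set (T * measurableTypeR R)) : measurable B ->
  m.-negligible [set x | mu (xsection B x) != 0%E] -> (m \x mu)%E B = 0%E.
Proof.
move=> mB h; rewrite /product_measure1.
rewrite (@ge0_ae_eq_integral _ _ _ m setT _ (cst 0%E)) ?integral0//=.
- exact: measurable_fun_xsection.
- by apply: negligibleS h => x /= hx; apply/eqP => x0; apply: hx.
Qed.

(* Not inferred: the library's sigma-finite instance on products is shadowed by the one
   for subprobabilities. *)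
Lemma prod_lebesgue_sigma_finite : sigma_finite setT (m \x mu)%E.
Proof.
have /sigma_finiteP[F [TF ndF Foo]] := sigma_finiteT m.
pose I (n : nat) : set (measurableTypeR R) := `]- n%:R, n%:R[%classic.
exists (fun n => F n `*` I n).
  apply/seteqP; split => // -[x t] _.
  have [i _ Fix] : (\bigcup_i F i) x by rewrite -TF.
  have tb := archi_boundP (normr_ge0 t); set j := Num.bound _ in tb.
  exists (maxn i j) => //; split => /=.
    by move: x Fix; apply/subsetPset/ndF/leq_maxl.
  rewrite /I/= in_itv/= -ltr_norml; apply: lt_le_trans tb _.
  by rewrite ler_nat leq_maxr.
move=> n; have [mFn Fn_lty] := Foo n.
have mI : measurable (I n) by exact: measurable_itv.
split; first exact: measurableX.
rewrite product_measure1E// lte_mul_pinfty//.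
  by rewrite ge0_fin_numE.
rewrite [ltLHS](_ : _ = (n%:R - - n%:R)%:E) ?ltry//.
have := @lebesgue_measure_itv R `]- n%:R, n%:R[; rewrite /= => ->.
rewrite lte_fin; case: ifPn => //; rewrite -leNgt => h.
by have : n%:R = 0 :> R; [have := ler0n R n; lra|move=> ->; rewrite oppr0 subrr].
Qed.

End glue.

(** * Rademacher's theorem, in general and along almost every parallel line *)

Section rademacher.
Context {R : realType}.
Notation mu := (@lebesgue_measure R).

Lemma adiff_pt_emb k (W : 'rV[R]_(1 + k) -> R) (t : R) (y : 'rV[R]_k) :
  adiff id (fun y => W (pt t y)) y -> adiff (@emb _ k) W (pt t y).
Proof.
move=> h e e0; have [q [d [d0 hq]]] := h e e0; exists q, d; split => // z zd.
by rewrite pt_emb; exact: hq.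
Qed.

Lemma pt_dist2 k (t : R) (y z : 'rV[R]_k) : `|pt t y - pt t z| <= `|y - z|.
Proof.
apply: rV_norm_le => // j; rewrite !mxE.
case: (fintype.split j) => i; rewrite ?mxE ?subrr ?normr0//.
by have := rV_coord_le (y - z) i; rewrite !mxE.
Qed.

Lemma lip_const_ge0 (U : normedModType R) (W : U -> R) (L : R) :
  (forall x y : U, `|W x - W y| <= L * `|x - y|) ->
  exists2 L', 0 <= L' & (forall x y : U, `|W x - W y| <= L' * `|x - y|).
Proof.
move=> lip; exists `|L| => // x y; apply: le_trans (lip x y) _.
by rewrite ler_wpM2r// ler_norm.
Qed.

(* The measure space stands for Lebesgue measure on ['rV_k]: it is built by adding one coordinate
   at a time, each step combining Fubini with density points. *)
Lemma rademacher k : exists (d : measure_display) (T : measurableType d)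
    (m : {sigma_finite_measure set T -> \bar R}) (p : T -> 'rV[R]_k),
  [/\ forall j, measurable_fun setT (fun x => p x 0 j),
      forall e : R, 0 < e -> m [set x | `|p x| < e] != 0%E &
      forall (W : 'rV[R]_k -> R) (L : R),
        (forall x y : 'rV[R]_k, `|W x - W y| <= L * `|x - y|) ->
        m.-negligible [set x | ~ adiff id W (p x)]].
Proof.
elim: k => [|k [d [T [m [p [mp pos IH]]]]]].
  (* ['rV_0] is one point, so any measure space of nonzero mass serves as a start. *)
  exists _, (measurableTypeR R), mu, (fun _ => 0); split.
  - by move=> [].
  - move=> e e0; rewrite (_ : [set _ | _] = setT); last first.
      by apply/seteqP; split => // x _ /=; rewrite normr0.
    have h := @lebesgue_measure_itv R `]-oo, +oo[; rewrite set_itvNyy /= in h.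
    by rewrite [X in X != _]h.
  - move=> W L lip; rewrite (_ : [set _ | _] = set0); first exact: negligible_set0.
    apply/seteqP; split => // x /=; apply => e e0; exists 0, 1; split => // z _.
    by rewrite (thinmx0 z) addr0 subrr mul0mx mxE subrr normr0 mulr_ge0// ltW.
pose T' := (T * measurableTypeR R)%type.
pose p' (x : T') := pt x.2 (p x.1).
have mp' j : measurable_fun setT (fun x : T' => p' x 0 j).
  apply: measurable_pt; first exact: measurable_snd.
  by move=> i; apply: (measurableT_comp (mp i)); exact: measurable_fst.
pose m' : {sigma_finite_measure set (T * measurableTypeR R)%type -> \bar R} :=
  HB.pack (m \x mu)%E (Measure_isSigmaFinite.Build _ _ _ (m \x mu)%E
    (prod_lebesgue_sigma_finite m)).
exists _, _, m', p'; split.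
- exact: mp'.
- move=> e e0.
  have -> : [set x : T' | `|p' x| < e] = [set x | `|p x| < e] `*` `]- e, e[%classic.
    apply/seteqP; split => -[x t] /=; rewrite in_itv/=.
      move=> h; split.
        apply: le_lt_trans h; have := rsubmx_norm (pt t (p x)).
        by rewrite /p'/= /pt row_mxKr.
      rewrite -ltr_norml; apply: le_lt_trans h.
      by have := lsubmx_norm (pt t (p x)); rewrite /p'/= /pt row_mxKl mxE.
    rewrite -ltr_norml => -[h1 h2]; apply: rV_norm_lt => // j.
    rewrite mxE; case: (fintype.split j) => i; rewrite ?mxE//.
    by apply: le_lt_trans h1; exact: rV_coord_le.
  rewrite -[X in X != _]/((m \x mu)%E _) product_measure1E//; last first.
    apply: (@measurable_preimage_open _ _ _ _ p [set y | `|y| < e]) => //.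
    have -> : [set y : 'rV[R]_k | `|y| < e] = ball 0 e.
      by rewrite mx_norm_ball; apply/seteqP; split => y /=; rewrite /ball_ sub0r normrN.
    exact: ball_open.
  rewrite mule_neq0// ?pos//.
  rewrite [X in X != _]lebesgue_measure_itv/= lte_fin ifT; last lra.
  by rewrite -EFinD eqe; apply/eqP; lra.
- move=> W L0' lip0; have [L L0 lip] := lip_const_ge0 lip0.
  (* [B1] records failure in the last [k] coordinates. Each of its slices at fixed [t] is null by
     induction, hence so are almost all slices at fixed [x]; for those [x], [ae_adiff_pt] makes the
     slice of [B2] null as well. *)
  pose B1 : set T' := [set x | ~ adiff (@emb _ k) W (p' x)].
  pose B2 : set T' := [set x | ~ adiff id W (p' x)].
  have mB1 : measurable B1.
    by apply: measurableC; exact: measurable_adiff lip mp'.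
  have mB2 : measurable B2.
    by apply: measurableC; exact: measurable_adiff lip mp'.
  apply/negligibleP => //; rewrite -[LHS]/((m \x mu)%E _).
  apply: null_xsection => //.
  have : m.-negligible [set x | mu (xsection B1 x) != 0%E].
    apply: null_ysection => // t; apply: measure_negligible.
      exact: measurable_ysection.
    have : m.-negligible [set x | ~ adiff id (fun y => W (pt t y)) (p x)].
      apply: (IH _ L) => y z; apply: le_trans (lip _ _) _.
      by rewrite ler_wpM2l// pt_dist2.
    apply: negligibleS => x; rewrite /ysection/= inE /B1/= => h1 h2.
    by apply: h1; exact: adiff_pt_emb.
  apply: negligibleS => x /= h; apply/negP => /eqP h0; move/negP: h; apply.
  apply/eqP; apply: measure_negligible; first exact: measurable_xsection.
  have := @ae_adiff_pt R k W L (p x) L0 lip.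
  have hB1 : mu.-negligible [set t | ~ adiff (@emb _ k) W (pt t (p x))].
    exists (xsection B1 x); split => //; first exact: measurable_xsection.
    by move=> t /= ht; rewrite /xsection/= inE.
  move=> /(_ hB1); apply: negligibleS => t.
  by rewrite /xsection/= inE.
Qed.

(** The line through [x0] may lie wholly in the exceptional set. For each [t] the bad shifts are
    null by [rademacher], so by Fubini almost every shift gives a good line, and small shifts have
    positive measure. *)
Lemma ae_adiff_line k (W : 'rV[R]_k -> R) (L : R) (x0 v : 'rV[R]_k) (e : R) :
  0 < e -> (forall x y : 'rV[R]_k, `|W x - W y| <= L * `|x - y|) ->
  exists y : 'rV[R]_k, `|y| < e /\
    mu.-negligible [set t | ~ adiff id W (x0 + y + t *: v)].
Proof.
move=> e0 lip; have [d [T [m [p [mp pos IH]]]]] := rademacher k.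
pose T' := (T * measurableTypeR R)%type.
pose p' (x : T') := x0 + p x.1 + x.2 *: v.
have mp' j : measurable_fun setT (fun x : T' => p' x 0 j).
  have -> : (fun x : T' => p' x 0 j) = (fun x => (x0 0 j + p x.1 0 j) + x.2 * v 0 j).
    by apply/funext => x; rewrite !mxE.
  apply: measurable_funD.
    apply: measurable_funD => //.
    by apply: (measurableT_comp (mp j)); exact: measurable_fst.
  by apply: measurable_funM => //; exact: measurable_snd.
pose B : set T' := [set x | ~ adiff id W (p' x)].
have mB : measurable B.
  by apply: measurableC; exact: measurable_adiff lip mp'.
have : m.-negligible [set x | mu (xsection B x) != 0%E].
  apply: null_ysection => // t; apply: measure_negligible.
    exact: measurable_ysection.
  have : m.-negligible [set x | ~ adiff id (fun y => W (x0 + t *: v + y)) (p x)].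
    apply: (IH _ L) => y z; apply: le_trans (lip _ _) _.
    by rewrite opprD addrACA subrr add0r.
  apply: negligibleS => x; rewrite /ysection/= inE /B/= => h1 h2.
  apply: h1 => r r0; have [q [dd [dd0 hq]]] := h2 r r0; exists q, dd; split => // z zd.
  by have := hq z zd; rewrite /p'/= addrA -!(addrAC _ (p x)) (addrAC _ (t *: v)).
move=> [N [mN N0 NB]].
have [x [px Nx]] : exists x, `|p x| < e /\ ~ N x.
  apply: contrapT => /forallNP h; have /negP := pos e e0; apply.
  have mA : measurable [set x | `|p x| < e].
    apply: (@measurable_preimage_open _ _ _ _ p [set y | `|y| < e]) => //.
    have -> : [set y : 'rV[R]_k | `|y| < e] = ball 0 e.
      by rewrite mx_norm_ball; apply/seteqP; split => y /=; rewrite /ball_ sub0r normrN.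
    exact: ball_open.
  apply/eqP; apply: measure_negligible => //.
  exists N; split => // x /= hx; apply: contrapT => nNx; exact: (h x).
exists (p x); split => //.
have mu0 : mu (xsection B x) = 0%E.
  by apply/eqP; apply: contrapT => /negP h; apply: Nx; apply: NB.
exists (xsection B x); split => //; first exact: measurable_xsection.
by move=> t /= ht; rewrite /xsection/= inE.
Qed.

End rademacher.

(** * From differentials at nearby points to increments at every point *)

Section dini.
Context {R : realType}.
Notation mu := (@lebesgue_measure R).

(** [S e a] reads: [a] is an approximation with error [e]. The limit is the supremum of the lower
    estimates [a - e]. It serves for slopes in [adiff_total] and for Picard iterates. *)
Lemma consistent_limit (S : R -> R -> Prop) :
  (exists e a, S e a) ->
  (forall e a e' a', S e a -> S e' a' -> `|a - a'| <= e + e') ->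
  exists A, forall e a, S e a -> `|A - a| <= e.
Proof.
move=> [e0 [a0 S0]] comp.
pose E := [set x | exists e a, S e a /\ x = a - e].
have ubE e a : S e a -> ubound E (a + e).
  move=> Sea _ [e' [a' [Sea' ->]]]; have := comp _ _ _ _ Sea Sea'.
  by rewrite ler_norml => /andP[h1 h2]; lra.
have supE : has_sup E by split; [exists (a0 - e0), e0, a0|exists (a0 + e0); exact: ubE].
exists (sup E) => e a Sea; rewrite ler_norml; apply/andP; split.
  have : a - e <= sup E by apply: ub_le_sup; [exact: supE.2|exists e, a].
  lra.
have : sup E <= a + e by apply: ge_sup; [exact: supE.1|exact: ubE].
lra.
Qed.

(** Two slopes valid with errors [e] and [e'] are compared on a small multiple of a coordinate
    vector, where both approximate the same increment of [W]; so each coordinate of the slope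
    converges. *)
Lemma adiff_total k (W : 'rV[R]_k -> R) (y : 'rV[R]_k) : adiff id W y ->
  exists Q : 'cV[R]_k, forall e : R, 0 < e -> exists d : R, 0 < d /\ linapp id W Q d e y.
Proof.
move=> ad.
pose S (j : 'I_k) (e a : R) := 0 < e /\ exists (q : 'cV[R]_k) (d : R),
  [/\ 0 < d, linapp id W q d e y & q j 0 = a].
have Sex j : exists e a, S j e a.
  have [q [d [d0 hq]]] := ad 1 ltr01.
  by exists 1, (q j 0); split => //; exists q, d.
have Scomp j e a e' a' : S j e a -> S j e' a' -> `|a - a'| <= e + e'.
  move=> [e0 [q [d [d0 hq <-]]]] [e0' [q' [d' [d0' hq' <-]]]].
  pose s := Num.min d d' / 2.
  have m0 : 0 < Num.min d d' by rewrite lt_min d0.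
  have s0 : 0 < s by rewrite /s; lra.
  have sd : s < d by have := ge_min d d d'; rewrite lexx /s => /= ?; lra.
  have sd' : s < d' by have := ge_min d' d d'; rewrite lexx orbT /s => ?; lra.
  pose z : 'rV[R]_k := s *: delta_mx 0 j.
  have zE (p : 'cV[R]_k) : (z *m p) 0 0 = s * p j 0.
    by rewrite /z -scalemxAl mxE -rowE mxE.
  have nz : `|z| <= s.
    apply: rV_norm_le; first exact: ltW.
    move=> i; rewrite !mxE/=; case: eqP => _; rewrite ?mulr1 ?mulr0 ?normr0 ?gtr0_norm//.
    exact: ltW.
  have h1 := hq z (le_lt_trans nz sd); have h2 := hq' z (le_lt_trans nz sd').
  rewrite !zE in h1 h2.
  have : `|s * (q j 0 - q' j 0)| <= s * (e + e').
    have -> : s * (q j 0 - q' j 0) =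
      (W (y + id z) - W y - s * q' j 0) - (W (y + id z) - W y - s * q j 0) by ring.
    apply: le_trans (ler_normB _ _) _.
    apply: le_trans (lerD h2 h1) _; rewrite -mulrDl mulrC (addrC e') ler_wpM2r//.
    by rewrite addr_ge0// ltW.
  by rewrite normrM gtr0_norm// ler_pM2l.
have Q_ j : exists A, forall e a, S j e a -> `|A - a| <= e.
  exact: consistent_limit (Sex j) (@Scomp j).
pose Q : 'cV[R]_k := \col_j sval (cid (Q_ j)).
(* One error [e1] comes from [q], and one from each of the [k] coordinates of [Q - q]. *)
exists Q => e e0; pose e1 := e / (k.+1%:R).
have k0 : 0 < k.+1%:R :> R by [].
have e10 : 0 < e1 by rewrite divr_gt0.
have [q [d [d0 hq]]] := ad e1 e10; exists d; split => // z zd.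
have -> : W (y + id z) - W y - (z *m Q) 0 0 =
  (W (y + id z) - W y - (z *m q) 0 0) - (z *m (Q - q)) 0 0.
  by rewrite mulmxBr !mxE; ring.
apply: le_trans (ler_normB _ _) _.
have h2 : `|(z *m (Q - q)) 0 0| <= k%:R * e1 * `|z|.
  apply: rV_mulmx_le => j; rewrite !mxE; apply: (svalP (cid (Q_ j))).
  by split => //; exists q, d.
apply: le_trans (lerD (hq z zd) h2) _.
rewrite -mulrDl ler_wpM2r// -{1}[e1]mul1r -mulrDl /e1.
rewrite mulrCA (_ : 1 + k%:R = k.+1%:R); last by rewrite -natr1 addrC.
by rewrite divff ?mulr1// gt_eqF.
Qed.

Lemma adiff_differentiable k (W : 'rV[R]_k -> R) (y : 'rV[R]_k) :
  adiff id W y -> differentiable W y.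
Proof.
move=> /adiff_total[Q hQ].
pose f (z : 'rV[R]_k) : R := (z *m Q) 0 0.
have linf : linear f.
  by move=> a u v; rewrite /f mulmxDl -scalemxAl !mxE.
pose df : {linear 'rV[R]_k -> R} := HB.pack f (GRing.isLinear.Build _ _ _ _ f linf).
have cf : continuous (df : 'rV[R]_k -> R).
  pose M := \big[Num.max/0]_j `|Q j 0|.
  apply: (@lip_continuous _ _ _ (k%:R * M)) => u v.
  rewrite -linearB /= /f; apply: rV_mulmx_le => j.
  exact: (le_bigmax _ (fun j => `|Q j 0|)).
apply/diff_locallyP.
rewrite (@diff_unique _ _ _ W df y cf); [split => //|]; apply/eqaddoP => e e0;
  have [d [d0 hd]] := hQ e e0; apply/nbhs_ballP; exists d => //= z;
  rewrite mx_norm_ball /ball_ /= sub0r normrN => zd;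
  have := hd z zd; rewrite /= /f !fctE /=;
  by rewrite (addrC z y) opprD addrA.
Qed.

Lemma diff_dini k (W : 'rV[R]_k -> R) (x v : 'rV[R]_k) (c : R) :
  differentiable W x -> 'd W x v <= c ->
  forall e : R, 0 < e -> exists d : R, 0 < d /\ forall h : R, 0 < h -> h < d ->
    W (x + h *: v) - W x <= (c + e) * h.
Proof.
move=> dW dc e e0.
have dv : derivable W x v by exact: diff_derivable.
have /cvgrPdist_le/(_ _ e0) := dv.
rewrite near_withinE => -[d /= d0 hd]; exists d; split => // h h0 hlt.
have := hd h; rewrite /= sub0r normrN gtr0_norm// => /(_ hlt).
rewrite gt_eqF// => /(_ isT).
have -> : lim (h^-1 *: (W (h *: v + x) - W x) @[h --> 0^']) = 'd W x v.
  by rewrite -deriveE.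
rewrite ler_norml => /andP[h1 _].
have : h^-1 *: (W (h *: v + x) - W x) <= c + e by lra.
by rewrite -[_ *: _]/(_ * _) mulrC ler_pdivrMr// (addrC x).
Qed.

Lemma diff_dini_ge k (W : 'rV[R]_k -> R) (x v : 'rV[R]_k) (c : R) :
  differentiable W x ->
  (exists d : R, 0 < d /\ forall h : R, 0 < h -> h < d ->
    W (x + h *: v) - W x <= c * h) -> 'd W x v <= c.
Proof.
move=> dW [d1 [d10 h1]]; apply/ler_addgt0Pr => /= e e0.
have dv : derivable W x v by exact: diff_derivable.
have /cvgrPdist_le/(_ _ e0) := dv.
rewrite near_withinE => -[d /= d0 hd].
pose h := Num.min d d1 / 2.
have m0 : 0 < Num.min d d1 by rewrite lt_min d0.
have h0 : 0 < h by rewrite /h; lra.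
have hlt : h < d by have := ge_min d d d1; rewrite lexx /h => /= ?; lra.
have hlt1 : h < d1 by have := ge_min d1 d d1; rewrite lexx orbT /h => ?; lra.
have := hd h; rewrite /= sub0r normrN gtr0_norm// => /(_ hlt).
rewrite gt_eqF// => /(_ isT).
have -> : lim (h^-1 *: (W (h *: v + x) - W x) @[h --> 0^']) = 'd W x v.
  by rewrite -deriveE.
rewrite ler_norml => /andP[_ h2].
have : h^-1 *: (W (h *: v + x) - W x) <= c.
  by rewrite -[_ *: _]/(_ * _) mulrC ler_pdivrMr// (addrC _ x); exact: h1.
lra.
Qed.

(** Projection onto the closed ball of the max norm around [x0]. It does not increase distances in
    that norm, so composition with it makes local bounds global without changing values on the
    ball. *)
Definition clip k (x0 : 'rV[R]_k) (r : R) (y : 'rV[R]_k) : 'rV[R]_k :=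
  \row_j Num.max (x0 0 j - r) (Num.min (x0 0 j + r) (y 0 j)).

Lemma max_lip (a u w : R) : `|Num.max a u - Num.max a w| <= `|u - w|.
Proof.
have h1 := ler_norm (u - w); have h2 := ler_norm (w - u); rewrite distrC in h2.
have h0 := normr_ge0 (u - w).
by rewrite ler_norml; apply/andP; split;
  case: (leP a u) => ?; case: (leP a w) => ?; lra.
Qed.

Lemma min_lip (a u w : R) : `|Num.min a u - Num.min a w| <= `|u - w|.
Proof.
have h1 := ler_norm (u - w); have h2 := ler_norm (w - u); rewrite distrC in h2.
have h0 := normr_ge0 (u - w).
by rewrite ler_norml; apply/andP; split;
  case: (leP a u) => ?; case: (leP a w) => ?; lra.
Qed.

Lemma clip_lip k (x0 : 'rV[R]_k) r y z : `|clip x0 r y - clip x0 r z| <= `|y - z|.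
Proof.
apply: rV_norm_le => // j; rewrite !mxE; apply: le_trans (max_lip _ _ _) _.
apply: le_trans (min_lip _ _ _) _.
by have := rV_coord_le (y - z) j; rewrite !mxE.
Qed.

Lemma clip_id k (x0 : 'rV[R]_k) r y : `|y - x0| <= r -> clip x0 r y = y.
Proof.
move=> yr; apply/rowP => j; rewrite !mxE.
have := le_trans (rV_coord_le (y - x0) j) yr; rewrite !mxE ler_norml => /andP[h1 h2].
by rewrite min_r ?max_r//; lra.
Qed.

Lemma clip_in k (x0 : 'rV[R]_k) r y : 0 <= r -> `|clip x0 r y - x0| <= r.
Proof.
move=> r0; apply: rV_norm_le => // j; rewrite !mxE ler_norml; apply/andP; split.
  by have := le_max (x0 0 j - r) (x0 0 j - r) (Num.min (x0 0 j + r) (y 0 j)); rewrite lexx/= => ?; lra.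
rewrite lerBlDr ge_max; apply/andP; split; first lra.
by rewrite ge_min addrC lexx.
Qed.

(** The segment is shifted by a small [y] so that [W] is differentiable at almost all of its points;
    there [dini_ae_le] bounds the increment, and undoing the shift costs twice [L'] times the norm
    of [y]. *)
Lemma lip_dini k (W : 'rV[R]_k -> R) (x0 v : 'rV[R]_k) (d L c h : R) :
  0 < d -> (forall y z : 'rV[R]_k, `|y - x0| < d -> `|z - x0| < d ->
    `|W y - W z| <= L * `|y - z|) ->
  (forall y : 'rV[R]_k, `|y - x0| < d -> differentiable W y -> 'd W y v <= c) ->
  0 <= h -> h * `|v| < d -> W (x0 + h *: v) - W x0 <= c * h.
Proof.
move=> d0 lip0 hW h0 hv.
(* Midpoint between the length of the segment and [d]: clipping there leaves room for the shift and
   stays where [lip0] applies. *)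
pose d1 := (h * `|v| + d) / 2.
have hv0 : 0 <= h * `|v| by rewrite mulr_ge0.
have d1d : d1 < d by rewrite /d1; lra.
have d10 : 0 < d1 by rewrite /d1; lra.
have hvd1 : h * `|v| < d1 by rewrite /d1; lra.
pose W1 y := W (clip x0 d1 y).
have W1E (y : 'rV[R]_k) : `|y - x0| <= d1 -> W1 y = W y by move=> yd; rewrite /W1 clip_id.
have in_d y : `|clip x0 d1 y - x0| < d.
  by apply: le_lt_trans d1d; apply: clip_in; exact: ltW.
have [L' L'0 lip] : exists2 L' : R, 0 <= L' & forall y z : 'rV[R]_k, `|W1 y - W1 z| <= L' * `|y - z|.
  exists `|L| => // y z; apply: le_trans (lip0 _ _ (in_d y) (in_d z)) _.
  apply: (@le_trans _ _ (`|L| * `|clip x0 d1 y - clip x0 d1 z|)).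
    by rewrite ler_wpM2r// ler_norm.
  by rewrite ler_wpM2l// clip_lip.
apply/ler_addgt0Pr => /= e e0.
(* The first bound keeps the cost of the shift below [e], the second keeps the shifted segment
   within [d1]. *)
pose e1 := Num.min (e / (2 * (L' + 1))) ((d1 - h * `|v|) / 2).
have e10 : 0 < e1.
  rewrite lt_min; apply/andP; split; last lra.
  by rewrite divr_gt0//; lra.
have [y [ye1 Ny]] := @ae_adiff_line R k W1 L' x0 v e1 e10 lip.
have ye : L' * `|y| <= e / 2.
  apply: (@le_trans _ _ (L' * (e / (2 * (L' + 1))))).
    by rewrite ler_wpM2l//; apply: le_trans (ltW ye1) _; rewrite ge_min lexx.
  rewrite mulrA ler_pdivrMr; last lra.
  nra.
have yd1 : `|y| < d1 - h * `|v|.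
  apply: lt_trans ye1 _; rewrite gt_min; apply/orP; right; lra.
pose g t := W1 (x0 + y + t *: v).
have gin (t : R) : 0 <= t -> t <= h -> `|x0 + y + t *: v - x0| < d1.
  move=> t0 th; rewrite -(addrA x0 y) (addrC x0 (y + _)) addrK; apply: le_lt_trans (ler_normD _ _) _.
  rewrite normrZ ger0_norm//.
  have := ler_wpM2r (normr_ge0 v) th; lra.
have main : g h - g 0 <= c * (h - 0).
  apply: (@dini_ae_le R g 0 h c (L' * `|v|) _ h0 _ Ny).
    move=> s t _ _ _ _; apply: le_trans (lip _ _) _.
    by rewrite opprD addrACA subrr add0r -scalerBl normrZ mulrA mulrAC.
  move=> t t0 th /contrapT ad r r0.
  have tin := gin t t0 (ltW th).
  have ad' : adiff id W (x0 + y + t *: v).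
    move=> r1 r10; have [q [dd [dd0 hq]]] := ad r1 r10.
    pose dd' := Num.min dd (d1 - `|x0 + y + t *: v - x0|).
    exists q, dd'; split; first by rewrite lt_min dd0 subr_gt0.
    move=> z; rewrite lt_min => /andP[zd zd1]; have := hq z zd; rewrite !W1E//; first exact: ltW.
    rewrite /= -(addrA _ z) (addrC z) addrA; apply: le_trans (ler_normD _ _) _; lra.
  have dW := adiff_differentiable ad'.
  have dc := hW _ (lt_trans tin d1d) dW.
  have [dd [dd0 hdd]] := diff_dini dW dc r0.
  exists dd; split => // s s0 sd ts.
  have := hdd s s0 sd; rewrite /g !W1E; last 2 first.
  - exact: ltW.
  - by apply/ltW/gin => //; lra.
  by rewrite scalerDl addrA.
rewrite subr0 in main.
have E0 : g 0 = W1 (x0 + y) by rewrite /g scale0r addr0.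
have A1 : `|W1 (x0 + h *: v) - g h| <= L' * `|y|.
  apply: le_trans (lip _ _) _; rewrite ler_wpM2l//.
  by rewrite distrC (addrAC x0 y) (addrC (x0 + _) y) addrK.
have A2 : `|g 0 - W1 x0| <= L' * `|y|.
  rewrite E0; apply: le_trans (lip _ _) _; rewrite ler_wpM2l//.
  by rewrite (addrC x0) addrK.
have B1 : W1 (x0 + h *: v) = W (x0 + h *: v).
  by apply: W1E; rewrite (addrC x0) addrK normrZ ger0_norm// ltW.
have B2 : W1 x0 = W x0 by apply: W1E; rewrite subrr normr0 ltW.
rewrite -B1 -B2.
move: A1 A2; rewrite !ler_norml => /andP[_ ?] /andP[_ ?]; lra.
Qed.

End dini.

(** * Comparison functions *)

Section comparison.
Context {R : realType}.

Lemma within_ge0_continuousP (g : R -> R) :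
  {within `[0, +oo[, continuous g} <->
  (forall x : R, 0 <= x -> forall e : R, 0 < e -> exists d : R, 0 < d /\
     forall y : R, 0 <= y -> `|y - x| < d -> `|g y - g x| <= e).
Proof.
split => [/subspace_continuousP h x|h]; last apply/subspace_continuousP => x.
  move=> x0 e e0; have /(_ _)/cvgrPdist_le/(_ _ e0) := h x.
  rewrite /= in_itv/= andbT => /(_ x0); rewrite near_withinE => -[d /= d0 hd].
  exists d; split => // y y0 yd; rewrite distrC; apply: hd => //=.
    by rewrite distrC.
  by rewrite in_itv/= y0.
rewrite /= in_itv/= andbT => x0; apply/cvgrPdist_le => /= e e0.
have [d [d0 hd]] := h x x0 e e0.
rewrite near_withinE; exists d => //= y yd; rewrite in_itv/= andbT => y0.
by rewrite distrC; apply: hd => //; rewrite distrC.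
Qed.

Lemma K0 (g : R -> R) : isK g -> g 0 = 0. Proof. by case. Qed.

Lemma K_lt (g : R -> R) r s : isK g -> 0 <= r -> r < s -> g r < g s.
Proof. by move=> [_ [_ h]]; exact: h. Qed.

Lemma K_le (g : R -> R) r s : isK g -> 0 <= r -> r <= s -> g r <= g s.
Proof.
move=> Kg r0; rewrite le_eqVlt => /orP[/eqP ->//|rs].
by apply/ltW/K_lt.
Qed.

Lemma K_ge0 (g : R -> R) r : isK g -> 0 <= r -> 0 <= g r.
Proof. by move=> Kg r0; rewrite -(K0 Kg) K_le. Qed.

Lemma K_gt0 (g : R -> R) r : isK g -> 0 < r -> 0 < g r.
Proof. by move=> Kg r0; rewrite -{1}(K0 Kg) K_lt. Qed.

Lemma K_cont (g : R -> R) : isK g -> forall x : R, 0 <= x -> forall e : R, 0 < e ->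
  exists d : R, 0 < d /\ forall y : R, 0 <= y -> `|y - x| < d -> `|g y - g x| <= e.
Proof. by move=> [_ [/within_ge0_continuousP h _]]. Qed.

Lemma K_inj_le (g : R -> R) r s : isK g -> 0 <= r -> 0 <= s -> g r <= g s -> r <= s.
Proof. by move=> Kg r0 s0 h; rewrite leNgt; apply/negP => /(K_lt Kg s0); rewrite ltNge h. Qed.

Lemma K_comp (g h : R -> R) : isK g -> isK h -> isK (g \o h).
Proof.
move=> Kg Kh; split; first by rewrite /= (K0 Kh) (K0 Kg).
split; last by move=> r s r0 rs /=; apply: K_lt (K_ge0 Kh r0) (K_lt Kh r0 rs).
apply/within_ge0_continuousP => x x0 e e0.
have [d [d0 hd]] := K_cont Kg (K_ge0 Kh x0) e0.
have d2 : 0 < d / 2 by lra.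
have [d' [d'0 hd']] := K_cont Kh x0 d2.
exists d'; split => // y y0 yd; apply: hd; first exact: K_ge0.
by have := hd' y y0 yd; lra.
Qed.

Lemma Kinf_comp (g h : R -> R) : isKinf g -> isKinf h -> isKinf (g \o h).
Proof.
move=> [Kg ug] [Kh uh]; split; first exact: K_comp.
move=> M; have [r [r0 hr]] := ug M; have [s [s0 hs]] := uh r.
by exists s; split => //=; apply: lt_trans hr _; exact: K_lt.
Qed.

Lemma K_add (g h : R -> R) : isK g -> isK h -> isK (fun r => g r + h r).
Proof.
move=> Kg Kh; split; first by rewrite (K0 Kh) (K0 Kg) addr0.
split; last by move=> r s r0 rs; apply: ltrD; exact: K_lt.
apply/within_ge0_continuousP => x x0 e e0.
have e2 : 0 < e / 2 by lra.
have [d [d0 hd]] := K_cont Kg x0 e2.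
have [d' [d'0 hd']] := K_cont Kh x0 e2.
exists (Num.min d d'); split; first by rewrite lt_min d0.
move=> y y0; rewrite lt_min => /andP[h1 h2].
rewrite opprD addrACA; apply: le_trans (ler_normD _ _) _.
by have := hd y y0 h1; have := hd' y y0 h2; lra.
Qed.

Lemma Kinf_add (g h : R -> R) : isKinf g -> isK h -> isKinf (fun r => g r + h r).
Proof.
move=> [Kg ug] Kh; split; first exact: K_add.
move=> M; have [r [r0 hr]] := ug M; exists r; split => //.
by have := K_ge0 Kh r0; lra.
Qed.

Lemma Kinf_scale (c : R) : 0 < c -> isKinf (fun r => c * r).
Proof.
move=> c0; split; last first.
  move=> M; exists ((`|M| + 1) / c); split; first by rewrite divr_ge0// ?ltW// addr_ge0.
  by rewrite mulrCA divff ?mulr1 ?gt_eqF//; have := ler_norm M; lra.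
split; first by rewrite mulr0.
split; last by move=> r s r0 rs; rewrite ltr_pM2l.
apply/within_ge0_continuousP => x x0 e e0; exists (e / c); rewrite divr_gt0//; split => // y y0 yd.
by rewrite -mulrBr normrM gtr0_norm// mulrC -ler_pdivlMr// ltW.
Qed.

Lemma Kinf_id : isKinf (fun r : R => r).
Proof.
have := @Kinf_scale 1 ltr01; congr isKinf; by apply/funext => r; rewrite mul1r.
Qed.

Lemma K_addKinf0 (g h : R -> R) : isKinf g -> isKinf0 h -> isKinf (fun r => g r + h r).
Proof.
move=> Kg [[Kh _]|h0]; first exact: Kinf_add.
move: Kg => [[g0 [cg sg]] ug]; split; last first.
  by move=> M; have [r [r0 hr]] := ug M; exists r; rewrite h0// addr0.
split; first by rewrite g0 h0// addr0.
split; last by move=> r s r0 rs; rewrite !h0 ?addr0; [exact: sg|lra|].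
apply/within_ge0_continuousP => x x0 e e0.
have [d [d0 hd]] := (within_ge0_continuousP g).1 cg x x0 e e0.
by exists d; split => // y y0 yd; rewrite !h0// !addr0; exact: hd.
Qed.

Lemma Kinf_sum n (g : 'I_n -> R -> R) (h : R -> R) : isKinf h ->
  (forall i, isKinf0 (g i)) -> isKinf (fun r => h r + \sum_(i < n) g i r).
Proof.
elim: n g h => [|n IH] g h Kh Kg.
  by have := Kh; congr isKinf; apply/funext => r; rewrite big_ord0 addr0.
have := IH (fun i => g (lift ord0 i)) (fun r => h r + g ord0 r)
  (K_addKinf0 Kh (Kg ord0)) (fun i => Kg _).
by congr isKinf; apply/funext => r; rewrite big_ord_recl addrA.
Qed.

Lemma K_sum n (g : 'I_n -> R -> R) (h : R -> R) : isK h ->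
  (forall i, isK (g i)) -> isK (fun r => h r + \sum_(i < n) g i r).
Proof.
elim: n g h => [|n IH] g h Kh Kg.
  by have := Kh; congr isK; apply/funext => r; rewrite big_ord0 addr0.
have := IH (fun i => g (lift ord0 i)) (fun r => h r + g ord0 r)
  (K_add Kh (Kg ord0)) (fun i => Kg _).
by congr isK; apply/funext => r; rewrite big_ord_recl addrA.
Qed.

Lemma Kinf0_le (g : R -> R) r s : isKinf0 g -> 0 <= r -> r <= s -> g r <= g s.
Proof.
by move=> [[Kg _] r0 rs|h r0 rs]; [exact: K_le|rewrite !h//; exact: le_trans rs].
Qed.

Lemma Kinf0_ge0 (g : R -> R) r : isKinf0 g -> 0 <= r -> 0 <= g r.
Proof. by move=> [[Kg _] r0|h r0]; [exact: K_ge0|rewrite h]. Qed.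

Lemma Kinf0_cont (g : R -> R) : isKinf0 g -> forall x : R, 0 <= x -> forall e : R, 0 < e ->
  exists d : R, 0 < d /\ forall y : R, 0 <= y -> `|y - x| < d -> `|g y - g x| <= e.
Proof.
move=> [[Kg _]|h] x x0 e e0; first exact: K_cont.
by exists 1; split => // y y0 _; rewrite !h// subrr normr0 ltW.
Qed.

Lemma Kinf_surj (g : R -> R) (v : R) : isKinf g -> 0 <= v -> exists r : R, 0 <= r /\ g r = v.
Proof.
move=> [Kg ug] v0; have [b [b0 hb]] := ug v.
have cg : {within `[0, b], continuous g}.
  apply: continuous_subspaceW Kg.2.1.
  by move=> x /=; rewrite !in_itv/= => /andP[-> _].
have [|c] := @IVT R g 0 b v b0 cg.
  by rewrite (K0 Kg) ge_min v0/= le_max (ltW hb) orbT.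
by rewrite in_itv/= => /andP[c0 _] gc; exists c.
Qed.

(* A monotone bijection of the half-line is continuous. *)
Lemma inverse_Kinf (g h : R -> R) : isKinf g ->
  (forall r : R, 0 <= r -> h (g r) = r) -> isKinf h.
Proof.
move=> Kg hg.
have hE (v : R) : 0 <= v -> 0 <= h v /\ g (h v) = v.
  by move=> v0; have [r [r0 <-]] := Kinf_surj Kg v0; rewrite hg.
have hlt (v w : R) : 0 <= v -> v < w -> h v < h w.
  move=> v0 vw; have [hv0 hv] := hE v v0; have [hw0 hw] := hE w ltac:(lra).
  rewrite ltNge; apply/negP => /(K_le Kg.1 hw0); lra.
have h0 : h 0 = 0 by rewrite -{1}(K0 Kg.1) hg.
split; last first.
  move=> M; exists (g (`|M| + 1)); split; first by apply: K_ge0 Kg.1 _; rewrite addr_ge0.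
  by rewrite hg ?addr_ge0//; have := ler_norm M; lra.
split => //; split; last exact: hlt.
apply/within_ge0_continuousP => y y0 e e0.
have [x0 gx] := hE y y0; set x := h y in x0 gx *.
have up : g x < g (x + e) by apply: K_lt Kg.1 _ _; lra.
have xe0 : 0 <= x + e by lra.
pose dl := if 0 <= x - e then y - g (x - e) else 1.
have dl0 : 0 < dl.
  rewrite /dl; case: ifPn => // h1; rewrite -gx subr_gt0; apply: K_lt Kg.1 _ _; lra.
exists (Num.min (g (x + e) - y) dl); split; first by rewrite lt_min dl0 andbT; lra.
move=> z z0; rewrite lt_min => /andP[zu zl].
move: zu zl; rewrite !ltr_norml => /andP[_ zu] /andP[zl _].
have [hz0 gz] := hE z z0.
rewrite ler_norml; apply/andP; split; last first.
  have : h z < h (g (x + e)) by apply: hlt => //; lra.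
  by rewrite hg//; lra.
move: zl; rewrite /dl; case: ifPn => h1 zl; last by move: h1; rewrite -ltNge; lra.
have : h (g (x - e)) < h z by apply: hlt; [exact: K_ge0 Kg.1 _|lra].
by rewrite hg//; lra.
Qed.

Lemma Kinf_inverse (g : R -> R) : isKinf g ->
  exists h, isKinf h /\ forall r : R, 0 <= r -> h (g r) = r /\ g (h r) = r.
Proof.
move=> Kg.
have ex (v : R) : exists r : R, 0 <= v -> 0 <= r /\ g r = v.
  have [v0|v0] := pselect (0 <= v); last by exists 0.
  by have [r hr] := Kinf_surj Kg v0; exists r.
pose h v := sval (cid (ex v)).
have hP v : 0 <= v -> 0 <= h v /\ g (h v) = v by exact: (svalP (cid (ex v))).
have hg r : 0 <= r -> h (g r) = r.
  move=> r0; have [h0 h1] := hP (g r) (K_ge0 Kg.1 r0).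
  by apply/le_anti/andP; split; apply: (K_inj_le Kg.1) => //; rewrite h1.
exists h; split; first exact: inverse_Kinf hg.
by move=> r r0; split; [exact: hg|case: (hP r r0)].
Qed.

(** [a] is an inf-convolution with the absolute value, capped by [|r|]: it is 1-Lipschitz, vanishes
    at [0] thanks to the cap, and is positive elsewhere by the bounds on compact intervals. It
    merges rates known on each compact range into one positive definite rate. *)
Lemma posdef_below (Q : R -> R -> Prop) :
  (forall s y, Q s y -> 0 <= y) ->
  (forall r1 r2 : R, 0 < r1 -> r1 <= r2 -> exists c : R, 0 < c /\
     forall s y, Q s y -> r1 <= s -> s <= r2 -> c <= y) ->
  exists a, posdef a /\ forall s y, Q s y -> a s <= y.
Proof.
move=> Q0 Qc.
pose E r := [set z | z = `|r| \/ exists s y, Q s y /\ z = y + `|s - r|].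
have lbE r : lbound (E r) 0.
  by move=> z [->//|[s [y [Qsy ->]]]]; rewrite addr_ge0// (Q0 s).
have infE r : has_inf (E r) by split; [exists `|r|; left|exists 0].
pose a r := inf (E r).
have a_le r z : E r z -> a r <= z by move=> ?; apply: ge_inf => //; case: (infE r).
have a_ge r c : lbound (E r) c -> c <= a r by move=> ?; apply: lb_le_inf => //; case: (infE r).
have lip r r' : a r' <= a r + `|r - r'|.
  rewrite -lerBlDr; apply: a_ge => z [->|[s [y [Qsy ->]]]]; rewrite lerBlDr.
    apply: le_trans (a_le _ _ (or_introl erefl)) _.
    by rewrite -{1}(subrKC r r') distrC; exact: ler_normD.
  apply: (@le_trans _ _ (y + `|s - r'|)); first by apply: a_le; right; exists s, y.
  by rewrite -addrA lerD2l; exact: ler_distD.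
exists a; split; last first.
  by move=> s y Qsy; apply: a_le; right; exists s, y; rewrite subrr normr0 addr0.
split; last split.
- apply/within_ge0_continuousP => x x0 e e0; exists e; split => // y y0 ye.
  rewrite ler_norml; apply/andP; split.
    by have := lip y x; lra.
  by have := lip x y; rewrite distrC; lra.
- by move=> r r0; exact: a_ge.
- move=> r r0; split => [ar0|->]; last first.
    by apply/eqP; rewrite eq_le a_ge// andbT; apply: a_le; left; rewrite normr0.
  apply/eqP; rewrite eq_le r0 andbT leNgt; apply/negP => r_gt0.
  have r2 : 0 < r / 2 by lra.
  (* A point with [s] at distance at least [r / 2] from [r] contributes at least [r / 2]; the others
     have [s] between [r / 2] and [2 * r]. *)
  have [c [c0 hc]] := Qc (r / 2) (2 * r) r2 ltac:(lra).
  have : Num.min (r / 2) c <= a r.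
    apply: a_ge => z [->|[s [y [Qsy ->]]]].
      by rewrite ge_min gtr0_norm//; apply/orP; left; lra.
    rewrite ge_min; have [h|h] := leP (r / 2) `|s - r|.
      by apply/orP; left; have := Q0 _ _ Qsy; lra.
    apply/orP; right; move: h; rewrite ltr_norml => /andP[h1 h2].
    have : c <= y by apply: (hc s) => //; lra.
    by have := normr_ge0 (s - r); lra.
  by rewrite ar0 leNgt lt_min r2 c0.
Qed.

End comparison.

(** * A KL bound from uniform boundedness and uniform attraction *)

Section KL.
Context {R : realType}.

Lemma within_quadrant_continuous (b : R -> R -> R) :
  (forall r t : R, 0 <= r -> 0 <= t -> forall e : R, 0 < e -> exists d : R, 0 < d /\
     forall r' t' : R, 0 <= r' -> 0 <= t' -> `|r' - r| < d -> `|t' - t| < d ->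
       `|b r' t' - b r t| <= e) ->
  {within [set p : R * R | 0 <= p.1 /\ 0 <= p.2], continuous (fun p : R * R => b p.1 p.2)}.
Proof.
move=> h; apply/subspace_continuousP => -[r t] /= [r0 t0].
apply/cvgrPdist_le => /= e e0; have [d [d0 hd]] := h r t r0 t0 e e0.
rewrite near_withinE; apply/nbhs_ballP; exists d => //= -[r' t'] [/= br bt] [/= r'0 t'0].
by rewrite distrC; apply: hd => //; rewrite distrC.
Qed.

(** Piecewise linear in [a / r]: [1] for [a <= r] and [0] for [a >= 2 * r]. The Lipschitz constant
    in [r] blows up like [1 / r] at [0], where the bound [phi (2 * r)] gives continuity instead. *)
Definition kap (a r : R) : R :=
  if 0 < r then Num.max 0 (Num.min 1 (2 - a / r)) else 0.
Definition kat (s t : R) : R := Num.max 0 (Num.min 1 (1 + s - t)).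

Lemma clamp01 (x : R) : 0 <= Num.max 0 (Num.min 1 x) <= 1.
Proof. by rewrite le_max lexx/= ge_max ler01 ge_min lexx. Qed.

Lemma kap01 a r : 0 <= kap a r <= 1.
Proof. by rewrite /kap; case: ifP => _; [exact: clamp01|rewrite lexx ler01]. Qed.

Lemma kat01 s t : 0 <= kat s t <= 1.
Proof. exact: clamp01. Qed.

Lemma kap1 (a r : R) : 0 < r -> a <= r -> kap a r = 1.
Proof.
move=> r0 ar; rewrite /kap r0.
have : a / r <= 1 by rewrite ler_pdivrMr// mul1r.
by move=> h; rewrite min_l ?max_r//; lra.
Qed.

Lemma kap0 (a r : R) : 2 * r <= a -> kap a r = 0.
Proof.
move=> ar; rewrite /kap; case: ifP => // r0.
have : 2 <= a / r by rewrite ler_pdivlMr.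
by move=> h; rewrite max_l// ge_min; apply/orP; right; lra.
Qed.

Lemma kat1 (s t : R) : t <= s -> kat s t = 1.
Proof. by move=> ts; rewrite /kat min_l ?max_r//; lra. Qed.

Lemma kat0 (s t : R) : s <= t - 1 -> kat s t = 0.
Proof. by move=> ts; rewrite /kat max_l// ge_min; apply/orP; right; lra. Qed.

Lemma clamp_mono (x y : R) : x <= y ->
  Num.max 0 (Num.min 1 x) <= Num.max 0 (Num.min 1 y).
Proof.
move=> xy; rewrite ge_max; apply/andP; split; first by rewrite le_max lexx.
rewrite le_max; apply/orP; right; rewrite le_min !ge_min lexx/=.
by apply/orP; right.
Qed.

Lemma kap_mono (a r r' : R) : 0 <= a -> r <= r' -> kap a r <= kap a r'.
Proof.
move=> a0 rr; rewrite /kap; case: ifP => [r0|_]; last first.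
  by case: ifP => // _; case/andP: (clamp01 (2 - a / r')).
have r'0 : 0 < r' by lra.
rewrite r'0; apply: clamp_mono; rewrite lerD2l lerN2 ler_wpM2l//.
by rewrite lef_pV2// posrE.
Qed.

Lemma kat_anti (s t t' : R) : t <= t' -> kat s t' <= kat s t.
Proof. by move=> tt; apply: clamp_mono; lra. Qed.

Lemma kat_lip (s t t' : R) : `|kat s t - kat s t'| <= `|t - t'|.
Proof.
apply: le_trans (max_lip _ _ _) _; apply: le_trans (min_lip _ _ _) _.
by rewrite opprD addrACA subrr add0r opprK addrC distrC.
Qed.

Lemma kap_lip (a r r' r0 : R) : 0 <= a -> 0 < r0 -> r0 <= r -> r0 <= r' ->
  `|kap a r - kap a r'| <= 2 / r0 * `|r - r'|.
Proof.
move=> a0 r00; wlog rr : r r' / r <= r'.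
  move=> H h1 h2; have [/H|/ltW/H] := leP r r'; first exact.
  by rewrite distrC (distrC r r'); exact.
move=> h1 h2.
have rp : 0 < r by lra.
have rp' : 0 < r' by lra.
have [a2|a2] := leP (2 * r') a.
  have a2' : 2 * r <= a by lra.
  by rewrite !kap0// subrr normr0 mulr_ge0// divr_ge0// ltW.
rewrite /kap rp rp'.
apply: le_trans (max_lip _ _ _) _; apply: le_trans (min_lip _ _ _) _.
have -> : 2 - a / r - (2 - a / r') = - (a / r' * ((r' - r) / r)).
  by field; rewrite !gt_eqF.
rewrite normrN ger0_norm; last by rewrite mulr_ge0// divr_ge0//; lra.
rewrite distrC ger0_norm; last lra.
have i1 : a / r' <= 2 by rewrite ler_pdivrMr//; exact: ltW.
have i2 : (r' - r) / r <= (r' - r) / r0.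
  by rewrite ler_wpM2l; [|lra|rewrite lef_pV2// posrE].
rewrite [leRHS](_ : _ = 2 * ((r' - r) / r0)); last by ring.
apply: ler_pM => //.
  by rewrite divr_ge0// ltW.
by rewrite divr_ge0//; lra.
Qed.

(* [beta] is the supremum over [S] of [y] times continuous cut-offs of [a] at [2 r] and of [s]
   below [t]; the extra term [r / (1 + t)] makes it strictly increasing in [r]. *)
Lemma KL_bound (S : R -> R -> R -> Prop) (phi : R -> R) : isK phi ->
  (forall a s y, S a s y -> 0 <= a /\ 0 <= s /\ y <= phi a) ->
  (forall r e : R, 0 < e -> exists T : R, forall a s y, S a s y -> a <= r -> T <= s -> y <= e) ->
  exists beta, isKL beta /\ forall a s y, S a s y -> y <= beta a s.
Proof.
move=> Kphi S1 S2.
pose f (a s y r t : R) := Num.max 0 y * (kap a r * kat s t).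
pose E r t := [set z : R | z = 0 \/ exists a s y, S a s y /\ z = f a s y r t].
have kk01 a s r t : 0 <= kap a r * kat s t <= 1.
  have /andP[? ?] := kap01 a r; have /andP[? ?] := kat01 s t.
  by rewrite mulr_ge0//= mulr_ile1.
have y0 (y : R) : 0 <= Num.max 0 y by rewrite le_max lexx.
have f_ge0 a s y r t : 0 <= f a s y r t.
  by rewrite mulr_ge0//; case/andP: (kk01 a s r t).
have f_le a s y r t : S a s y -> 0 <= r -> f a s y r t <= phi (2 * r).
  move=> Sasy r0; have [a0 [_ yphi]] := S1 _ _ _ Sasy.
  have p0 : 0 <= phi (2 * r) by apply: K_ge0 => //; lra.
  have [h|h] := leP (2 * r) a; first by rewrite /f kap0// mul0r mulr0.
  apply: (@le_trans _ _ (Num.max 0 y)).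
    by rewrite /f ler_piMr//; case/andP: (kk01 a s r t).
  rewrite ge_max p0/=; apply: le_trans yphi _; apply: K_le => //; exact: ltW.
have supE r t : 0 <= r -> has_sup (E r t).
  move=> r0; split; first by exists 0; left.
  exists (phi (2 * r)) => z [->|[a [s [y [Sasy ->]]]]]; last exact: f_le.
  by apply: K_ge0 => //; lra.
pose b0 r t := sup (E r t).
have b0_ge0 r t : 0 <= r -> 0 <= b0 r t.
  by move=> r0; apply: ub_le_sup; [exact: (supE r t r0).2|left].
have b0_ge a s y r t : 0 <= r -> S a s y -> f a s y r t <= b0 r t.
  by move=> r0 Sasy; apply: ub_le_sup; [exact: (supE r t r0).2|right; exists a, s, y].
have b0_le r t c : 0 <= r -> 0 <= c -> (forall a s y, S a s y -> f a s y r t <= c) -> b0 r t <= c.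
  move=> r0 c0 h; apply: ge_sup; first exact: (supE r t r0).1.
  by move=> z [->//|[a [s [y [Sasy ->]]]]]; exact: h.
have b0_phi r t : 0 <= r -> b0 r t <= phi (2 * r).
  move=> r0; apply: b0_le => //; first by apply: K_ge0 => //; lra.
  by move=> a s y Sasy; exact: f_le.
have b0_mono r r' t : 0 <= r -> r <= r' -> b0 r t <= b0 r' t.
  move=> r0 rr; have r'0 : 0 <= r' by lra.
  apply: b0_le => //; first exact: b0_ge0.
  move=> a s y Sasy; apply: le_trans (b0_ge a s y r' t r'0 Sasy).
  rewrite /f ler_wpM2l// ler_wpM2r//; first by case/andP: (kat01 s t).
  by apply: kap_mono => //; case: (S1 _ _ _ Sasy).
have b0_anti r t t' : 0 <= r -> t <= t' -> b0 r t' <= b0 r t.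
  move=> r0 tt; apply: b0_le => //; first exact: b0_ge0.
  move=> a s y Sasy; apply: le_trans (b0_ge a s y r t r0 Sasy).
  rewrite /f ler_wpM2l// ler_wpM2l//; first by case/andP: (kap01 a r).
  exact: kat_anti.
have b00 t : b0 0 t = 0.
  apply/le_anti/andP; split; last exact: b0_ge0.
  by have := b0_phi 0 t (lexx 0); rewrite mulr0 (K0 Kphi).
(* For radii up to [2 * r0] only triples with [a < 4 * r0] contribute, and their [y] is at most
   [phi (4 * r0)]. *)
have b0_lip r0 r r' t t' : 0 < r0 -> r0 <= r -> r0 <= r' -> r <= 2 * r0 -> r' <= 2 * r0 ->
    b0 r t <= b0 r' t' + phi (4 * r0) * (2 / r0 * `|r - r'| + `|t - t'|).
  move=> r00 h1 h2 h3 h4.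
  have p4 : 0 <= phi (4 * r0) by apply: K_ge0 => //; lra.
  have i0 : 0 <= 2 / r0 by rewrite divr_ge0// ltW.
  have C0 : 0 <= phi (4 * r0) * (2 / r0 * `|r - r'| + `|t - t'|).
    by rewrite mulr_ge0// addr_ge0// mulr_ge0.
  apply: b0_le; [lra| |].
    by rewrite addr_ge0// b0_ge0//; lra.
  move=> a s y Sasy; have [a0 [_ yphi]] := S1 _ _ _ Sasy.
  have := b0_ge a s y r' t' ltac:(lra) Sasy => h; apply: (@le_trans _ _ _ _ _ _ (lerD h (lexx _))).
  have [h5|h5] := leP (4 * r0) a.
    rewrite {1}/f kap0; last lra.
    by rewrite mul0r mulr0 addr_ge0.
  rewrite -lerBlDl /f -mulrBr.
  have yp : Num.max 0 y <= phi (4 * r0).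
    by rewrite ge_max p4/=; apply: le_trans yphi _; apply: K_le => //; exact: ltW.
  apply: (@le_trans _ _ (Num.max 0 y * `|kap a r * kat s t - kap a r' * kat s t'|)).
    by rewrite ler_wpM2l// ler_norm.
  apply: ler_pM => //.
  have -> : kap a r * kat s t - kap a r' * kat s t' =
     (kap a r - kap a r') * kat s t + kap a r' * (kat s t - kat s t') by ring.
  apply: le_trans (ler_normD _ _) _; rewrite !normrM; apply: lerD.
    have /andP[k0 k1] := kat01 s t.
    rewrite (ger0_norm k0); apply: (@le_trans _ _ (`|kap a r - kap a r'| * 1)).
      by rewrite ler_wpM2l.
    by rewrite mulr1; exact: kap_lip.
  have /andP[k0 k1] := kap01 a r'.
  rewrite (ger0_norm k0); apply: (@le_trans _ _ (1 * `|kat s t - kat s t'|)).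
    by rewrite ler_wpM2r.
  by rewrite mul1r; exact: kat_lip.
pose beta r t := b0 r t + r / (1 + t).
have beta_cont (r t : R) : 0 <= r -> 0 <= t -> forall e : R, 0 < e -> exists d : R, 0 < d /\
     forall r' t' : R, 0 <= r' -> 0 <= t' -> `|r' - r| < d -> `|t' - t| < d ->
       `|beta r' t' - beta r t| <= e.
  move=> r0 t0 e e0.
  have frac (r' t' d : R) : 0 <= r' -> 0 <= t' -> `|r' - r| < d -> `|t' - t| < d ->
      `|r' / (1 + t') - r / (1 + t)| <= d * (1 + r).
    move=> r'0 t'0 hr ht.
    have T1 : 0 < 1 + t by lra.
    have T2 : 0 < 1 + t' by lra.
    have -> : r' / (1 + t') - r / (1 + t) =
       (r' - r) * (1 + t')^-1 + r * ((t - t') * ((1 + t)^-1 * (1 + t')^-1)).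
      by field; rewrite !gt_eqF.
    have i1 : 0 <= (1 + t')^-1 <= 1 by rewrite invr_ge0 ltW//= invf_le1//; lra.
    have i2 : 0 <= (1 + t)^-1 <= 1 by rewrite invr_ge0 ltW//= invf_le1//; lra.
    move: i1 i2 => /andP[i1 i1'] /andP[i2 i2'].
    apply: le_trans (ler_normD _ _) _; rewrite !normrM mulrDr mulr1; apply: lerD.
      rewrite (ger0_norm i1); apply: (@le_trans _ _ (`|r' - r| * 1)).
        by rewrite ler_wpM2l.
      by rewrite mulr1 ltW.
    rewrite (ger0_norm r0) (ger0_norm i1) (ger0_norm i2) (mulrC d) ler_wpM2l//.
    apply: (@le_trans _ _ (`|t - t'| * 1)); last by rewrite mulr1 distrC ltW.
    by rewrite ler_wpM2l// mulr_ile1.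
  suff [d1 [d10 h1]] : exists d : R, 0 < d /\
     forall r' t' : R, 0 <= r' -> 0 <= t' -> `|r' - r| < d -> `|t' - t| < d ->
       `|b0 r' t' - b0 r t| <= e / 2.
    pose d := Num.min d1 (e / 2 / (1 + r)).
    have r1 : 0 < 1 + r by lra.
    exists d; split; first by rewrite lt_min d10 !divr_gt0.
    move=> r' t' r'0 t'0 hr ht.
    have hr1 : `|r' - r| < d1 by apply: lt_le_trans hr _; rewrite ge_min lexx.
    have ht1 : `|t' - t| < d1 by apply: lt_le_trans ht _; rewrite ge_min lexx.
    have A := h1 r' t' r'0 t'0 hr1 ht1.
    have B := frac r' t' d r'0 t'0 hr ht.
    have dC : d * (1 + r) <= e / 2.
      by rewrite -ler_pdivlMr// ge_min lexx orbT.
    rewrite /beta opprD addrACA; apply: le_trans (ler_normD _ _) _; lra.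
  have [->|rn0] := eqVneq r 0.
    have e2 : 0 < e / 2 by lra.
    have [d [d0 hd]] := K_cont Kphi (lexx 0) e2.
    exists (d / 2); split; first lra.
    move=> r' t' r'0 t'0; rewrite subr0 (ger0_norm r'0) => hr _.
    rewrite b00 subr0 ger0_norm ?b0_ge0//; apply: le_trans (b0_phi _ _ r'0) _.
    have := hd (2 * r') ltac:(lra); rewrite subr0 ger0_norm; last lra.
    rewrite (K0 Kphi) subr0 => /(_ ltac:(lra)).
    by apply: le_trans; exact: ler_norm.
  have rp : 0 < r by lra.
  (* Radii within [r / 4] of [r] lie between [q] and [2 * q], where [b0_lip] applies. *)
  pose q := 3 / 4 * r.
  have q0 : 0 < q by rewrite /q; lra.
  have p4 : 0 <= phi (4 * q) by apply: K_ge0 => //; lra.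
  pose M := phi (4 * q) * (2 / q + 1) + 1.
  have M0 : 0 < M.
    by rewrite /M ltr_wpDl// mulr_ge0// addr_ge0// divr_ge0// ltW.
  pose d := Num.min (r / 4) (e / 2 / M).
  exists d; split; first by rewrite lt_min; apply/andP; split; [lra|rewrite !divr_gt0].
  move=> r' t' r'0 t'0 hr ht.
  have hr4 : `|r' - r| < r / 4 by apply: lt_le_trans hr _; rewrite ge_min lexx.
  move: (hr4); rewrite ltr_norml => /andP[h3 h4].
  have dM : d * M <= e / 2 by rewrite -ler_pdivlMr// ge_min lexx orbT.
  have cc : phi (4 * q) * (2 / q * `|r' - r| + `|t' - t|) <= e / 2.
    apply: le_trans dM.
    have -> : d * M = d * (phi (4 * q) * (2 / q + 1)) + d by rewrite /M; ring.
    apply: (@le_trans _ _ (d * (phi (4 * q) * (2 / q + 1)))); last first.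
      by rewrite lerDl; apply: le_trans (ltW hr).
    rewrite [leRHS]mulrCA ler_wpM2l// mulrDr mulr1; apply: lerD; last exact: ltW.
    by rewrite mulrC ler_wpM2r ?ltW// divr_gt0.
  have A := b0_lip q r' r t' t q0 ltac:(rewrite /q; lra) ltac:(rewrite /q; lra)
    ltac:(rewrite /q; lra) ltac:(rewrite /q; lra).
  have B := b0_lip q r r' t t' q0 ltac:(rewrite /q; lra) ltac:(rewrite /q; lra)
    ltac:(rewrite /q; lra) ltac:(rewrite /q; lra).
  rewrite (distrC r) (distrC t) in B.
  by rewrite ler_norml; apply/andP; split; lra.
exists beta; split; last first.
  move=> a s y Sasy; have [a0 [s0 yphi]] := S1 _ _ _ Sasy.
  (* At [a = 0] the cut-off vanishes, but so does the bound [phi a] on [y]. *)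
  have [a_eq0|an0] := eqVneq a 0.
    rewrite a_eq0 /beta b00 mul0r addr0; move: yphi; by rewrite a_eq0 (K0 Kphi).
  have ap : 0 < a by rewrite lt_neqAle eq_sym an0.
  have := b0_ge a s y a s a0 Sasy; rewrite /f kap1// kat1// !mulr1 => h.
  have h2 : 0 <= a / (1 + s) by rewrite divr_ge0//; lra.
  have h3 : y <= Num.max 0 y by rewrite le_max lexx orbT.
  rewrite /beta; lra.
split; first exact: within_quadrant_continuous.
split.
  move=> t t0; have t1 : 0 < 1 + t by lra.
  split; first by rewrite /beta b00 mul0r addr0.
  split.
    apply/within_ge0_continuousP => x x0 e e0.
    have [d [d0 hd]] := beta_cont x t x0 t0 e e0.
    by exists d; split => // y y_0 yd; apply: hd => //; rewrite subrr normr0.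
  move=> r s r0 rs; rewrite /beta; apply: ler_ltD; first by apply: b0_mono => //; exact: ltW.
  by rewrite ltr_pM2r// invr_gt0.
move=> r r0; split.
  move=> s t s0 st; rewrite /beta; apply: lerD; first exact: b0_anti.
  by rewrite ler_wpM2l// lef_pV2 ?posrE; lra.
apply/cvgrPdist_le => /= e e0.
have e2 : 0 < e / 2 by lra.
have [T hT] := S2 (2 * r) (e / 2) e2.
(* Beyond [T + 1] the cut-off removes every [s <= T]; beyond [2 * r / e] the extra term is at most
   [e / 2]. *)
exists (Num.max (T + 1) (2 * r / e)); split; first by rewrite num_real.
move=> t; rewrite gt_max => /andP[tT te].
have re : 0 <= 2 * r / e by rewrite divr_ge0//; lra.
have t1 : 0 < 1 + t by lra.
rewrite sub0r normrN ger0_norm; last first.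
  by rewrite /beta addr_ge0// ?b0_ge0// divr_ge0//; lra.
have A : b0 r t <= e / 2.
  apply: b0_le => //; first lra.
  move=> a s y Sasy; have [h|h] := leP (2 * r) a.
    by rewrite /f kap0// mul0r mulr0; lra.
  have [h2|h2] := leP s (t - 1); first by rewrite /f kat0// !mulr0; lra.
  apply: (@le_trans _ _ (Num.max 0 y)).
    by rewrite /f ler_piMr//; case/andP: (kk01 a s r t).
  rewrite ge_max; apply/andP; split; first lra.
  by apply: (hT a s y) => //; lra.
have B : r / (1 + t) <= e / 2.
  rewrite ler_pdivrMr//; move: te; rewrite ltr_pdivrMr// => te; nra.
rewrite /beta; lra.
Qed.

End KL.

(** * Small gain: a bound by the input alone *)

Section small_gain.
Context {R : realType} (n : nat) (isSum : 'I_n -> bool) (gam : 'I_n -> 'I_n -> R -> R).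
Hypothesis Kgam : forall i j, isKinf0 (gam i j).

Lemma Gamma_le (v v' : 'I_n -> R) i : (forall j, 0 <= v j) -> (forall j, v j <= v' j) ->
  Gamma_op isSum gam v i <= Gamma_op isSum gam v' i.
Proof.
move=> v0 vv; rewrite /Gamma_op; case: ifP => _.
  by apply: ler_sum => j _; exact: Kinf0_le.
by apply: le_bigmax2 => j _; exact: Kinf0_le.
Qed.

Lemma Gamma_ge0 (v : 'I_n -> R) i : (forall j, 0 <= v j) -> 0 <= Gamma_op isSum gam v i.
Proof.
move=> v0; rewrite /Gamma_op; case: ifP => _; last exact: bigmax_ge_id.
by apply: sumr_ge0 => j _; exact: Kinf0_ge0.
Qed.

Variable alpha : R -> R.
Hypothesis Kalpha : isKinf alpha.
Hypothesis small_gain : forall s : 'I_n -> R, (forall i, 0 <= s i) -> (exists i, s i != 0) ->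
     exists i, Gamma_op isSum gam (D_op isSum alpha s) i < s i.

(* If [D (Gamma v) >= v] then [s = Gamma v] violates the condition for [Gamma o D]. *)
Lemma small_gain_swap (v : 'I_n -> R) : (forall i, 0 <= v i) -> (exists i, v i != 0) ->
  exists i, D_op isSum alpha (Gamma_op isSum gam v) i < v i.
Proof.
move=> v0 vn0; apply: contrapT => /forallNP h.
have Dv i : v i <= D_op isSum alpha (Gamma_op isSum gam v) i by rewrite leNgt; apply/negP.
have s0 i : 0 <= Gamma_op isSum gam v i by exact: Gamma_ge0.
have [sn0|s_eq0] := pselect (exists i, Gamma_op isSum gam v i != 0).
  have [i] := small_gain s0 sn0; apply/negP; rewrite -leNgt; exact: Gamma_le.
have sz i : Gamma_op isSum gam v i = 0.
  by apply/eqP; apply: contrapT => /negP h1; apply: s_eq0; exists i.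
case: vn0 => i /negP; apply; apply/eqP/le_anti; rewrite v0 andbT.
by apply: le_trans (Dv i) _; rewrite /D_op sz (K0 Kalpha.1) addr0 if_same.
Qed.

Definition gain_rel i (v : 'I_n -> R) (w : R) : R :=
  if isSum i then Gamma_op isSum gam v i + w else Num.max (Gamma_op isSum gam v i) w.

(** Induction on the size of a set [J] carrying the support of [v]. An index given by
    [small_gain_swap] is bounded by [psi w]; setting its entry to [0] leaves inequalities of the
    same form on the smaller set, with its contribution to the other rows added to [w]. *)
Lemma small_gain_bound_card (m : nat) : exists Phi, isKinf Phi /\
  forall (J : {set 'I_n}) (v : 'I_n -> R) (w : R), (#|J| <= m)%N -> 0 <= w ->
    (forall i, 0 <= v i) -> (forall i, i \notin J -> v i = 0) ->
    (forall i, i \in J -> v i <= gain_rel i v w) -> forall i, v i <= Phi w.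
Proof.
elim: m => [|m [Phi [KPhi IH]]].
  exists id; split; first exact: Kinf_id.
  move=> J v w; rewrite leqn0 cards_eq0 => /eqP -> w0 v0 vJ _ i.
  by rewrite vJ// inE.
have [ainv [Kainv ainvP]] := Kinf_inverse Kalpha.
pose psi w := w + ainv w.
have Kpsi : isKinf psi by exact: Kinf_add Kinf_id Kainv.1.
(* Crude bound for every single gain; the summand [r] keeps it of class K-infinity when all gains
   vanish. *)
pose tot := fun r : R => r + \sum_k \sum_i gam k i r.
have Ktot : isKinf tot.
  pose row (k : 'I_n) := fun r => \sum_i gam k i r.
  suff : forall (s : seq 'I_n) (h : R -> R), isKinf h ->
      isKinf (fun r => h r + \sum_(k <- s) row k r).
    move=> /(_ (index_enum 'I_n) id Kinf_id) //.
  elim => [|k s IHs] h Kh.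
    by have := Kh; congr isKinf; apply/funext => r; rewrite big_nil addr0.
  have := IHs _ (Kinf_sum Kh (Kgam k)); congr isKinf; apply/funext => r.
  by rewrite big_cons addrA.
exists (fun w => psi w + Phi (w + tot (psi w))); split.
  apply: Kinf_add => //; apply: K_comp KPhi.1 _.
  by apply: K_add; [exact: Kinf_id.1|exact: K_comp Ktot.1 Kpsi.1].
move=> J v w cJ w0 v0 vJ vle.
have pw0 : 0 <= psi w by exact: K_ge0 Kpsi.1 w0.
have tw0 : 0 <= tot (psi w) by exact: K_ge0 Ktot.1 pw0.
have Pw0 : 0 <= Phi (w + tot (psi w)) by apply: K_ge0 KPhi.1 _; lra.
have [vn0|v_eq0] := pselect (exists i, v i != 0); last first.
  move=> i; have -> : v i = 0 by apply/eqP; apply: contrapT => /negP h; apply: v_eq0; exists i.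
  lra.
have [i hi] := small_gain_swap v0 vn0.
have G0 := Gamma_ge0 i v0.
have iJ : i \in J.
  apply: contrapT => /negP /vJ vi; move: hi; rewrite vi /D_op; case: ifP => _; last lra.
  by have := K_ge0 Kalpha.1 G0; lra.
(* In a max row, [Gamma v < v] at [i] rules out the first term of the maximum, so even
   [v i <= w]. *)
have vi : v i <= psi w.
  have := vle i iJ; move: hi; rewrite /gain_rel /D_op /psi; case: ifP => _ h1.
    have h2 := K_ge0 Kalpha.1 G0.
    move=> h3; have h4 : alpha (Gamma_op isSum gam v i) <= w by lra.
    have := K_le Kainv.1 h2 h4; rewrite (ainvP _ G0).1; lra.
  rewrite le_max => /orP[h2|h2]; first lra.
  by have := K_ge0 Kainv.1 w0; lra.
pose v' j := if j == i then 0 else v j.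
have v'0 j : 0 <= v' j by rewrite /v'; case: eqP.
have gle k : gam k i (v i) <= tot (psi w).
  apply: le_trans (Kinf0_le (Kgam k i) (v0 i) vi) _.
  have nn k' j : 0 <= gam k' j (psi w) by exact: Kinf0_ge0.
  rewrite /tot (bigD1 k)//= (bigD1 i)//=.
  have : 0 <= \sum_(j < n | j != i) gam k j (psi w) by apply: sumr_ge0.
  have : 0 <= \sum_(k' < n | k' != k) \sum_j gam k' j (psi w).
    by apply: sumr_ge0 => k' _; apply: sumr_ge0.
  lra.
have bound : forall j, v' j <= Phi (w + tot (psi w)).
  apply: (IH (J :\ i)) => //.
  - by move: cJ; rewrite (cardsD1 i J) iJ.
  - by rewrite addr_ge0.
  - move=> j; rewrite !inE negb_and negbK => /orP[/eqP ->|jJ]; rewrite /v' ?eqxx//.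
    by case: eqP => // _; exact: vJ.
  move=> k; rewrite !inE => /andP[ki kJ]; rewrite {1}/v' (negbTE ki).
  apply: le_trans (vle k kJ) _; rewrite /gain_rel; case: ifP => sk.
    rewrite /Gamma_op sk.
    have : \sum_j gam k j (v j) <= \sum_j gam k j (v' j) + gam k i (v i).
      rewrite (bigD1 i)//= [X in _ <= X + _](bigD1 i)//=.
      have -> : \sum_(j < n | j != i) gam k j (v j) = \sum_(j < n | j != i) gam k j (v' j).
        by apply: eq_bigr => j /negbTE ji; rewrite /v' ji.
      by have := Kinf0_ge0 (Kgam k i) (v'0 i); lra.
    by have := gle k; lra.
  rewrite ge_max; apply/andP; split; last by rewrite le_max; apply/orP; right; lra.
  rewrite {1}/Gamma_op sk; apply: bigmax_le.
    by rewrite le_max Gamma_ge0.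
  move=> j _; have [->|ji] := eqVneq j i.
    by rewrite le_max; apply/orP; right; have := gle k; lra.
  rewrite le_max; apply/orP; left; rewrite /Gamma_op sk.
  have -> : gam k j (v j) = gam k j (v' j) by rewrite /v' (negbTE ji).
  exact: (le_bigmax _ (fun j => gam k j (v' j))).
move=> j; have [->|ji] := eqVneq j i; first lra.
by have := bound j; rewrite /v' (negbTE ji); lra.
Qed.

Lemma small_gain_bound : exists Phi, isKinf Phi /\
  forall (v : 'I_n -> R) (w : R), 0 <= w -> (forall i, 0 <= v i) ->
    (forall i, v i <= gain_rel i v w) -> forall i, v i <= Phi w.
Proof.
have [Phi [KPhi h]] := small_gain_bound_card n.
exists Phi; split => // v w w0 v0 vle; apply: (h [set: 'I_n]%SET) => //.
  by rewrite cardsT card_ord.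
by move=> i; rewrite inE.
Qed.

End small_gain.

(** * Block vectors and single-block updates *)

Section blocks.
Context {R : realType} (n : nat) (Ni : 'I_n -> nat).

Lemma submxrow_norm_le (x : 'rV[R]_(\sum_(j < n) Ni j)) j : `|submxrow x j| <= `|x|.
Proof. by apply: rV_norm_le => // k; rewrite mxE; exact: rV_coord_le. Qed.

Lemma mxrow_norm_le (x : 'rV[R]_(\sum_(j < n) Ni j)) (e : R) : 0 <= e ->
  (forall j, `|submxrow x j| <= e) -> `|x| <= e.
Proof.
move=> e0 h; apply: rV_norm_le => // k.
have := le_trans (rV_coord_le (submxrow x (tagnat.sig1 k)) (tagnat.sig2 k)) (h (tagnat.sig1 k)).
by rewrite mxE tagnat.sig2K.
Qed.

Lemma mxrow_norm_attained (x : 'rV[R]_(\sum_(j < n) Ni j)) : x != 0 ->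
  exists j, `|submxrow x j| = `|x|.
Proof.
move=> x0; apply: contrapT => /forallNP h.
have lt j : `|submxrow x j| < `|x|.
  by rewrite lt_neqAle submxrow_norm_le andbT; apply/eqP.
pose e := \big[Num.max/0]_j `|submxrow x j|.
have : `|x| <= e.
  apply: mxrow_norm_le; first exact: bigmax_ge_id.
  by move=> j; exact: (le_bigmax _ (fun j => `|submxrow x j|)).
by apply/negP; rewrite -ltNge; apply: bigmax_lt => //; rewrite normr_gt0.
Qed.

Definition upd (x : 'rV[R]_(\sum_(j < n) Ni j)) i (y : 'rV[R]_(Ni i)) :
  'rV[R]_(\sum_(j < n) Ni j) := \mxrow_j eqtype.dfwith (fun j => submxrow x j) y j.

Lemma upd_in x i y : submxrow (@upd x i y) i = y.
Proof. by rewrite mxrowK dfwith_in. Qed.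

Lemma upd_out x i y j : i != j -> submxrow (@upd x i y) j = submxrow x j.
Proof. by move=> ij; rewrite mxrowK dfwith_out. Qed.

Lemma upd_dist x i y : `|@upd x i y - x| <= `|y - submxrow x i|.
Proof.
apply: mxrow_norm_le => // j; rewrite submxrowB.
have [<-|ij] := eqVneq i j; first by rewrite upd_in.
by rewrite upd_out// subrr normr0.
Qed.

End blocks.

(** * Decrease of each subsystem function at every point *)

Section lyap.
Context {R : realType}.

Lemma proper_ge0 k (V : 'rV[R]_k -> R) x : proper_pd V -> 0 <= V x.
Proof.
move=> [p1 [p2 [K1 [K2 h]]]]; apply: le_trans (h x).1.
exact: K_ge0 K1.1 (normr_ge0 _).
Qed.

Lemma proper_0 k (V : 'rV[R]_k -> R) : proper_pd V -> V 0 = 0.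
Proof.
move=> pV; apply/le_anti; rewrite proper_ge0// andbT.
by move: pV => [p1 [p2 [K1 [K2 /(_ 0)[_]]]]]; rewrite normr0 (K0 K2.1).
Qed.

Lemma proper_gt0 k (V : 'rV[R]_k -> R) x : proper_pd V -> x != 0 -> 0 < V x.
Proof.
move=> [p1 [p2 [K1 [K2 h]]]] x0; apply: lt_le_trans (h x).1.
by apply: K_gt0 K1.1 _; rewrite normr_gt0.
Qed.

Lemma posdef_gt0 (a : R -> R) r : posdef a -> 0 < r -> 0 < a r.
Proof.
move=> [_ [a0 ar]] r0; rewrite lt_neqAle a0 ?ltW// andbT eq_sym.
by apply/eqP => /(ar r (ltW r0)).1 re; rewrite re ltxx in r0.
Qed.

Lemma diff_lip_le k (W : 'rV[R]_k -> R) (y : 'rV[R]_k) (L d : R) : 0 < d ->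
  (forall z : 'rV[R]_k, `|z - y| < d -> `|W z - W y| <= L * `|z - y|) ->
  differentiable W y -> forall v, 'd W y v <= L * `|v|.
Proof.
move=> d0 lip dW v; apply: diff_dini_ge => //.
exists (d / (`|v| + 1)); have v1 : 0 < `|v| + 1 by rewrite ltr_wpDl.
split; first by rewrite divr_gt0.
move=> h h0 hd; apply: le_trans (ler_norm _) _.
have e1 : y + h *: v - y = h *: v by rewrite addrC addKr.
have nz : `|y + h *: v - y| = h * `|v| by rewrite e1 normrZ gtr0_norm.
apply: le_trans (lip _ _) _; rewrite nz; last by rewrite (mulrC h) mulrA.
apply: le_lt_trans (_ : h * `|v| <= h * (`|v| + 1)) _; first by rewrite ler_wpM2l ?ltW// ltrDl.
by rewrite -ltr_pdivlMr.
Qed.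

Variables (n : nat) (Ni mi : 'I_n -> nat)
    (fs : forall i : 'I_n,
        'rV[R]_(\sum_(j < n) Ni j) -> 'rV[R]_(mi i) -> 'rV[R]_(Ni i))
    (isSum : 'I_n -> bool)
    (V : forall i : 'I_n, 'rV[R]_(Ni i) -> R)
    (gam : 'I_n -> 'I_n -> R -> R) (gi : 'I_n -> R -> R).
Arguments fs : clear implicits.
Arguments V : clear implicits.
Hypothesis reg : forall i, regular_rhs (fs i).
Hypothesis Kgam : forall i j, isKinf0 (gam i j).
Hypothesis gam0 : forall i, is_zero_gain (gam i i).
Hypothesis Kgi : forall i, isK (gi i).

Definition gain_at i (x : 'rV[R]_(\sum_(j < n) Ni j)) (r : R) : R :=
  if isSum i then \sum_(j < n) gam i j (V j (submxrow x j)) + gi i r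
  else Num.max (\big[Num.max/0]_(j < n) gam i j (V j (submxrow x j))) (gi i r).

Definition decrease_rate i (a : R -> R) :=
  forall (x : 'rV[R]_(\sum_(j < n) Ni j)) (u : 'rV[R]_(\sum_(j < n) mi j)),
    gain_at i x `|u| < V i (submxrow x i) -> forall e : R, 0 < e ->
    exists d : R, 0 < d /\ forall h : R, 0 < h -> h < d ->
      V i (submxrow x i + h *: fs i x (submxrow u i)) - V i (submxrow x i) <=
      (- a `|submxrow x i| + e) * h.

Lemma gain_at_upd i x y r : proper_pd (V i) -> gain_at i (@upd _ _ _ x i y) r = gain_at i x r.
Proof.
move=> pV; have E j : gam i j (V j (submxrow (@upd _ _ _ x i y) j)) = gam i j (V j (submxrow x j)).
  have [<-|ij] := eqVneq i j; last by rewrite upd_out.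
  by rewrite upd_in !gam0 ?proper_ge0.
by rewrite /gain_at; under eq_bigr do rewrite E; under [X in Num.max X]eq_bigr do rewrite E.
Qed.

Lemma gain_at_ge0 i x r : 0 <= r -> (forall j, proper_pd (V j)) -> 0 <= gain_at i x r.
Proof.
move=> r0 pV; rewrite /gain_at; case: ifP => _.
  by rewrite addr_ge0 ?K_ge0// sumr_ge0// => j _; rewrite Kinf0_ge0// proper_ge0.
by rewrite le_max bigmax_ge_id.
Qed.

(* The hypothesis only concerns differentiability points; Lipschitz continuity
   and [lip_dini] transfer the decrease to every point with a strict gain margin. *)
Lemma sub_decrease i : (forall j, proper_pd (V j)) -> iss_lyap_sub fs isSum V gam gi i ->
  exists a, posdef a /\ decrease_rate i a.
Proof.
move=> pV [cV [_ [lipV [a [pa hd]]]]]; exists a; split => // x u mar e e0.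
set xi := submxrow x i in mar *; set v := fs i x (submxrow u i).
(* The gain bound is nonnegative, so a strict margin keeps [xi] away from the origin, where [V i]
   need not be Lipschitz. *)
have xi0 : xi != 0.
  apply/eqP => xi0; move: mar; rewrite xi0 proper_0//.
  by apply/negP; rewrite -leNgt gain_at_ge0.
have [d1 [L [d10 lip]]] := lipV xi xi0.
have [d2 d20 h2] : exists2 d2 : R, 0 < d2 & forall y : 'rV[R]_(Ni i), `|y - xi| < d2 ->
    gain_at i x `|u| <= V i y.
  have m0 : 0 < V i xi - gain_at i x `|u| by rewrite subr_gt0.
  have /cvgrPdist_le/(_ _ m0) := cV xi.
  move=> /nbhs_ballP[d2 /= d20 h2]; exists d2 => // y yd.
  have := h2 y; rewrite mx_norm_ball /ball_/= distrC => /(_ yd).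
  by rewrite ler_norml => /andP[_]; lra.
have e3 : 0 < e / 3 by lra.
have [d3 [d30 h3]] := (within_ge0_continuousP a).1 pa.1 `|xi| (normr_ge0 _) _ e3.
pose L1 := `|L| + 1.
have L10 : 0 < L1 by rewrite /L1 ltr_wpDl.
have eL : 0 < e / 3 / L1 by rewrite divr_gt0.
have [d4 d40 h4] : exists2 d4 : R, 0 < d4 & forall x' : 'rV[R]_(\sum_(j < n) Ni j),
    `|x' - x| < d4 -> `|v - fs i x' (submxrow u i)| <= e / 3 / L1.
  have := (reg i).1 (x, submxrow u i) => /cvgrPdist_le/(_ _ eL).
  move=> /nbhs_ballP[d4 /= d40 h4]; exists d4 => // x' xd.
  apply: (h4 (x', submxrow u i)); split => /=; last exact: ballxx.
  by rewrite mx_norm_ball /ball_/= distrC.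
pose d := Num.min (Num.min d1 d2) (Num.min d3 d4).
have d0 : 0 < d by rewrite !lt_min d10 d20 d30 d40.
have main (y : 'rV[R]_(Ni i)) : `|y - xi| < d -> differentiable (V i) y ->
    'd (V i) y v <= - a `|xi| + e.
  rewrite !lt_min => /andP[/andP[y1 y2] /andP[y3 y4]] dV.
  (* Only block [i] is moved, so the gain bound is the one at [x]. The velocity does change, from
     [v] to [v'], which continuity of [fs i] and the Lipschitz constant of [V i] make harmless. *)
  pose x' := @upd _ _ _ x i y.
  have := hd x' u; rewrite upd_in -/(gain_at i x' `|u|) => /(_ dV).
  have gx : gain_at i x' `|u| <= V i y by rewrite gain_at_upd//; exact: h2.
  move=> /(_ ltac:(by move: gx; rewrite /gain_at; case: (isSum i))).
  set v' := fs i x' _ => dv'.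
  have dvv : 'd (V i) y (v - v') <= e / 3.
    apply: (@le_trans _ _ (`|L| * `|v - v'|)).
      apply: (@diff_lip_le _ _ _ _ (d1 - `|y - xi|)) => //; first by rewrite subr_gt0.
      move=> z zd; apply: (@le_trans _ _ (L * `|z - y|)).
        apply: lip => //; apply: le_lt_trans (ler_distD y _ _) _; lra.
      by rewrite ler_wpM2r// ler_norm.
    apply: (@le_trans _ _ (L1 * (e / 3 / L1))); last by rewrite mulrC mulfVK// gt_eqF.
    apply: ler_pM => //; first by rewrite /L1 lerDl.
    by apply: h4; apply: le_lt_trans (upd_dist _ _) y4.
  have aa : `|a `|y| - a `|xi| | <= e / 3.
    by apply: h3 => //; apply: le_lt_trans (ler_dist_dist _ _) y3.
  have -> : 'd (V i) y v = 'd (V i) y v' + 'd (V i) y (v - v').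
    by rewrite -linearD addrC subrK.
  by move: aa; rewrite ler_norml => /andP[? ?]; lra.
exists (d / (`|v| + 1)); have v1 : 0 < `|v| + 1 by rewrite ltr_wpDl.
split; first by rewrite divr_gt0.
move=> h h0 hlt; apply: (@lip_dini R _ _ xi v d L) => //.
- by move=> y z yd zd; apply: lip; [move: yd|move: zd]; rewrite !lt_min => /andP[/andP[]].
- exact: ltW.
apply: le_lt_trans (_ : h * `|v| <= h * (`|v| + 1)) _; first by rewrite ler_wpM2l ?ltW// ltrDl.
by rewrite -ltr_pdivlMr.
Qed.

End lyap.

(** * Slope bounds and finite families *)

Section slopes_and_maxima.
Context {R : realType}.
Notation mu := (@lebesgue_measure R).

Lemma slope_lower_local (q : R -> R) (a b c L : R) : a <= b ->
  (forall s t, a <= s -> s <= b -> a <= t -> t <= b -> `|q s - q t| <= L * `|s - t|) ->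
  (forall t, a < t -> t < b -> derivable q t 1 -> c <= derive1 q t) ->
  c * (b - a) <= q b - q a.
Proof.
move=> ab lip dq.
(* Constant extension beyond [[a, b]], to have a Lipschitz function on the whole line. *)
pose cl t := Num.max a (Num.min b t).
have cl_in t : a <= cl t /\ cl t <= b.
  by rewrite /cl le_max lexx ge_max ab ge_min lexx.
have cl_id t : a <= t -> t <= b -> cl t = t by move=> h1 h2; rewrite /cl min_r// max_r.
pose G t := q (cl t).
have lipG s t : `|G s - G t| <= `|L| * `|s - t|.
  have [h1 h2] := cl_in s; have [h3 h4] := cl_in t.
  apply: le_trans (lip _ _ h1 h2 h3 h4) _.
  apply: (@le_trans _ _ (`|L| * `|cl s - cl t|)).
    by rewrite ler_wpM2r// ler_norm.
  rewrite ler_wpM2l//; apply: le_trans (max_lip _ _ _) _; exact: min_lip.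
have N1 := lipschitz_ae_derivable lipG.
(* At the endpoint [a], differentiability of the extension says nothing about [q]. *)
have N2 : mu.-negligible [set a] by apply/negligibleP => //; exact: lebesgue_measure_set1.
have := @dini_ae_le R (fun t => - G t) a b (- c) `|L| _ ab _ (negligibleU N1 N2) _.
rewrite /G !cl_id// => main.
suff : - q b - - q a <= - c * (b - a) by rewrite mulNr; lra.
apply: main => [s t _ _ _ _|t at_ tb].
  by rewrite -opprD normrN; exact: lipG.
move=> /not_orP[/contrapT dG /eqP ta] e e0.
have {}at_ : a < t by rewrite lt_neqAle eq_sym ta.
have {}dG : derivable q t 1.
  apply: near_eq_derivable dG; near=> y; rewrite /G cl_id//.
    by apply/ltW; near: y; exact: lt_nbhsr.
  by apply/ltW; near: y; exact: lt_nbhsl.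
have cD : c <= 'D_1 q t by rewrite -derive1E; exact: dq.
have [d [d0 hd]] := derivable_approx dG e0.
exists d; split => // h h0 hlt thb; rewrite !cl_id; [|lra..].
have := hd h; rewrite gtr0_norm// => /(_ hlt); rewrite ler_norml => /andP[h1 _].
have := ler_wpM2r (ltW h0) cD; lra.
Unshelve. all: by end_near. Qed.

(** Applied to [sinv i], this turns the derivative bound of an Omega-path, known at
    differentiability points, into a bound on increments. *)
Lemma slope_lower (q : R -> R) (lo hi c : R) :
  (forall r, lo <= r -> r <= hi -> exists d L : R, 0 < d /\ forall a b : R,
     `|a - r| < d -> `|b - r| < d -> `|q a - q b| <= L * `|a - b|) ->
  (forall r, lo <= r -> r <= hi -> derivable q r 1 -> c <= derive1 q r) ->
  forall a b, lo <= a -> a <= b -> b <= hi -> c * (b - a) <= q b - q a.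
Proof.
move=> lip dq a b loa ab bhi.
have loc r : lo <= r -> r <= hi -> exists d : R, 0 < d /\ forall s t,
    `|s - r| < d -> `|t - r| < d -> lo <= s -> s <= t -> t <= hi -> c * (t - s) <= q t - q s.
  move=> r1 r2; have [d [L [d0 hd]]] := lip r r1 r2; exists d; split => // s t sd td los st thi.
  apply: (@slope_lower_local _ _ _ _ L) => //; last first.
    by move=> p sp pt dp; apply: dq => //; lra.
  move=> p p' h1 h2 h3 h4; apply: hd; move: sd td; rewrite !ltr_norml => /andP[? ?] /andP[? ?];
    apply/andP; split; lra.
apply: (@real_induction R (fun t => c * (t - a) <= q t - q a) a b ab).
- by rewrite !subrr mulr0.
- move=> t at_ tb IH; have [d [d0 hd]] := loc t ltac:(lra) ltac:(lra).
  exists d; split => // s ts sd sb.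
  have := hd t s; rewrite subrr normr0 ger0_norm; last lra.
  by move=> /(_ d0 ltac:(lra) ltac:(lra) ltac:(lra) ltac:(lra)); lra.
- move=> t at_ tb IH; have [d [d0 hd]] := loc t ltac:(lra) ltac:(lra).
  pose s := Num.max a (t - d / 2).
  have as_ : a <= s by rewrite le_max lexx.
  have st : s < t by rewrite gt_max at_/=; lra.
  have sd : t - d / 2 <= s by rewrite le_max lexx orbT.
  have := hd s t; rewrite subrr normr0 ler0_norm; last lra.
  move=> /(_ ltac:(lra) d0 ltac:(lra) ltac:(lra) ltac:(lra)).
  by have := IH s as_ st; lra.
Qed.

Lemma fin_pos_min n (d : 'I_n -> R) : (forall i, 0 < d i) ->
  exists e : R, 0 < e /\ forall i, e <= d i.
Proof.
elim: n d => [|n IH] d d0; first by exists 1; split => // -[].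
have [e [e0 he]] := IH (fun i => d (lift ord0 i)) (fun i => d0 _).
exists (Num.min (d ord0) e); split; first by rewrite lt_min d0.
by move=> i; case: (unliftP ord0 i) => [j ->|->]; rewrite ge_min ?lexx// he orbT.
Qed.

Lemma le_term_sum n (F : 'I_n -> R) i : (forall j, 0 <= F j) -> F i <= \sum_j F j.
Proof. by move=> F0; rewrite (bigD1 i)//= lerDl sumr_ge0. Qed.

Lemma eps_delta_continuous (U : normedModType R) (f : U -> R) :
  (forall (x : U) (e : R), 0 < e -> exists d : R, 0 < d /\
     forall y : U, `|y - x| < d -> `|f y - f x| <= e) -> continuous f.
Proof.
move=> h x; apply/cvgrPdist_le => /= e e0; have [d [d0 hd]] := h x e e0.
near=> y; rewrite distrC; apply: hd; rewrite distrC.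
by near: y; apply: cvgr_dist_lt => //; exact: cvg_id.
Unshelve. all: by end_near. Qed.

Lemma bigmax_dist n (F G : 'I_n -> R) (e : R) : 0 <= e -> (forall i, `|F i - G i| <= e) ->
  `|\big[Num.max/0]_i F i - \big[Num.max/0]_i G i| <= e.
Proof.
move=> e0 h; have one (F' G' : 'I_n -> R) : (forall i, `|F' i - G' i| <= e) ->
    \big[Num.max/0]_i F' i <= \big[Num.max/0]_i G' i + e.
  move=> h'; apply: bigmax_le; first by rewrite addr_ge0// bigmax_ge_id.
  move=> i _; have := h' i; rewrite ler_norml => /andP[_ h1].
  have := le_bigmax (0 : R) G' i; lra.
have h1 := one F G h; have h2 := one G F (fun i => ltac:(by rewrite distrC)).
by rewrite ler_norml; apply/andP; split; lra.
Qed.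

(** The inverse of a sum dominating all inverses lies below every [rho i]; the identity in the sum
    covers an empty family. *)
Lemma Kinf_lower n (rho : 'I_n -> R -> R) : (forall i, isKinf (rho i)) ->
  exists p, isKinf p /\ forall i r, 0 <= r -> p r <= rho i r.
Proof.
move=> Krho; have [q hq] := choice (fun i => Kinf_inverse (Krho i)).
have KQ : isKinf (fun r => r + \sum_i q i r).
  by apply: Kinf_sum; [exact: Kinf_id|move=> i; left; case: (hq i)].
have [p [Kp pQ]] := Kinf_inverse KQ; exists p; split => // i r r0.
have p0 : 0 <= p r by exact: K_ge0 Kp.1 r0.
have qp0 j : 0 <= q j (p r) by apply: K_ge0 (hq j).1.1 p0.
have [_ qr] := pQ r r0.
have h : q i (p r) <= r.
  rewrite -[leRHS]qr; have := @le_term_sum n (fun j => q j (p r)) i qp0; lra.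
have := K_le (Krho i).1 (qp0 i) h.
by rewrite ((hq i).2 (p r) p0).2.
Qed.

(** Properness confines the norms of such [y] to a compact interval away from [0], where a positive
    definite function has a positive minimum. *)
Lemma rate_lower k (V : 'rV[R]_k -> R) (a : R -> R) (lo hi : R) :
  proper_pd V -> posdef a -> 0 < lo ->
  exists c : R, 0 < c /\ forall y, lo <= V y -> V y <= hi -> c <= a `|y|.
Proof.
move=> [p1 [p2 [K1 [K2 hV]]]] pa lo0.
have [q1 [Kq1 q1P]] := Kinf_inverse K1; have [q2 [Kq2 q2P]] := Kinf_inverse K2.
pose m := q2 lo; have m0 : 0 < m by exact: K_gt0 Kq2.1 lo0.
pose M := q1 (Num.max lo hi).
have yin y : lo <= V y -> V y <= hi -> m <= `|y| /\ `|y| <= M.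
  move=> h1 h2; have [h3 h4] := hV y; split.
    rewrite -(q2P _ (normr_ge0 y)).1; apply: K_le Kq2.1 _ _; lra.
  rewrite -(q1P _ (normr_ge0 y)).1; apply: K_le Kq1.1 _ _.
    exact: K_ge0 K1.1 (normr_ge0 _).
  by rewrite le_max (le_trans h3 h2) orbT.
have [mM|Mm] := leP m M; last first.
  exists 1; split => // y h1 h2; have [] := yin y h1 h2; lra.
have ca : {within `[m, M], continuous a}.
  apply: continuous_subspaceW pa.1 => x /=; rewrite !in_itv/= => /andP[h _].
  by rewrite andbT; lra.
have [c] := @EVT_min R a m M mM ca; rewrite in_itv/= => /andP[c1 c2] hc.
exists (a c); split; first by apply: posdef_gt0 => //; lra.
by move=> y h1 h2; have [h3 h4] := yin y h1 h2; apply: hc; rewrite in_itv/= h3 h4.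
Qed.

End slopes_and_maxima.

(** * The maximum along an Omega-path as an ISS Lyapunov function *)

Section omega_path_lyapunov.
Context {R : realType}.
Variables (n : nat) (Ni mi : 'I_n -> nat)
    (fs : forall i : 'I_n,
        'rV[R]_(\sum_(j < n) Ni j) -> 'rV[R]_(mi i) -> 'rV[R]_(Ni i))
    (isSum : 'I_n -> bool)
    (V : forall i : 'I_n, 'rV[R]_(Ni i) -> R)
    (gam : 'I_n -> 'I_n -> R -> R) (gi : 'I_n -> R -> R).
Arguments fs : clear implicits.
Arguments V : clear implicits.
Hypothesis reg : forall i, regular_rhs (fs i).
Hypothesis Kgam : forall i j, isKinf0 (gam i j).
Hypothesis gam0 : forall i, is_zero_gain (gam i i).
Hypothesis Kgi : forall i, isK (gi i).
Hypothesis lyap : forall i, iss_lyap_sub fs isSum V gam gi i.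
Variable alpha : R -> R.
Hypothesis Kalpha : isKinf alpha.
Variables sigma sinv : 'I_n -> R -> R.
Hypothesis path : omega_path (fun s => D_op isSum alpha (Gamma_op isSum gam s)) sigma sinv.

Let pV j : proper_pd (V j) := (lyap j).2.1.
Let Ksig i : isKinf (sigma i) := path.1 i.
Let sinvP i (r : R) : 0 <= r -> sinv i (sigma i r) = r /\ sigma i (sinv i r) = r := path.2.1 i r.

Lemma Ksinv i : isKinf (sinv i).
Proof. by apply: (inverse_Kinf (Ksig i)) => r r0; case: (sinvP i r0). Qed.

Let w i (x : 'rV[R]_(\sum_(j < n) Ni j)) := sinv i (V i (submxrow x i)).
Let W x := \big[Num.max/0]_(i < n) w i x.

Let w_ge0 i x : 0 <= w i x.
Proof. by apply: K_ge0 (Ksinv i).1 _; exact: proper_ge0. Qed.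

Let W_ge0 x : 0 <= W x. Proof. exact: bigmax_ge_id. Qed.

Let w_leW i x : w i x <= W x. Proof. exact: (le_bigmax _ (fun i => w i x)). Qed.

Let w_cont i x (e : R) : 0 < e -> exists d : R, 0 < d /\
  forall y : 'rV[R]_(\sum_(j < n) Ni j), `|y - x| < d -> `|w i y - w i x| <= e.
Proof.
move=> e0; have [d [d0 hd]] := K_cont (Ksinv i).1 (proper_ge0 (submxrow x i) (pV i)) e0.
have d2 : 0 < d / 2 by lra.
have /cvgrPdist_le/(_ _ d2)/nbhs_ballP[d' /= d'0 h'] := (lyap i).1 (submxrow x i).
exists d'; split => // y yd; apply: hd; first exact: proper_ge0.
have := h' (submxrow y i); rewrite mx_norm_ball /ball_/= -submxrowB => h.
rewrite distrC; apply: le_lt_trans (h _) _; last lra.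
by rewrite distrC in yd; exact: le_lt_trans (submxrow_norm_le _ _) yd.
Qed.

Let W_cont x (e : R) : 0 < e -> exists d : R, 0 < d /\
  forall y : 'rV[R]_(\sum_(j < n) Ni j), `|y - x| < d -> `|W y - W x| <= e.
Proof.
move=> e0; have [d hd] := choice (fun i => w_cont i x e0).
have [d0 [d0_gt0 d0_le]] := fin_pos_min (fun i => (hd i).1).
exists d0; split => // y yd; apply: bigmax_dist => [|i]; first exact: ltW.
by apply: (hd i).2; exact: lt_le_trans yd (d0_le i).
Qed.

Let W_continuous : continuous W.
Proof.
by apply: eps_delta_continuous => x e e0; exact: W_cont.
Qed.

Let W_proper : proper_pd W.
Proof.
have [p1 hp1] := choice pV; have [p2 hp2] := choice hp1.
have [q1 [Kq1 q1P]] := Kinf_lower (fun i => Kinf_comp (Ksinv i) (hp2 i).1).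
exists q1, (fun r => r + \sum_i sinv i (p2 i r)); split => //; split.
  apply: Kinf_sum; first exact: Kinf_id.
  by move=> i; left; exact: Kinf_comp (Ksinv i) (hp2 i).2.1.
move=> x; split.
  have [->|x0] := eqVneq x 0; first by rewrite normr0 (K0 Kq1.1).
  have [i xi] := mxrow_norm_attained x0; apply: le_trans (w_leW i x).
  apply: le_trans (q1P i _ (normr_ge0 _)) _; rewrite /= -xi.
  apply: K_le (Ksinv i).1 _ ((hp2 i).2.2 _).1.
  exact: K_ge0 (hp2 i).1.1 (normr_ge0 _).
have t0 i : 0 <= sinv i (p2 i `|x|).
  by apply: K_ge0 (Ksinv i).1 _; apply: K_ge0 (hp2 i).2.1.1 _.
apply: bigmax_le; first by rewrite addr_ge0// sumr_ge0.
move=> i _; have := @le_term_sum R n (fun j => sinv j (p2 j `|x|)) i t0.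
have : w i x <= sinv i (p2 i `|x|).
  apply: K_le (Ksinv i).1 (proper_ge0 _ (pV i)) _.
  apply: le_trans ((hp2 i).2.2 _).2 _.
  by apply: K_le (hp2 i).2.1.1 (normr_ge0 _) (submxrow_norm_le _ _).
have := normr_ge0 x; lra.
Qed.

(** Neither [sinv i] nor [V i] is assumed Lipschitz near zero; the maximum with [r > 0] is constant
    near the bad points. *)
Let w_lip i x (r : R) : 0 < r -> exists d L : R, 0 < d /\
  forall y z : 'rV[R]_(\sum_(j < n) Ni j), `|y - x| < d -> `|z - x| < d ->
    `|Num.max r (w i y) - Num.max r (w i z)| <= L * `|y - z|.
Proof.
move=> r0; have [wr|rw] := ltP (w i x) r.
  have e0 : 0 < r - w i x by rewrite subr_gt0.
  have [d [d0 hd]] := w_cont i x e0.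
  exists d, 0; split => // y z yd zd.
  have lt y' : `|y' - x| < d -> w i y' <= r.
    by move=> /hd; rewrite ler_norml => /andP[_]; lra.
  by rewrite !max_l ?lt// subrr normr0 mul0r.
have xi0 : submxrow x i != 0.
  apply/eqP => h; move: rw; rewrite /w h (proper_0 (pV i)) (K0 (Ksinv i).1); lra.
have Vx0 := proper_gt0 (pV i) xi0.
have [d1 [L1 [d10 lip1]]] := (lyap i).2.2.1 _ xi0.
have [d2 [L2 [d20 lip2]]] := path.2.2.1 i _ Vx0.
have d22 : 0 < d2 / 2 by lra.
have /cvgrPdist_le/(_ _ d22)/nbhs_ballP[d3 /= d30 h3] := (lyap i).1 (submxrow x i).
exists (Num.min d1 d3), (`|L2| * `|L1|); split; first by rewrite lt_min d10.
move=> y z; rewrite !lt_min => /andP[y1 y3] /andP[z1 z3].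
have bnd (y' : 'rV[R]_(\sum_(j < n) Ni j)) dd : `|y' - x| < dd -> `|submxrow y' i - submxrow x i| < dd.
  by move=> h; rewrite -submxrowB; exact: le_lt_trans (submxrow_norm_le _ _) h.
have b3 (y' : 'rV[R]_(\sum_(j < n) Ni j)) : `|y' - x| < d3 -> `|V i (submxrow y' i) - V i (submxrow x i)| < d2.
  move=> h; have := h3 (submxrow y' i); rewrite mx_norm_ball /ball_/= distrC => /(_ (bnd _ _ h)).
  by rewrite distrC; lra.
apply: le_trans (max_lip _ _ _) _.
apply: le_trans (lip2 _ _ (b3 y y3) (b3 z z3)) _.
apply: (@le_trans _ _ (`|L2| * `|V i (submxrow y i) - V i (submxrow z i)|)).
  by rewrite ler_wpM2r// ler_norm.
rewrite -mulrA ler_wpM2l//.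
apply: le_trans (lip1 _ _ (bnd _ _ y1) (bnd _ _ z1)) _.
apply: (@le_trans _ _ (`|L1| * `|submxrow y i - submxrow z i|)).
  by rewrite ler_wpM2r// ler_norm.
by rewrite ler_wpM2l// -submxrowB submxrow_norm_le.
Qed.

Let W_lip : loc_lipschitz_nz W.
Proof.
move=> x x0; have Wx0 := proper_gt0 W_proper x0.
have r0 : 0 < W x / 2 by lra.
(* Near [x] the value of [W] stays above [r], so each [w i] may be replaced by its truncation at
   [r]. *)
set r := W x / 2 in r0.
have [d hd] := choice (fun i => w_lip i x r0); have [L hL] := choice hd.
have [d1 [d10 d1_le]] := fin_pos_min (fun i => (hL i).1).
have [d2 [d20 hd2]] := W_cont x r0.
exists (Num.min d1 d2), (\sum_i `|L i|); split; first by rewrite lt_min d10.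
move=> y z; rewrite !lt_min => /andP[y1 y2] /andP[z1 z2].
have WE (y' : 'rV[R]_(\sum_(j < n) Ni j)) : `|y' - x| < d2 ->
    W y' = \big[Num.max/0]_i Num.max r (w i y').
  move=> /hd2; rewrite ler_norml => /andP[h1 _].
  have Wr : r <= W y' by rewrite /r in h1 *; lra.
  apply/le_anti/andP; split.
    by apply: le_bigmax2 => i _; rewrite le_max lexx orbT.
  apply: bigmax_le => // i _; rewrite ge_max Wr; exact: w_leW.
rewrite !WE//; apply: bigmax_dist.
  by rewrite mulr_ge0// sumr_ge0.
move=> i; apply: le_trans ((hL i).2 y z _ _) _; [exact: lt_le_trans y1 _|exact: lt_le_trans z1 _|].
rewrite ler_wpM2r//; have := ler_norm (L i).
have := @le_term_sum R n (fun j => `|L j|) i (fun j => normr_ge0 _).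
lra.
Qed.

(* [chi i] converts the slack [sigma i - Gamma (sigma)] of the path into an input margin:
   it is [alpha] of a single nonzero gain if row [i] has one, and [sigma i / 2] otherwise. *)
Let margin i : exists chi, isKinf chi /\ forall r s : R, 0 < r -> 0 <= s -> gi i s <= chi r ->
  (if isSum i then Gamma_op isSum gam (fun j => sigma j r) i + gi i s
   else Num.max (Gamma_op isSum gam (fun j => sigma j r) i) (gi i s)) < sigma i r.
Proof.
have om r : 0 < r -> D_op isSum alpha (Gamma_op isSum gam (fun j => sigma j r)) i < sigma i r.
  by move=> r0; exact: path.2.2.2.2.
have half : isKinf (fun r => 2^-1 * sigma i r).
  have h2 : 0 < (2^-1 : R) by lra.
  exact: Kinf_comp (Kinf_scale h2) (Ksig i).
case: (boolP (isSum i)) => Si; last first.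
  exists (fun r => 2^-1 * sigma i r); split => // r s r0 s0 h.
  have := om r r0; rewrite /D_op (negbTE Si) => h1; rewrite gt_max h1/=.
  by have := K_gt0 (Ksig i).1 r0; lra.
have [[j Kj]|nz] := pselect (exists j, isKinf (gam i j)).
  exists (fun r => alpha (gam i j (sigma j r))); split.
    exact: Kinf_comp Kalpha (Kinf_comp Kj (Ksig j)).
  move=> r s r0 s0 h; have := om r r0; rewrite /D_op Si.
  have sg0 k : 0 <= sigma k r by apply: K_ge0 (Ksig k).1 (ltW r0).
  have g0 : 0 <= gam i j (sigma j r) by exact: Kinf0_ge0.
  have : gam i j (sigma j r) <= Gamma_op isSum gam (fun j => sigma j r) i.
    rewrite /Gamma_op Si (bigD1 j)//= lerDl sumr_ge0// => k _; exact: Kinf0_ge0.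
  move=> /(K_le Kalpha.1 g0); lra.
exists (fun r => 2^-1 * sigma i r); split => // r s r0 s0 h.
have -> : Gamma_op isSum gam (fun j => sigma j r) i = 0.
  rewrite /Gamma_op Si big1// => j _.
  have [Kj|z] := Kgam i j; first by exfalso; apply: nz; exists j.
  by apply: z; exact: K_ge0 (Ksig j).1 (ltW r0).
by have := K_gt0 (Ksig i).1 r0; lra.
Qed.

Lemma omega_path_iss_lyap : iss_lyap (whole_rhs fs) W.
Proof.
split; first exact: W_continuous.
split; first exact: W_proper.
split; first exact: W_lip.
have [chi hchi] := choice margin.
have [cinv hcinv] := choice (fun i => Kinf_inverse (hchi i).1).
(* With this sum, a single condition on [W x] puts the input term of every index below its margin
   [chi i (W x)]. *)
pose g := fun s => s + \sum_i cinv i (gi i s).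
have Kg : isK g.
  apply: K_sum; first exact: Kinf_id.1.
  by move=> i; exact: K_comp (hcinv i).1.1 (Kgi i).
have [a ha] := choice (fun i => sub_decrease reg Kgam gam0 Kgi pV (lyap i)).
exists g.
have active x (u : 'rV[R]_(\sum_(j < n) mi j)) i : 0 < W x -> g `|u| <= W x -> w i x = W x ->
    gain_at isSum V gam gi i x `|u| < V i (submxrow x i).
  move=> W0 gu wi; set r := W x in W0 gu wi.
  have VE : V i (submxrow x i) = sigma i r.
    by rewrite -wi (sinvP i (proper_ge0 _ (pV i))).2.
  have Vle j : V j (submxrow x j) <= sigma j r.
    rewrite -(sinvP j (proper_ge0 (submxrow x j) (pV j))).2.
    by apply: K_le (Ksig j).1 (w_ge0 j x) (w_leW j x).
  have c0 j : 0 <= cinv j (gi j `|u|).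
    by apply: K_ge0 (hcinv j).1.1 _; exact: K_ge0.
  have ci : cinv i (gi i `|u|) <= r.
    apply: le_trans gu; rewrite /g.
    have := @le_term_sum R n (fun j => cinv j (gi j `|u|)) i c0.
    by have := normr_ge0 u; lra.
  have := K_le (hchi i).1.1 (c0 i) ci; rewrite ((hcinv i).2 _ (K_ge0 (Kgi i) (normr_ge0 u))).2.
  move=> /((hchi i).2 r `|u| W0 (normr_ge0 _)) h.
  rewrite VE; apply: le_lt_trans h; rewrite /gain_at.
  have := @Gamma_le R n isSum gam Kgam (fun j => V j (submxrow x j)) (fun j => sigma j r) i
    (fun j => proper_ge0 _ (pV j)) Vle.
  rewrite /Gamma_op; case: ifP => _ h2; first by rewrite lerD2r.
  by rewrite ge_max !le_max h2 lexx orbT.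
(* Pairs of a norm and a decay of [W] occurring at that norm; a positive lower bound of the decays
   on each compact range of norms will give the rate. *)
pose Q (s y : R) := 0 < s /\ exists (x : 'rV[R]_(\sum_(j < n) Ni j))
  (u : 'rV[R]_(\sum_(j < n) mi j)), [/\ `|x| = s, g `|u| <= W x,
   differentiable W x & y = - 'd W x (whole_rhs fs x u)].
suff Qc : forall r1 r2 : R, 0 < r1 -> r1 <= r2 -> exists c : R, 0 < c /\
     forall s y, Q s y -> r1 <= s -> s <= r2 -> c <= y.
  have [a' [pa' ha']] : exists a, posdef a /\ forall s y, Q s y -> a s <= y.
    apply: posdef_below => // s y Qsy; have [c [c0 hc]] := Qc s s Qsy.1 (lexx s).
    by apply: le_trans (ltW c0) (hc s y Qsy _ _).
  exists a'; split => //; split => // x u dW gu.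
  have [x0|x0] := eqVneq x 0; last first.
    have := ha' `|x| (- 'd W x (whole_rhs fs x u)).
    rewrite lerNr; apply; split; first by rewrite normr_gt0.
    by exists x, u.
  have -> : a' `|x| = 0 by rewrite x0 normr0; apply/(pa'.2.2 0 (lexx 0)).
  (* At the origin [W] has its minimum [0]; a positive derivative along [v] would make [W] negative
     along [- v]. *)
  rewrite oppr0 leNgt; apply/negP; set v := whole_rhs fs x u => dv.
  set p := 'd W x v in dv.
  have dN : 'd W x (- v) <= - p by rewrite linearN.
  have p2 : 0 < p / 2 by lra.
  have [d [d0 hd]] := diff_dini dW dN p2.
  have := hd (d / 2) ltac:(lra) ltac:(lra).
  have -> : W x = 0 by rewrite x0; exact: proper_0 W_proper.
  have := W_ge0 (x + d / 2 *: - v).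
  have : 0 < p * d by rewrite mulr_gt0.
  lra.
move=> r1 r2 r10 r12.
have [p1 [p2 [K1 [K2 hp]]]] := W_proper.
pose lo0 := p1 r1; have lo00 : 0 < lo0 by exact: K_gt0 K1.1 r10.
pose hi0 := p2 r2.
have [lo [lo_gt0 lo_le]] := fin_pos_min (fun i => K_gt0 (Ksig i).1 lo00).
have sh0 i : 0 <= sigma i hi0.
  by apply: K_ge0 (Ksig i).1 _; apply: K_ge0 K2.1 _; lra.
pose hi := \sum_i sigma i hi0 + lo.
have hi_ge i : sigma i hi0 <= hi.
  by have := @le_term_sum R n (fun j => sigma j hi0) i sh0; rewrite /hi; lra.
(* At a maximising index [V i] takes values in [[lo, hi]]; the interval starts at [lo / 2] to leave
   room for its decrease. *)
pose P : set R := `[lo / 2, hi]%classic.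
have [|c [C [c0 [_ hc]]]] := path.2.2.2.1 P _ (@segment_compact _ _ _).
  move=> t; rewrite /P /= !in_itv/= => /andP[h _]; rewrite andbT.
  by apply: lt_le_trans h; lra.
have slope i s t : lo / 2 <= s -> s <= t -> t <= hi -> c * (t - s) <= sinv i t - sinv i s.
  apply: slope_lower => r h1 h2; first by apply: path.2.2.1; lra.
  move=> dr; have Pr : P r by rewrite /P/= in_itv/= h1 h2.
  by case: (hc i r Pr dr).
have [k hk] := choice (fun i => rate_lower hi (pV i) (ha i).1 (lo_gt0)).
have [kk [kk0 kk_le]] := fin_pos_min (fun i => (hk i).1).
(* [c] is a lower slope of every [sinv i] and [kk] a lower decay rate of every [V i]; half of the
   latter is given up to the tolerance of the Dini estimate. *)
have kap0 : 0 < c * (kk / 2) by rewrite mulr_gt0//; lra.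
exists (c * (kk / 2)); split => // s y [s0 [x [u [xs gu dW ->]]]] s1 s2.
have [Wlo Whi] : lo0 <= W x /\ W x <= hi0.
  have [h1 h2] := hp x; split.
    by apply: le_trans h1; rewrite xs; apply: K_le K1.1 _ _; lra.
  by apply: le_trans h2 _; rewrite xs; apply: K_le K2.1 _ _; lra.
have Wx0 : 0 < W x by lra.
rewrite lerNr; apply: diff_dini_ge => //.
set F := whole_rhs fs x u.
have Fi i : submxrow F i = fs i x (submxrow u i) by rewrite /F /whole_rhs mxrowK.
have each i : exists d : R, 0 < d /\ forall h : R, 0 < h -> h < d ->
    w i (x + h *: F) <= W x - c * (kk / 2) * h.
  have F1 : 0 < `|F| + 1 by rewrite ltr_wpDl.
  have near_x (dd : R) h : 0 < h -> h < dd / (`|F| + 1) -> `|x + h *: F - x| < dd.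
    move=> h0; rewrite ltr_pdivlMr// => hlt; rewrite (addrC x) addrK normrZ gtr0_norm//.
    by apply: le_lt_trans hlt; rewrite ler_wpM2l ?ltW// ltrDl.
  (* A non-maximal index has a gap to [W x], which absorbs its variation for short times; only
     maximal ones need the decay. *)
  have [wi|wi] := eqVneq (w i x) (W x); last first.
    have e0 : 0 < (W x - w i x) / 2.
      have : w i x < W x by rewrite lt_neqAle wi w_leW.
      lra.
    have [d [d0 hd]] := w_cont i x e0.
    exists (Num.min (d / (`|F| + 1)) ((W x - w i x) / 2 / (c * (kk / 2)))).
    split; first by rewrite lt_min (divr_gt0 d0 F1) (divr_gt0 e0 kap0).
    move=> h h0; rewrite lt_min => /andP[h1 h2].
    have := hd _ (near_x d h h0 h1); rewrite ler_norml => /andP[_ h3].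
    by move: h2; rewrite ltr_pdivlMr// => h2; lra.
  have ga := active x u i Wx0 gu wi.
  have VE : V i (submxrow x i) = sigma i (W x).
    by rewrite -wi (sinvP i (proper_ge0 _ (pV i))).2.
  have Vlo : lo <= V i (submxrow x i).
    by rewrite VE; apply: le_trans (lo_le i) _; apply: K_le (Ksig i).1 (ltW lo00) Wlo.
  have Vhi : V i (submxrow x i) <= hi.
    by rewrite VE; apply: le_trans (hi_ge i); apply: K_le (Ksig i).1 (ltW Wx0) Whi.
  have ak := (hk i).2 _ Vlo Vhi.
  have akk : kk <= a i `|submxrow x i| := le_trans (kk_le i) ak.
  have a2 : 0 < a i `|submxrow x i| / 2 by lra.
  have [d1 [d10 hd1]] := (ha i).2 x u ga _ a2.
  have l2 : 0 < lo / 2 by lra.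
  have /cvgrPdist_le/(_ _ l2)/nbhs_ballP[d2 /= d20 h2] := (lyap i).1 (submxrow x i).
  exists (Num.min d1 (d2 / (`|F| + 1))); split; first by rewrite lt_min d10 (divr_gt0 d20 F1).
  move=> h h0; rewrite lt_min => /andP[h1 hlt2].
  have := hd1 h h0 h1; rewrite -Fi.
  have xE : submxrow (x + h *: F) i = submxrow x i + h *: submxrow F i.
    by apply/rowP => j; rewrite !mxE.
  rewrite -xE => dec.
  set b := V i (submxrow (x + h *: F) i) in dec *; set b0 := V i (submxrow x i) in dec Vlo Vhi VE *.
  have bd : b <= b0 - kk / 2 * h.
    have := ler_wpM2r (ltW h0) akk; lra.
  have blo : lo / 2 <= b.
    have := h2 (submxrow (x + h *: F) i); rewrite mx_norm_ball /ball_/= -submxrowB distrC.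
    have nx := near_x _ _ h0 hlt2; rewrite distrC in nx.
    move=> H; have {H} := H (le_lt_trans (submxrow_norm_le _ _) nx).
    by rewrite -/b -/b0 ler_norml => /andP[+ _]; lra.
  have kh : 0 < kk / 2 * h by rewrite mulr_gt0//; lra.
  have := slope i b b0 blo ltac:(lra) Vhi.
  have -> : sinv i b0 = W x by rewrite -wi.
  rewrite -/(w i (x + h *: F)) => sl.
  have := ler_wpM2l (ltW c0) bd; lra.
have [d hd] := choice each.
have [d1 [d10 d1_le]] := fin_pos_min (fun i => (hd i).1).
(* The second bound keeps the target nonnegative, as the maximum has default value [0]. *)
exists (Num.min d1 (W x / (c * (kk / 2)))); split; first by rewrite lt_min d10 (divr_gt0 Wx0 kap0).
move=> h h0; rewrite lt_min => /andP[h1 h2].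
rewrite lerBlDr mulNr (addrC (- _)); apply: bigmax_le.
  by move: h2; rewrite ltr_pdivlMr//; lra.
by move=> i _; apply: (hd i).2 => //; exact: lt_le_trans h1 (d1_le i).
Qed.

End omega_path_lyapunov.

(** * Trajectories: Lipschitz bounds and almost everywhere right derivatives *)

Section integral.
Context {R : realType}.
Notation mu := (@lebesgue_measure R).

Lemma Rintegral_diff_le (f : R -> R) (T s t M : R) :
  mu.-integrable `[0, T] (EFin \o f) -> (forall r, 0 <= r -> r <= T -> `|f r| <= M) ->
  0 <= s -> s <= t -> t <= T ->
  `|\int[mu]_(r in `[0, t]) f r - \int[mu]_(r in `[0, s]) f r| <= M * (t - s).
Proof.
move=> intf fM s0 st tT.
have i0t : mu.-integrable `[0, t] (EFin \o f).
  by apply: integrableS intf => //; apply: subset_itvl; rewrite bnd_simp.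
rewrite Rintegral_itvB//.
have ist : mu.-integrable `]s, t] (EFin \o f).
  by apply: integrableS i0t => //; apply: subset_itvr; rewrite bnd_simp.
apply: le_trans (le_normr_Rintegral _ ist) _ => //.
have mst : mu `]s, t]%classic = (t - s)%:E.
  rewrite lebesgue_measure_itv/= lte_fin; case: ltP => [_|ts]; first by rewrite -EFinD.
  have ts' : t = s by lra.
  by rewrite ts' subrr.
have -> : M * (t - s) = \int[mu]_(r in `]s, t]) M.
  by rewrite Rintegral_cst//= [mu _]mst.
apply: le_Rintegral => //.
- by apply: integrable_norm ist.
- apply: measurable_bounded_integrable => //.
    by rewrite [ltLHS]mst ltry.
  by exists `|M|; split; rewrite ?num_real// => x xM r _; exact: ltW.
- by move=> r /=; rewrite in_itv/= => /andP[h1 h2]; apply: fM; lra.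
Qed.

Lemma negligible_ord N (A : 'I_N -> set R) : (forall k, mu.-negligible (A k)) ->
  mu.-negligible [set t | exists k, A k t].
Proof.
move=> h; pose B (i : nat) : set R := if insub i is Some k then A k else set0.
have : mu.-negligible (\bigcup_i B i).
  apply: negligible_bigcup => i; rewrite /B; case: insubP => [k _ _|_]; first exact: h.
  exact: negligible_set0.
by apply: negligibleS => t /= [k Akt]; exists (val k) => //; rewrite /B valK.
Qed.

Lemma continuous_measurable_rV d (T : measurableType d) k (g : 'rV[R]_k -> R)
    (p : T -> 'rV[R]_k) : continuous g ->
  (forall j, measurable_fun setT (fun t => p t 0 j)) ->
  measurable_fun setT (fun t => g (p t)).
Proof.
move=> cg mp; apply: (measurability _ (RGenOInfty.measurableE R)) => _ [_ [a ->] <-].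
rewrite setTI; apply: (@measurable_preimage_open _ _ _ _ p (g @^-1` `]a, +oo[%classic)) => //.
by apply: open_comp => [? _|]; [exact: cg|exact: interval_open].
Qed.

Definition right_deriv k (x : R -> 'rV[R]_k) (t : R) (v : 'rV[R]_k) :=
  forall e : R, 0 < e -> exists d : R, 0 < d /\ forall h : R, 0 < h -> h < d ->
    `|x (t + h) - x t - h *: v| <= e * h.

(* Weaker than solving the equation, so that it also covers solutions of the clipped system
   as long as they stay in the ball. *)
Definition arc N m (F : 'rV[R]_N -> 'rV[R]_m -> 'rV[R]_N) (u : R -> 'rV[R]_m)
    (x : R -> 'rV[R]_N) (T : R) :=
  (exists M : R, forall s t, 0 <= s -> s <= T -> 0 <= t -> t <= T ->
     `|x s - x t| <= M * `|s - t|) /\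
  mu.-negligible [set t | 0 < t /\ t < T /\ ~ right_deriv x t (F (x t) (u t))].

Lemma integral_ae_deriv (f : R -> R) (T : R) :
  mu.-integrable `[0, T] (EFin \o f) ->
  mu.-negligible [set t | 0 < t /\ t < T /\ ~ (forall e : R, 0 < e -> exists d : R, 0 < d /\
    forall h : R, 0 < h -> h < d ->
    `|\int[mu]_(r in `[0, t + h]) f r - \int[mu]_(r in `[0, t]) f r - f t * h| <= e * h)].
Proof.
move=> intf; pose g := f \_ `[0, T].
have gE t : 0 <= t -> t <= T -> g t = f t.
  by move=> t0 tT; rewrite /g patchE mem_set//= in_itv/= t0 tT.
have intg : mu.-integrable `[0, T] (EFin \o g).
  apply: (eq_integrable _ _ _ _ intf) => // t; rewrite inE/= in_itv/= => /andP[t0 tT].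
  by rewrite gE.
have intE t : 0 <= t -> t <= T -> \int[mu]_(r in `[0, t]) g r = \int[mu]_(r in `[0, t]) f r.
  move=> t0 tT; apply: eq_Rintegral => r; rewrite inE/= in_itv/= => /andP[r0 rt].
  by rewrite gE//; exact: le_trans rt tT.
have locg : locally_integrable setT g by apply: integrable_locally_restrict.
have := lebesgue_differentiation locg.
apply: negligibleS => t /= [t0 [tT nd]] lp; apply: nd => e e0.
have [dF dE] := @FTC1_lebesgue_pt R g (BLeft 0) t T tT intg ltac:(by rewrite lte_fin) lp.
have [d [d0 hd]] := derivable_approx dF e0.
exists (Num.min d (T - t)); split; first by rewrite lt_min d0 subr_gt0.
move=> h h0; rewrite lt_min => /andP[h1 h2].
have := hd h; rewrite gtr0_norm// => /(_ h1).
rewrite -derive1E dE gE ?intE//; lra.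
Qed.

Lemma rhs_bounded N m (F : 'rV[R]_N -> 'rV[R]_m -> 'rV[R]_N) (B c : R) :
  continuous (fun p : 'rV[R]_N * 'rV[R]_m => F p.1 p.2) ->
  exists M : R, 0 <= M /\ forall y w, `|y| <= B -> `|w| <= c -> `|F y w| <= M.
Proof.
move=> cF.
have cball k (r : R) : compact [set y : 'rV[R]_k | `|y| <= r].
  apply: bounded_closed_compact.
    by exists r; split; rewrite ?num_real// => x rx y /= yr; exact: le_trans yr (ltW rx).
  apply: (@closed_comp _ _ (fun y : 'rV[R]_k => `|y|) [set z | z <= r]) => [y _|].
    exact: norm_continuous.
  exact: closed_le.
have cK := compact_setX (cball N B) (cball m c).
have := continuous_compact (continuous_subspaceT cF) cK.
move=> /compact_bounded[M [_ hM]]; exists (`|M| + 1); split; first by rewrite addr_ge0.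
move=> y w yB wc; apply: (hM (`|M| + 1)); first by rewrite ltr_pwDr// ler_norm.
by exists (y, w).
Qed.

(** Continuity of the integrals bounds the trajectory on compact time intervals; then [F] is bounded
    along it, which gives the Lipschitz constant. Right derivatives exist at the common Lebesgue
    points of the coordinates. *)
Lemma solution_arc N m (F : 'rV[R]_N -> 'rV[R]_m -> 'rV[R]_N) u x0 x (c T : R) :
  continuous (fun p : 'rV[R]_N * 'rV[R]_m => F p.1 p.2) ->
  (forall t, 0 <= t -> `|u t| <= c) -> is_solution F u x0 x -> 0 <= T -> arc F u x T.
Proof.
move=> cF uc [xi sol] T0; pose T1 := T + 1.
have T10 : 0 <= T1 by rewrite /T1; lra.
pose f k s := F (x s) (u s) 0 k.
have intf k : mu.-integrable `[0, T1] (EFin \o f k) by case: (sol T1 T10 k).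
have xE k t : 0 <= t -> x t 0 k = x0 0 k + \int[mu]_(s in `[0, t]) f k s.
  by move=> t0; case: (sol t t0 k).
have xDE k (s t : R) : 0 <= s -> 0 <= t -> x t 0 k - x s 0 k =
    \int[mu]_(r in `[0, t]) f k r - \int[mu]_(r in `[0, s]) f k r.
  by move=> s0 t0; rewrite (xE k t t0) (xE k s s0); lra.
have [B hB] : exists B : R, forall t, 0 <= t -> t <= T1 -> `|x t| <= B.
  have bk k : exists b : R, forall t, 0 <= t -> t <= T1 -> `|x t 0 k| <= b.
    have ck := parameterized_integral_continuous T10 (intf k).
    have := continuous_compact ck (@segment_compact _ 0 T1).
    move=> /compact_bounded[M [_ hM]]; exists (`|x0 0 k| + (`|M| + 1)) => t t0 tT.
    rewrite xE//; apply: le_trans (ler_normD _ _) _; rewrite lerD2l.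
    apply: (hM (`|M| + 1)); first by rewrite ltr_pwDr// ler_norm.
    by exists t => //=; rewrite in_itv/= t0 tT.
  have [b hb] := choice bk.
  exists (\sum_k `|b k|) => t t0 tT; apply: rV_norm_le; first by apply: sumr_ge0.
  move=> k; apply: le_trans (hb k t t0 tT) _; apply: le_trans (ler_norm _) _.
  by rewrite (bigD1 k)//= lerDl sumr_ge0.
have [M [M0 hM]] := rhs_bounded B c cF.
have fM k t : 0 <= t -> t <= T1 -> `|f k t| <= M.
  move=> t0 tT; apply: le_trans (rV_coord_le (F (x t) (u t)) k) _.
  by apply: hM; [exact: hB|exact: uc].
split.
  have lip s t : 0 <= s -> s <= t -> t <= T1 -> `|x t - x s| <= M * (t - s).
    move=> s0 st tT; apply: rV_norm_le; first by rewrite mulr_ge0//; lra.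
    move=> k; rewrite 2!mxE xDE; [|lra|lra].
    exact: Rintegral_diff_le (intf k) (fM k) _ _ _.
  exists M => s t s0 sT t0 tT.
  have sT1 : s <= T1 by rewrite /T1; lra.
  have tT1 : t <= T1 by rewrite /T1; lra.
  have [st|/ltW ts] := leP s t.
    by rewrite distrC (distrC s) (ger0_norm (x := t - s)) ?subr_ge0//; exact: lip.
  by rewrite (ger0_norm (x := s - t)) ?subr_ge0//; exact: lip.
have := negligible_ord (fun k => integral_ae_deriv (intf k)).
apply: negligibleS => t /= [t0 [tT nd]]; apply: contrapT => /forallNP h.
apply: nd => e e0.
have hk k : exists d : R, 0 < d /\ forall h : R, 0 < h -> h < d ->
    `|\int[mu]_(r in `[0, t + h]) f k r - \int[mu]_(r in `[0, t]) f k r - f k t * h| <= e * h.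
  apply: contrapT => nk; apply: (h k); split => //; split; first by rewrite /T1; lra.
  by move=> /(_ e e0).
have [d hd] := choice hk.
have [d1 [d10 d1_le]] := fin_pos_min (fun i => (hd i).1).
exists d1; split => // s s0 sd; apply: rV_norm_le; first by rewrite mulr_ge0// ltW.
move=> k; have := (hd k).2 s s0 (lt_le_trans sd (d1_le k)).
rewrite -xDE; [|lra|lra].
by rewrite 5!mxE (mulrC s).
Qed.

Lemma arc_sub N m (F F' : 'rV[R]_N -> 'rV[R]_m -> 'rV[R]_N) u x (T T' : R) :
  arc F u x T -> T' <= T -> (forall t, 0 <= t -> t <= T' -> F' (x t) (u t) = F (x t) (u t)) ->
  arc F' u x T'.
Proof.
move=> [[M lip] neg] TT FF; split.
  by exists M => s t s0 sT t0 tT; apply: lip => //; exact: le_trans TT.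
apply: negligibleS neg => t /= [t0 [tT nd]]; split => //; split; first exact: lt_le_trans TT.
by rewrite -FF//; exact: ltW.
Qed.

End integral.

(** * Picard iteration on the half-line *)

Section existence.
Context {R : realType}.
Notation mu := (@lebesgue_measure R).

Lemma Rintegral_expR (K t : R) : 0 < K -> 0 <= t ->
  mu.-integrable `[0, t] (EFin \o (fun s => expR (K * s))) /\
  \int[mu]_(s in `[0, t]) expR (K * s) <= K^-1 * expR (K * t).
Proof.
move=> K0 t0.
have cE : continuous (fun s : R => expR (K * s)).
  move=> s; apply: (@continuous_comp _ _ _ ( *%R K) expR); last exact: continuous_expR.
  exact: mulrl_continuous.
have int : mu.-integrable `[0, t] (EFin \o (fun s => expR (K * s))).
  apply: continuous_compact_integrable; first exact: segment_compact.
  exact: continuous_subspaceT.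
split => //.
have [->|tn0] := eqVneq t 0.
  rewrite set_itv1 /Rintegral integral_set1 ?expR0//= mulr_ge0// invr_ge0 ltW//.
have {tn0}t0' : 0 < t by rewrite lt_neqAle eq_sym tn0.
have dE (s : R) : is_derive s (1 : R) (fun s => K^-1 * expR (K * s)) (expR (K * s)).
  apply: is_derive_eq; rewrite /GRing.scale/= !mulr1 ?scaler0.
  by field; exact: lt0r_neq0.
rewrite /Rintegral (@continuous_FTC2 R _ (fun s => K^-1 * expR (K * s)))//=.
- by rewrite gerBl mulr_ge0 ?expR_ge0// invr_ge0 ltW.
- exact: continuous_subspaceT.
- have cF (s : R) : (fun s => K^-1 * expR (K * s)) @ s --> K^-1 * expR (K * s).
    by apply: cvgM; [exact: cvg_cst|exact: cE].
  split; [by move=> s _; exact: (@ex_derive _ _ _ _ _ _ _ (dE s))| |].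
    exact: cvg_at_right_filter.
  exact: cvg_at_left_filter.
- by move=> s _; rewrite derive1E; exact: derive_val.
Qed.

Lemma Rintegral_dist_le (f g : R -> R) (C K t : R) : 0 < K -> 0 <= t ->
  mu.-integrable `[0, t] (EFin \o f) -> mu.-integrable `[0, t] (EFin \o g) ->
  (forall s, 0 <= s -> `|f s - g s| <= C * expR (K * s)) -> 0 <= C ->
  `|\int[mu]_(s in `[0, t]) f s - \int[mu]_(s in `[0, t]) g s| <= C * K^-1 * expR (K * t).
Proof.
move=> K0 t0 intf intg fg C0; have [intE leE] := Rintegral_expR K0 t0.
rewrite -RintegralB//.
have intB : mu.-integrable `[0, t] (EFin \o (fun s => f s - g s)).
  by apply: (eq_integrable _ _ _ _ (integrableB _ intf intg)) => // s _.
apply: le_trans (le_normr_Rintegral _ intB) _ => //.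
apply: (@le_trans _ _ (\int[mu]_(s in `[0, t]) (C * expR (K * s)))).
  apply: le_Rintegral => //.
  - exact: integrable_norm intB.
  - by apply: (eq_integrable _ _ _ _ (integrableZl _ C intE)) => // s _.
  - by move=> s /=; rewrite in_itv/= => /andP[s0 _]; exact: fg.
by rewrite RintegralZl// -mulrA ler_wpM2l.
Qed.

(** Compactness is applied to pairs of points. Near the diagonal the local constant serves; near a
    pair [a != b] the distance stays above half of that between [a] and [b], and the bound [2 * M]
    on the difference of values gives a constant. *)
Lemma loc_lip_compact N m (F : 'rV[R]_N -> 'rV[R]_m -> 'rV[R]_N) (B c : R) :
  regular_rhs F -> exists L : R, 1 <= L /\ forall y z w,
    `|y| <= B -> `|z| <= B -> `|w| <= c -> `|F y w - F z w| <= L * `|y - z|.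
Proof.
move=> [cF lipF]; have [M [M0 hM]] := rhs_bounded B c cF.
have cball : compact [set y : 'rV[R]_N | `|y| <= B].
  apply: bounded_closed_compact.
    by exists B; split; rewrite ?num_real// => x rx y /= yr; exact: le_trans yr (ltW rx).
  apply: (@closed_comp _ _ (fun y : 'rV[R]_N => `|y|) [set z | z <= B]) => [y _|].
    exact: norm_continuous.
  exact: closed_le.
have /compact_near_coveringP cov := compact_setX cball cball.
pose P (L : R) (p : 'rV[R]_N * 'rV[R]_N) := `|p.1| <= B -> `|p.2| <= B ->
  forall w, `|w| <= c -> `|F p.1 w - F p.2 w| <= L * `|p.1 - p.2|.
have : \forall L \near +oo, [set y | `|y| <= B] `*` [set y | `|y| <= B] `<=` P L.
  apply: cov => -[a b] [/= aB bB].
  have [ab|ab] := eqVneq a b.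
    rewrite {}ab in aB *; have [d [L [d0 hd]]] := lipF c b.
    have nb : nbhs b [set y : 'rV[R]_N | `|y - b| < d].
      by apply/nbhs_ballP; exists d => //= y; rewrite mx_norm_ball /ball_/= distrC.
    exists ([set p | `|p.1 - b| < d /\ `|p.2 - b| < d], [set L' | L < L']).
      split; last by exists L; rewrite num_real.
      by exists ([set y | `|y - b| < d], [set y | `|y - b| < d]).
    move=> [[y z] L'] [/= [yd zd] LL] _ _ w wc /=.
    by apply: le_trans (hd _ _ _ yd zd wc) _; rewrite ler_wpM2r// ltW.
  have d0 : 0 < `|a - b| by rewrite normr_gt0 subr_eq0.
  have d4 : 0 < `|a - b| / 4 by rewrite divr_gt0.
  have nb (q : 'rV[R]_N) : nbhs q [set y : 'rV[R]_N | `|y - q| < `|a - b| / 4].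
    by apply/nbhs_ballP; exists (`|a - b| / 4) => //= y; rewrite mx_norm_ball /ball_/= distrC.
  exists ([set p | `|p.1 - a| < `|a - b| / 4 /\ `|p.2 - b| < `|a - b| / 4],
          [set L' | 4 * M / `|a - b| < L']).
    split; last by exists (4 * M / `|a - b|); rewrite num_real.
    by exists ([set y | `|y - a| < `|a - b| / 4], [set y | `|y - b| < `|a - b| / 4]).
  move=> [[y z] L'] [/= [yd zd] LL] yB zB w wc /=.
  have yz : `|a - b| / 2 <= `|y - z|.
    have : `|a - b| <= `|y - z| + `|y - a| + `|z - b|.
      have -> : a - b = (y - z) - (y - a) + (z - b).
        by apply/rowP => j; rewrite !mxE; lra.
      by apply: le_trans (ler_normD _ _) _; rewrite lerD2r; exact: ler_normB.
    lra.
  apply: (@le_trans _ _ (2 * M)).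
    apply: le_trans (ler_normB _ _) _.
    by have := hM _ _ yB wc; have := hM _ _ zB wc; lra.
  apply: (@le_trans _ _ (4 * M / `|a - b| * (`|a - b| / 2))).
    by rewrite le_eqVlt; apply/orP; left; apply/eqP; field; exact: lt0r_neq0.
  apply: ler_pM (ltW LL) yz; last by rewrite divr_ge0.
  by rewrite divr_ge0// mulr_ge0.
move=> [L [_ hL]]; exists (Num.max 1 (L + 1)); split; first by rewrite le_max lexx.
move=> y z w yB zB wc; have LL : L < Num.max 1 (L + 1) by rewrite lt_max ltrDl ltr01 orbT.
exact: (hL _ LL (y, z) _ yB zB w wc).
Qed.

Section picard.
Variables (N m : nat) (G : 'rV[R]_N -> 'rV[R]_m -> 'rV[R]_N) (c L M : R).
Variables (u : R -> 'rV[R]_m) (x0 : 'rV[R]_N).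
Hypothesis cG : continuous (fun p : 'rV[R]_N * 'rV[R]_m => G p.1 p.2).
Hypothesis L1 : 1 <= L.
Hypothesis M0 : 0 <= M.
Hypothesis GL : forall y z w, `|w| <= c -> `|G y w - G z w| <= L * `|y - z|.
Hypothesis GM : forall y w, `|w| <= c -> `|G y w| <= M.
Hypothesis mu_ : forall k, measurable_fun setT (fun t : R => u t 0 k).
Hypothesis uc : forall t : R, 0 <= t -> `|u t| <= c.

Let lip (y : R -> 'rV[R]_N) := forall s t : R, `|y s - y t| <= M * `|s - t|.

(** Concatenating state and input makes the right-hand side a continuous function of one row vector,
    to which [continuous_measurable_rV] applies. *)
Let cGk k : continuous (fun v : 'rV[R]_(N + m) => G (lsubmx v) (rsubmx v) 0 k).
Proof.
apply: eps_delta_continuous => v e e0.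
have /cvgrPdist_le/(_ _ e0)/nbhs_ballP[d /= d0 hd] := @cG (lsubmx v, rsubmx v).
exists d; split => // y yd.
have := hd (lsubmx y, rsubmx y); rewrite /= => H.
have {H} := H _.
  rewrite distrC => h; apply: le_trans (h _); last first.
    split => /=; rewrite mx_norm_ball /ball_/= distrC; apply: le_lt_trans yd;
    apply: rV_norm_le => // j; rewrite !mxE.
      by have := rV_coord_le (y - v) (lshift m j); rewrite !mxE.
    by have := rV_coord_le (y - v) (rshift N j); rewrite !mxE.
  by have := rV_coord_le (G (lsubmx y) (rsubmx y) - G (lsubmx v) (rsubmx v)) k; rewrite !mxE.
Qed.

Let integrable_rhs y k t : lip y -> mu.-integrable `[0, t] (EFin \o (fun s => G (y s) (u s) 0 k)).
Proof.
move=> ly.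
have mrow j : measurable_fun setT (fun s : R => row_mx (y s) (u s) 0 j).
  case: (split_ordP j) => i ->.
    rewrite (_ : (fun s => _) = (fun s => y s 0 i)); last by apply/funext => s; rewrite row_mxEl.
    apply: continuous_measurable_fun; apply: (@lip_continuous _ _ _ M) => s s'.
    by apply: le_trans (ly s s'); have := rV_coord_le (y s - y s') i; rewrite !mxE.
  by rewrite (_ : (fun s => _) = (fun s => u s 0 i)) //; apply/funext => s; rewrite row_mxEr.
have mG := continuous_measurable_rV (@cGk k) mrow.
apply: measurable_bounded_integrable => //.
- by have := lebesgue_measure_itv (`[0, t]%R : interval R) => /= ->; case: ifP; rewrite ?ltry.
- apply: (@measurable_funS _ _ _ _ setT) => //.
  by apply: eq_measurable_fun mG => s _; rewrite row_mxKl row_mxKr.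
exists M; split; rewrite ?num_real// => B MB s /=; rewrite in_itv/= => /andP[s0 _].
apply: le_trans (ltW MB); apply: le_trans (rV_coord_le (G (y s) (u s)) k) _.
by apply: GM; exact: uc.
Qed.

Let step (y : R -> 'rV[R]_N) (t : R) : 'rV[R]_N :=
  \row_k (x0 0 k + \int[mu]_(s in `[0, t]) G (y s) (u s) 0 k).

(** Integrals over empty or one-point intervals vanish, so the iterates extend constantly to
    negative times and [lip] can be required on the whole line. *)
Let step_neg y (t : R) : t <= 0 -> step y t = x0.
Proof.
move=> t0; apply/rowP => k; rewrite mxE; case: (ltgtP t 0) t0 => // [t0|->] _.
  by rewrite set_itv_ge ?bnd_simp -?ltNge// Rintegral_set0 addr0.
by rewrite set_itv1 /Rintegral integral_set1/= addr0.
Qed.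

Let step_lip y : lip y -> lip (step y).
Proof.
move=> ly; have one (s t : R) : 0 <= s -> s <= t -> `|step y t - step y s| <= M * (t - s).
  move=> s0 st; apply: rV_norm_le; first by rewrite mulr_ge0// subr_ge0.
  move=> k; rewrite !mxE opprD addrACA subrr add0r.
  apply: (@Rintegral_diff_le _ _ t) => //; first exact: integrable_rhs.
  move=> r r0 _; apply: le_trans (rV_coord_le (G (y r) (u r)) k) _.
  by apply: GM; exact: uc.
have two (s t : R) : s <= t -> `|step y t - step y s| <= M * (t - s).
  move=> st; have [s0|/ltW s0] := leP 0 s; first exact: one.
  have [t0|/ltW t0] := leP 0 t; last by rewrite !step_neg// subrr normr0 mulr_ge0// subr_ge0.
  rewrite (step_neg _ s0) -(step_neg y (lexx 0)); apply: le_trans (one _ _ _ t0) _ => //.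
  by rewrite ler_wpM2l//; lra.
move=> s t; have [st|/ltW ts] := leP s t.
  by rewrite distrC (distrC s) (ger0_norm (x := t - s)) ?subr_ge0//; exact: two.
by rewrite (ger0_norm (x := s - t)) ?subr_ge0//; exact: two.
Qed.

(** Integrating the weight [expR (2 * L * t)] gains the factor [(2 * L)^-1] against the Lipschitz
    constant [L], so the step contracts by [1 / 2] on the whole half-line, whatever [L]. *)
Let step_contr y z (C : R) : lip y -> lip z -> 0 <= C ->
  (forall t : R, 0 <= t -> `|y t - z t| <= C * expR (2 * L * t)) ->
  forall t : R, 0 <= t -> `|step y t - step z t| <= C / 2 * expR (2 * L * t).
Proof.
move=> ly lz C0 yz t t0; have L0 : 0 < L := lt_le_trans ltr01 L1.
have L2 : 0 < 2 * L by rewrite mulr_gt0.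
apply: rV_norm_le; first by rewrite mulr_ge0 ?expR_ge0// divr_ge0.
move=> k; rewrite !mxE opprD addrACA subrr add0r.
have -> : C / 2 = (L * C) * (2 * L)^-1 by field; exact: lt0r_neq0.
apply: Rintegral_dist_le => //; [exact: integrable_rhs|exact: integrable_rhs| |by rewrite mulr_ge0// ltW].
move=> s s0; have := rV_coord_le (G (y s) (u s) - G (z s) (u s)) k; rewrite !mxE => h.
apply: le_trans h _; apply: le_trans (GL _ _ (uc s0)) _.
by rewrite -mulrA ler_wpM2l ?yz// ltW.
Qed.

Let it n := iter n step (fun=> x0).

Let it_lip n : lip (it n).
Proof.
elim: n => [|n IH]; last exact: step_lip.
by move=> s t; rewrite /= subrr normr0 mulr_ge0.
Qed.

Let it_succ n (t : R) : 0 <= t -> `|it n.+1 t - it n t| <= M / 2 ^+ n * expR (2 * L * t).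
Proof.
elim: n t => [|n IH] t t0; last first.
  have -> : M / 2 ^+ n.+1 = M / 2 ^+ n / 2 by rewrite exprS; field; rewrite expf_neq0.
  apply: (step_contr (@it_lip n.+1) (@it_lip n)) => //; by rewrite divr_ge0// exprn_ge0.
rewrite expr0 divr1 [it 0 t](_ : _ = step (it 0) 0); last by rewrite step_neg.
apply: le_trans (step_lip (@it_lip 0) _ _) _; rewrite ler_wpM2l// subr0 ger0_norm//.
apply: le_trans (expR_ge1Dx _); apply: (@le_trans _ _ (2 * L * t)); last by rewrite lerDr.
have h2 : 1 <= 2 :> R by rewrite ler1n.
by apply: ler_peMl t0 _; apply: le_trans h2 _; apply: ler_peMr.
Qed.

Let it_dist n p (t : R) : 0 <= t -> `|it (n + p) t - it n t| <= 2 * M / 2 ^+ n * expR (2 * L * t).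
Proof.
move=> t0; pose E := expR (2 * L * t); have E0 : 0 <= E := expR_ge0 _.
(* The telescoping sum is kept in this sharper form so that the induction on [p] closes. *)
suff : `|it (n + p) t - it n t| <= (2 * M / 2 ^+ n - 2 * M / 2 ^+ (n + p)) * E.
  move=> /le_trans; apply; rewrite ler_wpM2r// gerBl divr_ge0 ?mulr_ge0// exprn_ge0//.
elim: p => [|p IH]; first by rewrite addn0 !subrr normr0 mul0r.
have -> : it (n + p.+1) t - it n t = (it (n + p).+1 t - it (n + p)%N t) + (it (n + p)%N t - it n t).
  by rewrite addrA subrK addnS.
apply: le_trans (ler_normD _ _) _.
apply: le_trans (lerD (it_succ (n + p)%N t0) IH) _.
rewrite addnS exprS -/E.
rewrite le_eqVlt; apply/orP; left; apply/eqP.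
by field; rewrite !expf_neq0.
Qed.

Let limit_exists (t : R) : exists l : 'rV[R]_N, 0 <= t -> forall n,
  `|l - it n t| <= 2 * M / 2 ^+ n * expR (2 * L * t).
Proof.
have [t0|t0] := leP 0 t; last by exists 0.
have e0 n : 0 <= 2 * M / 2 ^+ n * expR (2 * L * t).
  by rewrite mulr_ge0 ?expR_ge0// divr_ge0 ?mulr_ge0// exprn_ge0.
have lk k : exists a : R, forall n, `|a - it n t 0 k| <= 2 * M / 2 ^+ n * expR (2 * L * t).
  have [||a ha] := @consistent_limit R (fun e b => exists n,
      e = 2 * M / 2 ^+ n * expR (2 * L * t) /\ b = it n t 0 k).
  - by exists (2 * M / 2 ^+ 0 * expR (2 * L * t)), (it 0 t 0 k), 0%N.
  - have one (n p : nat) : (n <= p)%N ->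
       `|it p t 0 k - it n t 0 k| <= 2 * M / 2 ^+ n * expR (2 * L * t).
      move=> /subnKC <-; apply: le_trans (it_dist n (p - n) t0).
      by have := rV_coord_le (it (n + (p - n)) t - it n t) k; rewrite !mxE.
    move=> _ _ _ _ [n [-> ->]] [p [-> ->]]; have [np|/ltnW pn] := leqP n p.
      by rewrite distrC; have := one _ _ np; have := e0 p; lra.
    by have := one _ _ pn; have := e0 n; lra.
  by exists a => n; apply: ha; exists n.
have [a ha] := choice lk; exists (\row_k a k) => _ n.
by apply: rV_norm_le => // k; rewrite !mxE.
Qed.

Lemma picard : exists x, is_solution G u x0 x.
Proof.
have [x hx] := choice limit_exists.
(* The limit is only determined for [t >= 0]; the value [x0] elsewhere restores [lip] on the whole
   line. *)
pose X (t : R) := if t <= 0 then x0 else x t.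
have hX (t : R) : 0 <= t -> forall n, `|X t - it n t| <= 2 * M / 2 ^+ n * expR (2 * L * t).
  move=> t0 n; rewrite /X; case: (leP t 0) => t0'; last exact: hx.
  have it0 : it n t = x0 by case: n => [//|n]; exact: step_neg.
  by rewrite it0 subrr normr0 mulr_ge0 ?expR_ge0// divr_ge0 ?mulr_ge0// exprn_ge0.
have small (a C : R) : (forall n, a <= C / 2 ^+ n) -> a <= 0.
  move=> h; apply/ler_addgt0Pr => /= e e0; rewrite add0r.
  have e1 : 0 < e / (`|C| + 1) by rewrite divr_gt0// ltr_pwDr.
  have [k hk] := inv_nat_lt e1; apply: le_trans (h k.+1) _.
  apply: le_trans (ler_norm _) _; rewrite normrM normfV (@ger0_norm _ (2 ^+ k.+1)) ?exprn_ge0//.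
  have k2 : k.+1%:R <= 2 ^+ k.+1 :> R by rewrite -natrX ler_nat ltnW// ltn_expl.
  have : (2 ^+ k.+1)^-1 <= e / (`|C| + 1).
    by apply: le_trans (ltW hk); rewrite lef_pV2 ?posrE ?ltr0n ?exprn_gt0.
  rewrite ler_pdivlMr ?ltr_pwDr// => h1; rewrite mulrC; apply: le_trans h1.
  by rewrite ler_wpM2l ?invr_ge0 ?exprn_ge0// lerDl.
have lX : lip X.
  have lX' (s t : R) : 0 <= s -> 0 <= t -> `|X s - X t| <= M * `|s - t|.
    move=> s0 t0; rewrite -subr_le0.
    apply: (small _ (2 * M * expR (2 * L * s) + 2 * M * expR (2 * L * t))) => n.
    have -> : X s - X t = (X s - it n s) + (it n s - it n t) - (X t - it n t).
      by rewrite opprB addrA -!addrA !addKr.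
    have h1 := hX s s0 n; have h2 := hX t t0 n; have h3 := it_lip n s t.
    have h4 := ler_normB ((X s - it n s) + (it n s - it n t)) (X t - it n t).
    have h5 := ler_normD (X s - it n s) (it n s - it n t).
    rewrite mulrDl !(mulrAC _ (expR _)); lra.
  have Xn (t : R) : t <= 0 -> X t = X 0 by move=> t0; rewrite /X t0 lexx.
  move=> s t; have [s0|/ltW s0] := leP 0 s; have [t0|/ltW t0] := leP 0 t.
  - exact: lX'.
  - rewrite (Xn _ t0); apply: le_trans (lX' _ _ s0 (lexx 0)) _.
    by rewrite ler_wpM2l// subr0 !ger0_norm//; lra.
  - rewrite (Xn _ s0); apply: le_trans (lX' _ _ (lexx 0) t0) _.
    by rewrite ler_wpM2l// sub0r normrN ger0_norm// ler0_norm; lra.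
  - by rewrite (Xn _ s0) (Xn _ t0) subrr normr0 mulr_ge0.
have XE (t : R) : 0 <= t -> X t = step X t.
  move=> t0; apply/eqP; rewrite -subr_eq0 -normr_le0.
  apply: (small _ (2 * M * expR (2 * L * t))) => n.
  have -> : X t - step X t = (X t - it n.+1 t) - (step X t - step (it n) t).
    by rewrite opprB addrA subrK.
  apply: le_trans (ler_normB _ _) _.
  have C0 : 0 <= 2 * M / 2 ^+ n by rewrite divr_ge0 ?mulr_ge0// exprn_ge0.
  have h1 := hX t t0 n.+1; have h2 := step_contr lX (@it_lip n) C0 (fun s s0 => hX s s0 n) t0.
  apply: le_trans (lerD h1 h2) _.
  rewrite le_eqVlt; apply/orP; left; apply/eqP; rewrite exprS; field.
  by rewrite expf_neq0.
exists X; split; first by rewrite /X lexx.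
move=> t t0 k; split; first exact: integrable_rhs.
by rewrite {1}(XE t t0) mxE.
Qed.
End picard.
End existence.

(** * Global existence from an a priori bound *)

Section global_existence.
Context {R : realType}.
Notation mu := (@lebesgue_measure R).

(** The clipped field equals [F] up to radius [B + 1]. While a trajectory has stayed within [B],
    continuity keeps it within [B + 1] a little longer, so it is still an arc of [F] and the a
    priori bound gives [B] again; the clipping never acts. *)
Lemma solution_exists N m (F : 'rV[R]_N -> 'rV[R]_m -> 'rV[R]_N) (u : R -> 'rV[R]_m)
    (x0 : 'rV[R]_N) (c B : R) :
  regular_rhs F -> (forall k, measurable_fun setT (fun t : R => u t 0 k)) ->
  (forall t : R, 0 <= t -> `|u t| <= c) -> `|x0| <= B ->
  (forall (x : R -> 'rV[R]_N) (T : R), 0 <= T -> arc F u x T -> x 0 = x0 ->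
     forall t : R, 0 <= t -> t <= T -> `|x t| <= B) ->
  exists x, is_solution F u x0 x.
Proof.
move=> regF mu_ uc x0B apriori.
have B0 : 0 <= B := le_trans (normr_ge0 _) x0B.
have B10 : 0 <= B + 1 by lra.
pose G y w := F (clip 0 (B + 1) y) w.
have cl_in (y : 'rV[R]_N) : `|clip 0 (B + 1) y| <= B + 1 by have := clip_in 0 y B10; rewrite subr0.
have cG : continuous (fun p : 'rV[R]_N * 'rV[R]_m => G p.1 p.2).
  move=> [y w]; apply/cvgrPdist_le => e e0.
  have /cvgrPdist_le/(_ _ e0)/nbhs_ballP[d /= d0 hd] := regF.1 (clip 0 (B + 1) y, w).
  exists (ball y d, ball w d); first by split; exact: nbhsx_ballx.
  move=> [y' w'] [/= yd wd]; apply: (hd (clip 0 (B + 1) y', w')); split => //=.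
  by move: yd; rewrite !mx_norm_ball /ball_/=; apply: le_lt_trans; exact: clip_lip.
have [L [L1 hL]] := loc_lip_compact (B + 1) c regF.
have [M [M0 hM]] := rhs_bounded (B + 1) c regF.1.
have GL y z w : `|w| <= c -> `|G y w - G z w| <= L * `|y - z|.
  move=> wc; apply: le_trans (hL _ _ _ (cl_in y) (cl_in z) wc) _.
  by rewrite ler_wpM2l ?clip_lip//; exact: le_trans ler01 L1.
have GM y w : `|w| <= c -> `|G y w| <= M by move=> wc; exact: hM.
have [x solx] := picard x0 cG L1 M0 GL GM mu_ uc.
have GF y w : `|y| <= B + 1 -> G y w = F y w.
  by move=> yB; rewrite /G clip_id ?subr0.
have bound (T : R) : 0 <= T -> forall t : R, 0 <= t -> t <= T -> `|x t| <= B.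
  move=> T0; have T10 : 0 <= T + 1 by lra.
  have arcG := solution_arc cG uc solx T10.
  have [[K lipx] _] := arcG.
  have near_x (t : R) (e : R) : 0 < e -> exists d : R, 0 < d /\ d <= 1 /\
      forall s : R, 0 <= s -> s <= T + 1 -> 0 <= t -> t <= T + 1 -> `|s - t| < d -> `|x s - x t| <= e.
    move=> e0; exists (Num.min 1 (e / (`|K| + 1))).
    have K1 : 0 < `|K| + 1 by rewrite ltr_pwDr.
    split; first by rewrite lt_min ltr01 divr_gt0.
    split; first by rewrite ge_min lexx.
    move=> s s0 sT t0 tT; rewrite lt_min ltr_pdivlMr// => /andP[_ h].
    apply: le_trans (lipx _ _ s0 sT t0 tT) _; apply: le_trans (ltW h).
    rewrite mulrC ler_wpM2l//; have := ler_norm K; lra.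
  apply: (@real_induction R (fun t => forall s : R, 0 <= s -> s <= t -> `|x s| <= B) 0 T T0).
  - move=> s s0 s0'; have -> : s = 0 by lra.
    by rewrite solx.1.
  - move=> t t0 tT IH; have [d [d0 [d1 hd]]] := near_x t 1 ltr01.
    exists d; split => // s ts sd sT.
    have arcF : arc F u x s.
      apply: (arc_sub arcG); first lra.
      move=> r r0 rs; rewrite -GF//; have [rt|tr] := leP r t; first by have := IH r r0 rt; lra.
      have h1 : `|x r - x t| <= 1.
        apply: hd => //; [lra|lra|by rewrite gtr0_norm; lra].
      have h2 : `|x t| <= B by apply: IH.
      by have := ler_normD (x r - x t) (x t); rewrite subrK; lra.
    by apply: apriori arcF _; [lra|exact: solx.1].
  - move=> t t0 tT IH s s0; rewrite le_eqVlt => /orP[/eqP ->|st]; last exact: (IH s s0 st s s0 (lexx s)).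
    apply/ler_addgt0Pr => /= e e0; have [d [d0 [d1 hd]]] := near_x t e e0.
    pose r := Num.max 0 (t - d / 2).
    have r0 : 0 <= r by rewrite le_max lexx.
    have rt : r < t by rewrite gt_max t0/=; lra.
    have rd : t - d / 2 <= r by rewrite le_max lexx orbT.
    have h1 : `|x r - x t| <= e.
      by apply: hd => //; [lra|lra|lra|rewrite ltr0_norm; lra].
    have h2 : `|x r| <= B by exact: (IH r r0 rt r r0 (lexx r)).
    have := ler_normB (x r) (x r - x t); rewrite opprB addrC subrK; lra.
exists x; split; first exact: solx.1.
move=> t t0 k; have [int eq] := solx.2 t t0 k.
have E (s : R) : s \in `[0, t]%classic -> G (x s) (u s) 0 k = F (x s) (u s) 0 k.
  rewrite inE/= in_itv/= => /andP[s0 st].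
  by rewrite GF//; have := bound t t0 s s0 st; lra.
split.
  by apply: (eq_integrable _ _ _ _ int) => // s st; rewrite E.
by rewrite eq; congr (_ + _); apply: eq_Rintegral => s st; rewrite E.
Qed.

Lemma whole_rhs_regular n (Ni mi : 'I_n -> nat)
    (fs : forall i : 'I_n,
        'rV[R]_(\sum_(j < n) Ni j) -> 'rV[R]_(mi i) -> 'rV[R]_(Ni i)) :
  (forall i, regular_rhs (fs i)) -> regular_rhs (whole_rhs fs).
Proof.
move=> reg; split.
  move=> [y w]; apply/cvgrPdist_le => /= e e0.
  have each i : exists d : R, 0 < d /\ forall (y' : 'rV[R]_(\sum_(j < n) Ni j))
      (w' : 'rV[R]_(\sum_(j < n) mi j)), `|y' - y| < d -> `|w' - w| < d ->
      `|fs i y (submxrow w i) - fs i y' (submxrow w' i)| <= e.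
    have /cvgrPdist_le/(_ _ e0)/nbhs_ballP[d /= d0 hd] := (reg i).1 (y, submxrow w i).
    exists d; split => // y' w' yd wd; apply: (hd (y', submxrow w' i)).
    split => /=; rewrite mx_norm_ball /ball_/= distrC// -submxrowB.
    exact: le_lt_trans (submxrow_norm_le _ _) wd.
  have [d hd] := choice each; have [d1 [d10 d1_le]] := fin_pos_min (fun i => (hd i).1).
  exists (ball y d1, ball w d1); first by split; exact: nbhsx_ballx.
  move=> [y' w'] [/= yd wd].
  rewrite mx_norm_ball /ball_/= distrC in yd; rewrite mx_norm_ball /ball_/= distrC in wd.
  rewrite /whole_rhs; apply: mxrow_norm_le => //; first exact: ltW.
  by move=> i; rewrite submxrowB !mxrowK; apply: (hd i).2; apply: lt_le_trans (d1_le i).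
move=> r x0; have [d hd] := choice (fun i => (reg i).2 r x0); have [L hL] := choice hd.
have [d1 [d10 d1_le]] := fin_pos_min (fun i => (hL i).1).
exists d1, (\sum_i `|L i|); split => // y z w yd zd wr.
apply: mxrow_norm_le; first by rewrite mulr_ge0// sumr_ge0.
move=> i; rewrite submxrowB !mxrowK.
apply: le_trans ((hL i).2 _ _ _ (lt_le_trans yd (d1_le i)) (lt_le_trans zd (d1_le i)) _) _.
  exact: le_trans (submxrow_norm_le _ _) wr.
rewrite ler_wpM2r//; have := ler_norm (L i).
have := @le_term_sum R n (fun j => `|L j|) i (fun j => normr_ge0 _).
lra.
Qed.
End global_existence.

(** * A level estimate along a curve *)

Section level.
Context {R : realType}.
Notation mu := (@lebesgue_measure R).

Lemma dini_ae_le_local (g : R -> R) (a b c : R) (N : set R) : a <= b ->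
  (forall t : R, a <= t -> t <= b -> exists d L : R, 0 < d /\ forall p q : R,
     a <= p -> p <= b -> a <= q -> q <= b -> `|p - t| < d -> `|q - t| < d ->
     `|g p - g q| <= L * `|p - q|) ->
  mu.-negligible N ->
  (forall t : R, a <= t -> t < b -> ~ N t -> forall e : R, 0 < e ->
     exists d : R, 0 < d /\ forall h : R, 0 < h -> h < d -> t + h <= b ->
       g (t + h) - g t <= (c + e) * h) ->
  g b - g a <= c * (b - a).
Proof.
move=> ab lip negN dini.
have loc (t : R) : a <= t -> t <= b -> exists d : R, 0 < d /\ forall p q : R,
    a <= p -> p <= q -> q <= b -> `|p - t| < d -> `|q - t| < d -> g q - g p <= c * (q - p).
  move=> t1 t2; have [d [L [d0 hd]]] := lip t t1 t2; exists d; split => // p q ap pq qb pd qd.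
  apply: (@dini_ae_le R g p q c L N) => //.
    move=> s s' h1 h2 h3 h4; apply: hd; try lra; move: pd qd; rewrite !ltr_norml
      => /andP[? ?] /andP[? ?]; apply/andP; split; lra.
  move=> s ps sq Ns e e0; have [d' [d'0 hd']] := dini s ltac:(lra) ltac:(lra) Ns e e0.
  by exists d'; split => // h h0 hd1 shq; apply: hd' => //; lra.
apply: (@real_induction R (fun t => g t - g a <= c * (t - a)) a b ab).
- by rewrite !subrr mulr0.
- move=> t at_ tb IH; have [d [d0 hd]] := loc t ltac:(lra) ltac:(lra).
  exists d; split => // s ts sd sb.
  have := hd t s; rewrite subrr normr0 ger0_norm; last lra.
  by move=> /(_ ltac:(lra) ltac:(lra) ltac:(lra) d0 ltac:(lra)); lra.
- move=> t at_ tb IH; have [d [d0 hd]] := loc t ltac:(lra) ltac:(lra).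
  pose s := Num.max a (t - d / 2).
  have as_ : a <= s by rewrite le_max lexx.
  have st : s < t by rewrite gt_max at_/=; lra.
  have sd : t - d / 2 <= s by rewrite le_max lexx orbT.
  have := hd s t; rewrite subrr normr0 ler0_norm; last lra.
  move=> /(_ ltac:(lra) ltac:(lra) ltac:(lra) ltac:(lra) d0).
  by have := IH s as_ st; lra.
Qed.

Lemma max_loc_lip k (V : 'rV[R]_k -> R) (r : R) (x : 'rV[R]_k) : 0 < r ->
  continuous V -> proper_pd V -> loc_lipschitz_nz V ->
  exists d L : R, 0 < d /\ forall y z : 'rV[R]_k, `|y - x| < d -> `|z - x| < d ->
    `|Num.max r (V y) - Num.max r (V z)| <= L * `|y - z|.
Proof.
move=> r0 cV pV lV; have [x0|x0] := eqVneq x 0; last first.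
  have [d [L [d0 hd]]] := lV x x0; exists d, L; split => // y z yd zd.
  by apply: le_trans (max_lip _ _ _) _; exact: hd.
have /cvgrPdist_le/(_ _ r0)/nbhs_ballP[d /= d0 hd] := cV x.
exists d, 0; split => // y z yd zd.
have lt (y' : 'rV[R]_k) : `|y' - x| < d -> V y' <= r.
  rewrite distrC => h; have := hd y'; rewrite mx_norm_ball /ball_/= => /(_ h).
  by rewrite {1}x0 proper_0// sub0r normrN; apply: le_trans; exact: ler_norm.
by rewrite !max_l ?lt// subrr normr0 mul0r.
Qed.

(* Dini estimate for the excess of [V (y t)] over the barrier [max M' (V (y s) - kap (t - s))]. *)
Lemma level_decrease k (V : 'rV[R]_k -> R) (y : R -> 'rV[R]_k) (s T K M' kap : R) (N : set R) :
  continuous V -> proper_pd V -> loc_lipschitz_nz V -> 0 <= kap -> 0 < M' -> s <= T ->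
  (forall p q : R, s <= p -> p <= T -> s <= q -> q <= T -> `|y p - y q| <= K * `|p - q|) ->
  mu.-negligible N ->
  (forall t : R, s <= t -> t < T -> ~ N t -> M' <= V (y t) -> forall e : R, 0 < e ->
     exists d : R, 0 < d /\ forall h : R, 0 < h -> h < d -> t + h <= T ->
       V (y (t + h)) - V (y t) <= (- kap + e) * h) ->
  V (y T) <= Num.max M' (V (y s) - kap * (T - s)).
Proof.
move=> cV pV lV kap0 M0 sT lipy negN dini.
pose w t := V (y t); pose b (t : R) := Num.max M' (w s - kap * (t - s)).
have bM t : M' <= b t by rewrite le_max lexx.
have lipb (p q : R) : `|b p - b q| <= kap * `|p - q|.
  apply: le_trans (max_lip _ _ _) _.
  have -> : w s - kap * (p - s) - (w s - kap * (q - s)) = kap * (q - p) by lra.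
  by rewrite normrM ger0_norm// distrC.
pose g t := Num.max (w t) (b t) - b t.
have K0 : 0 <= `|K| := normr_ge0 K.
have neary (t : R) (d : R) : 0 < d -> s <= t -> t <= T -> exists d' : R, 0 < d' /\ forall p : R,
    s <= p -> p <= T -> `|p - t| < d' -> `|y p - y t| < d.
  move=> d0 st tT; exists (d / (`|K| + 1)); have K1 : 0 < `|K| + 1 by lra.
  split; first by rewrite divr_gt0.
  move=> p sp pT; rewrite ltr_pdivlMr// => h.
  apply: le_lt_trans (lipy _ _ sp pT st tT) _; apply: le_lt_trans h.
  by rewrite mulrC ler_wpM2l//; have := ler_norm K; lra.
have := @dini_ae_le_local g s T 0 N sT _ negN _; rewrite mul0r.
have gs : g s = 0 by rewrite /g /b subrr mulr0 subr0 max_r ?subrr// le_max lexx orbT.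
have gT : g T <= 0 -> V (y T) <= b T.
  by rewrite /g subr_le0 ge_max => /andP[].
move=> H; apply: gT; move: H; rewrite gs subr0; apply.
- move=> t st tT; have [d [L [d0 hd]]] := max_loc_lip (y t) M0 cV pV lV.
  have [d' [d'0 hd']] := neary t d d0 st tT.
  exists d', (`|L| * `|K| + kap + kap); split => // p q sp pT sq qT pd qd.
  (* As the barrier is at least [M'], only the truncation of [V] at [M'] matters, which is locally
     Lipschitz even at the origin. *)
  have maxE r : Num.max (w r) (b r) = Num.max (b r) (Num.max M' (w r)).
    by rewrite [RHS]maxA (max_l (bM r)) maxC.
  have h1 : `|Num.max M' (w p) - Num.max M' (w q)| <= `|L| * `|K| * `|p - q|.
    apply: le_trans (hd _ _ (hd' _ sp pT pd) (hd' _ sq qT qd)) _.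
    apply: (@le_trans _ _ (`|L| * `|y p - y q|)); first by rewrite ler_wpM2r// ler_norm.
    rewrite -mulrA ler_wpM2l//; apply: le_trans (lipy _ _ sp pT sq qT) _.
    by rewrite ler_wpM2r// ler_norm.
  have h2 : `|Num.max (w p) (b p) - Num.max (w q) (b q)| <=
      `|L| * `|K| * `|p - q| + kap * `|p - q|.
    rewrite (maxE p) (maxE q).
    apply: le_trans (ler_distD (Num.max (b p) (Num.max M' (w q))) _ _) _.
    apply: lerD; first by apply: le_trans (max_lip _ _ _) h1.
    by rewrite (maxC (b p)) (maxC (b q)); apply: le_trans (max_lip _ _ _) (lipb _ _).
  rewrite /g; have -> (a1 a2 a3 a4 : R) : a1 - a2 - (a3 - a4) = (a1 - a3) - (a2 - a4) by lra.
  apply: le_trans (ler_normB _ _) _; have := lipb p q; lra.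
- move=> t st tT nN e e0; rewrite add0r.
  (* Below the barrier the excess stays [0] for a short time. On or above it [M' <= V], so [V] falls
     at rate [kap] and the barrier no faster. *)
  have [wb|bw] := ltP (w t) (b t).
    pose e1 := (b t - w t) / 2; have e10 : 0 < e1 by rewrite /e1; lra.
    have /cvgrPdist_le/(_ _ e10)/nbhs_ballP[d /= d0 hd] := cV (y t).
    have [d' [d'0 hd']] := neary t d d0 st (ltW tT).
    exists (Num.min d' (e1 / (kap + 1))); split.
      by rewrite lt_min d'0 divr_gt0//; lra.
    move=> h h0; rewrite lt_min => /andP[h1 h2] thT.
    have := hd (y (t + h)); rewrite mx_norm_ball /ball_/=.
    have yd : `|y t - y (t + h)| < d.
      by rewrite distrC; apply: hd' => //; [lra|rewrite addrC addKr gtr0_norm].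
    move=> /(_ yd); rewrite ler_norml => /andP[h3 _].
    have := lipb (t + h) t; rewrite (addrC t h) addrK (gtr0_norm h0) (addrC h) ler_norml.
    move=> /andP[h4 _].
    move: h2; rewrite ltr_pdivlMr; last lra.
    move=> h2; have wb' : w (t + h) <= b (t + h).
      have : 2 * e1 = b t - V (y t) by rewrite /e1 -/(w t); lra.
      by rewrite /w; lra.
    by rewrite /g (max_r wb') (max_r (ltW wb)) !subrr mulr_ge0// ltW.
  have Mw : M' <= V (y t) := le_trans (bM t) bw.
  have [d [d0 hd]] := dini t st tT nN Mw e e0.
  exists d; split => // h h0 hlt thT; have h1 := hd h h0 hlt thT.
  have h2 : b t - kap * h <= b (t + h).
    rewrite /b le_max; case: (leP M' (w s - kap * (t - s))) => _; apply/orP; [right; lra|left].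
    have : 0 <= kap * h by rewrite mulr_ge0// ltW.
    lra.
  rewrite /g (max_l bw) lerBlDr lerBlDr.
  rewrite ge_max; apply/andP; split; rewrite /w in bw *; first by lra.
  by have : 0 <= e * h by [rewrite mulr_ge0// ltW]; lra.
Qed.
End level.

(** * Uniform stability, uniform attraction and ISS *)

Section iss.
Context {R : realType}.
Notation mu := (@lebesgue_measure R).
Variables (n : nat) (Ni mi : 'I_n -> nat)
    (fs : forall i : 'I_n,
        'rV[R]_(\sum_(j < n) Ni j) -> 'rV[R]_(mi i) -> 'rV[R]_(Ni i))
    (isSum : 'I_n -> bool)
    (V : forall i : 'I_n, 'rV[R]_(Ni i) -> R)
    (gam : 'I_n -> 'I_n -> R -> R) (gi : 'I_n -> R -> R).
Arguments fs : clear implicits.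
Arguments V : clear implicits.
Hypothesis reg : forall i, regular_rhs (fs i).
Hypothesis Kgam : forall i j, isKinf0 (gam i j).
Hypothesis gam0 : forall i, is_zero_gain (gam i i).
Hypothesis Kgi : forall i, isK (gi i).
Hypothesis lyap : forall i, iss_lyap_sub fs isSum V gam gi i.
Variable alpha : R -> R.
Hypothesis Kalpha : isKinf alpha.
Hypothesis small_gain : forall s : 'I_n -> R, (forall i, 0 <= s i) -> (exists i, s i != 0) ->
     exists i, Gamma_op isSum gam (D_op isSum alpha s) i < s i.

Let pV j : proper_pd (V j) := (lyap j).2.1.

Local Notation X := 'rV[R]_(\sum_(j < n) Ni j).
Local Notation U := 'rV[R]_(\sum_(j < n) mi j).

Let w i (x : X) := V i (submxrow x i).

Let w_ge0 i x : 0 <= w i x. Proof. exact: (proper_ge0 _ (pV i)). Qed.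

Let gain_atE i x r : gain_at isSum V gam gi i x r = gain_rel isSum gam i (w^~ x) (gi i r).
Proof. by rewrite /gain_at /gain_rel /Gamma_op; case: (isSum i). Qed.

Lemma gain_rel_le i (v v' : 'I_n -> R) (r r' : R) : (forall j, 0 <= v j) ->
  (forall j, v j <= v' j) -> r <= r' -> gain_rel isSum gam i v r <= gain_rel isSum gam i v' r'.
Proof.
move=> v0 vv rr; have := Gamma_le isSum Kgam i v0 vv; rewrite /gain_rel.
case: (isSum i) => h; first exact: lerD.
by rewrite ge_max !le_max h rr orbT.
Qed.

Lemma gain_rel_ge i (v : 'I_n -> R) (r : R) : (forall j, 0 <= v j) ->
  r <= gain_rel isSum gam i v r.
Proof.
move=> v0; have := Gamma_ge0 isSum Kgam i v0; rewrite /gain_rel.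
by case: (isSum i) => h; rewrite ?lerDr// le_max lexx orbT.
Qed.

(** Infima of eventual bounds need not be attained; this allows the slightly larger vector [v + d]
    in their place. *)
Lemma gain_rel_cont i (v : 'I_n -> R) (r e : R) : (forall j, 0 <= v j) -> 0 < e ->
  exists d : R, 0 < d /\ gain_rel isSum gam i (fun j => v j + d) r <= gain_rel isSum gam i v r + e.
Proof.
move=> v0 e0; have e1 : 0 < e / n.+1%:R by rewrite divr_gt0// ltr0n.
have [d hd] := choice (fun j => Kinf0_cont (Kgam i j) (v0 j) e1).
have [d1 [d10 d1_le]] := fin_pos_min (fun j => (hd j).1).
exists (d1 / 2); split; first by lra.
have g_le j : gam i j (v j + d1 / 2) <= gam i j (v j) + e / n.+1%:R.
  have := (hd j).2 (v j + d1 / 2); rewrite (addrC (v j)) addrK gtr0_norm; last lra.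
  have := d1_le j => h1 /(_ ltac:(have := v0 j; lra) ltac:(lra)).
  by rewrite ler_norml (addrC (d1 / 2)) lerBlDl => /andP[_].
have ne : e / n.+1%:R * n%:R <= e.
  by rewrite mulrAC ler_pdivrMr ?ltr0n// ler_wpM2l ?ltW// ltr_nat.
have e1e : e / n.+1%:R <= e.
  by rewrite ler_pdivrMr ?ltr0n// ler_peMr ?ler1n// ltW.
rewrite /gain_rel /Gamma_op; case: (isSum i).
  apply: (@le_trans _ _ (\sum_j (gam i j (v j) + e / n.+1%:R) + r)).
    by rewrite lerD2r; apply: ler_sum.
  rewrite big_split/= sumr_const card_ord -!addrA lerD2l addrC lerD2l.
  by rewrite -[leLHS]mulr_natr.
rewrite ge_max; apply/andP; split; last by rewrite -[leLHS]addr0 lerD ?le_max ?lexx ?orbT// ltW.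
apply: bigmax_le.
  by rewrite addr_ge0 ?(ltW e0)// le_max bigmax_ge_id.
move=> j _; apply: le_trans (g_le j) _; apply: lerD => //.
by rewrite le_max (le_bigmax _ (fun j => gam i j (v j))).
Qed.

Let F := whole_rhs fs.

Let Fi i x (u : U) : submxrow (F x u) i = fs i x (submxrow u i).
Proof. by rewrite /F /whole_rhs mxrowK. Qed.

Let rates : exists a : 'I_n -> R -> R, forall i, posdef (a i) /\ decrease_rate fs isSum V gam gi i (a i).
Proof.
have h i : exists a, posdef a /\ decrease_rate fs isSum V gam gi i a by exact: sub_decrease.
by have [a ha] := choice h; exists a.
Qed.

(** At almost every time the arc leaves the ray of [decrease_rate] by [o(h)], and near the nonzero
    block the Lipschitz bound of [V i] turns this into an arbitrarily small error in the slope; then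
    [level_decrease] applies. With [kap = 0] it excludes a rise above both [M'] and the value at
    [s]. *)
Lemma arc_decrease i (a : R -> R) (u : R -> U) (x : R -> X) (c s T M' R0 kap : R) :
  posdef a -> decrease_rate fs isSum V gam gi i a ->
  (forall t : R, 0 <= t -> `|u t| <= c) -> arc F u x T -> 0 <= s -> s <= T -> 0 < M' -> 0 <= kap ->
  (forall t : R, s <= t -> t <= T -> gain_rel isSum gam i (w^~ (x t)) (gi i c) < M') ->
  (forall t : R, s <= t -> t <= T -> w i (x t) <= R0) ->
  (forall y, M' <= V i y -> V i y <= R0 -> kap <= a `|y|) ->
  w i (x T) <= Num.max M' (w i (x s) - kap * (T - s)).
Proof.
move=> pa dec uc [[K lipx] neg] s0 sT M0 kap0 gM wR hkap.
have [cV [_ [lV _]]] := lyap i.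
(* Time [0] is excluded because an arc is only required to have right derivatives at positive
   times. *)
have N0 : mu.-negligible [set (0 : R)] by apply/negligibleP => //; exact: lebesgue_measure_set1.
apply: (@level_decrease _ _ (V i) (fun t => submxrow (x t) i) s T K M' kap _ cV (pV i) lV
  kap0 M0 sT _ (negligibleU neg N0)).
  move=> p q sp pT sq qT; rewrite -submxrowB; apply: le_trans (submxrow_norm_le _ _) _.
  by apply: lipx => //; lra.
move=> t st tT /not_orP[nd /eqP t0] Mw e e0.
have t0' : 0 < t by rewrite lt_neqAle eq_sym t0/=; lra.
have rd : right_deriv x t (F (x t) (u t)).
  by apply: contrapT => h; apply: nd; split => //; split.
have ga : gain_at isSum V gam gi i (x t) `|u t| < V i (submxrow (x t) i).
  rewrite gain_atE; apply: lt_le_trans Mw.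
  apply: le_lt_trans (gM t st (ltW tT)); apply: gain_rel_le => //.
  by apply: K_le (Kgi i) (normr_ge0 _) _; apply: uc; lra.
have xi0 : submxrow (x t) i != 0.
  by apply/eqP => h; move: Mw; rewrite h proper_0//; lra.
have [d1 [L [d10 lip]]] := lV _ xi0.
pose v := F (x t) (u t).
have e2 : 0 < e / 2 by lra.
have [d2 [d20 hd2]] := dec (x t) (u t) ga _ e2; rewrite -Fi -/v in hd2.
have L1 : 0 < `|L| + 1 by rewrite ltr_pwDr.
have e3 : 0 < e / 2 / (`|L| + 1) by rewrite divr_gt0.
have [d3 [d30 hd3]] := rd _ e3.
(* [h * q] exceeds the displacement along both the ray and the arc, to stay where [lip] holds. *)
pose q := `|v| + e / 2 / (`|L| + 1) + 1.
have q0 : 0 < q by rewrite /q; have := normr_ge0 v; lra.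
exists (Num.min (Num.min d2 d3) (d1 / q)); split.
  by rewrite !lt_min d20 d30 divr_gt0.
move=> h h0; rewrite !lt_min => /andP[/andP[h2 h3]]; rewrite ltr_pdivlMr// => h1 _.
have D := hd3 h h0 h3; rewrite -/v in D.
set xi := submxrow (x t) i; set xh := submxrow (x (t + h)) i; set vi := submxrow v i.
have Di : `|xh - (xi + h *: vi)| <= e / 2 / (`|L| + 1) * h.
  apply: le_trans D; apply: le_trans (submxrow_norm_le _ i).
  by rewrite le_eqVlt; apply/orP; left; apply/eqP; congr (`| _ |); apply/rowP => j; rewrite !mxE; lra.
have hv : `|h *: vi| <= h * `|v|.
  by rewrite normrZ (gtr0_norm h0); apply: (ler_wpM2l (ltW h0)); exact: submxrow_norm_le.
have n1 : `|xi + h *: vi - xi| < d1.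
  rewrite (addrC xi) addrK; apply: le_lt_trans hv _; apply: le_lt_trans h1.
  by rewrite ler_wpM2l ?ltW// /q; lra.
have n2 : `|xh - xi| < d1.
  have -> : xh - xi = (xh - (xi + h *: vi)) + h *: vi.
    by apply/rowP => j; rewrite !mxE; lra.
  apply: le_lt_trans (ler_normD _ _) _; apply: le_lt_trans h1; rewrite /q.
  by have := Di; have := hv; lra.
have h4 := lip _ _ n2 n1.
have h5 : V i xh - V i (xi + h *: vi) <= e / 2 * h.
  apply: le_trans (ler_norm _) _; apply: le_trans h4 _.
  apply: (@le_trans _ _ ((`|L| + 1) * (e / 2 / (`|L| + 1) * h))).
    apply: (@le_trans _ _ ((`|L| + 1) * `|xh - (xi + h *: vi)|)).
      by rewrite ler_wpM2r//; have := ler_norm L; lra.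
    by rewrite ler_wpM2l// ltW.
  by rewrite le_eqVlt; apply/orP; left; apply/eqP; field; exact: lt0r_neq0.
have h6 := hd2 h h0 h2.
have h7 := ler_wpM2r (ltW h0) (hkap _ Mw (wR t st (ltW tT))).
rewrite -/xi -/vi in h6 h7 *; lra.
Qed.

Lemma UGS : exists Phi, isKinf Phi /\
  (forall v r, 0 <= r -> (forall i, 0 <= v i) ->
    (forall i, v i <= gain_rel isSum gam i v r) -> forall i, v i <= Phi r) /\
  forall (u : R -> U) (x : R -> X) (c T : R), (forall t : R, 0 <= t -> `|u t| <= c) ->
    arc F u x T -> forall t : R, 0 <= t -> t <= T -> forall i,
    w i (x t) <= Phi (\sum_j w j (x 0) + \sum_j gi j c).
Proof.
have [Phi [KPhi hPhi]] := small_gain_bound Kgam Kalpha small_gain.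
exists Phi; split => //; split => // u x c T uc ar t t0 tT i.
have c0 : 0 <= c := le_trans (normr_ge0 _) (uc 0 (lexx 0)).
have T0 : 0 <= T := le_trans t0 tT.
have g0 j : 0 <= gi j c by exact: K_ge0.
(* [r] dominates the initial value and the input term of every index at once, so that the suprema
   [S] satisfy the inequalities of [small_gain_bound]. *)
set r := \sum_j _ + _.
have wr j : w j (x 0) + gi j c <= r.
  have := @le_term_sum R n (fun j => w j (x 0)) j (fun j => w_ge0 j _).
  by have := @le_term_sum R n (fun j => gi j c) j g0; rewrite /r; lra.
have r0 : 0 <= r by apply: addr_ge0; apply: sumr_ge0.
have [K lipx] := ar.1.
pose Bx := `|x 0| + `|K| * T.
have xB (s : R) : 0 <= s -> s <= T -> `|x s| <= Bx.
  move=> s0 sT; have := lipx s 0 s0 sT (lexx 0) T0; rewrite subr0 ger0_norm// => h1.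
  have := ler_normD (x s - x 0) (x 0); rewrite subrK => h2.
  have : K * s <= `|K| * T.
    by apply: (@le_trans _ _ (`|K| * s)); [rewrite ler_wpM2r// ler_norm|rewrite ler_wpM2l].
  by rewrite /Bx; lra.
pose S j := sup [set z | exists s : R, [/\ 0 <= s, s <= T & z = w j (x s)]].
have supS j : has_sup [set z | exists s : R, [/\ 0 <= s, s <= T & z = w j (x s)]].
  split; first by exists (w j (x 0)), 0.
  have [p1 [p2 [K1 [K2 hp]]]] := pV j; exists (p2 Bx) => _ [s [s0 sT ->]].
  apply: le_trans (hp _).2 _; apply: K_le K2.1 (normr_ge0 _) _.
  exact: le_trans (submxrow_norm_le _ _) (xB s s0 sT).
have wS j (s : R) : 0 <= s -> s <= T -> w j (x s) <= S j.
  by move=> s0 sT; apply: (sup_upper_bound (supS j)); exists s.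
have S0 j : 0 <= S j by apply: le_trans (w_ge0 j (x 0)) (wS j 0 _ _).
apply: le_trans (wS i t t0 tT) _; apply: hPhi => // {t t0 tT} {}i.
apply/ler_addgt0Pr => /= e e0.
apply: ge_sup (supS i).1 _ => _ [s [s0 sT ->]].
have [a ha] := rates.
set G := gain_rel isSum gam i S r.
have rG : r <= G by apply: gain_rel_ge.
have ars : arc F u x s by exact: (arc_sub ar sT).
have := @arc_decrease i (a i) u x c 0 s (G + e) (S i) 0 (ha i).1 (ha i).2 uc ars (lexx 0) s0
  ltac:(lra) (lexx 0) _ _ _.
rewrite mul0r subr0 => H; apply: le_trans (H _ _ _) _.
- move=> t t0 ts; apply: le_lt_trans (_ : _ <= G) _; last lra.
  apply: gain_rel_le => // [j|]; first by apply: wS => //; lra.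
  by have := wr i; have := w_ge0 i (x 0); lra.
- by move=> t t0 ts; apply: wS => //; lra.
- by move=> y _ _; apply: (ha i).1.2.1.
rewrite ge_max lexx/=; have := wr i; have := g0 i; lra.
Qed.


Let sol (u : R -> U) (x : R -> X) (c : R) :=
  (forall t : R, 0 <= t -> `|u t| <= c) /\ forall T : R, 0 <= T -> arc F u x T.

Lemma iss_estimates : exists xi A B : R -> R, isKinf xi /\ isK A /\ isK B /\
  (forall u x c T, (forall t : R, 0 <= t -> `|u t| <= c) -> arc F u x T ->
     forall t : R, 0 <= t -> t <= T -> `|x t| <= xi (A `|x 0| + B c)) /\
  (forall r c e : R, 0 < e -> exists T : R, forall u x, sol u x c -> `|x 0| <= r ->
     forall t : R, T <= t -> `|x t| <= xi (B c) + e).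
Proof.
have [Phi [KPhi [hPhi bound]]] := UGS.
have [p1 hp1] := choice pV; have [p2 hp2] := choice hp1.
have [p [Kp p_le]] := Kinf_lower (fun i => (hp2 i).1).
have [q [Kq pq]] := Kinf_inverse Kp.
have norm_le (x : X) (b : R) : 0 <= b -> (forall i, w i x <= b) -> `|x| <= q b.
  move=> b0 wb; have [->|x0] := eqVneq x 0; first by rewrite normr0 K_ge0//; exact: Kq.1.
  have [i xi] := mxrow_norm_attained x0.
  rewrite -(pq _ (normr_ge0 x)).1; apply: K_le Kq.1 _ _; first exact: K_ge0 Kp.1 (normr_ge0 _).
  apply: le_trans (wb i); apply: le_trans (p_le i _ (normr_ge0 x)) _.
  by rewrite -xi; exact: ((hp2 i).2.2 _).1.
pose A r := r + \sum_j p2 j r; pose B c := c + \sum_j gi j c.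
have KA : isK A by apply: K_sum; [exact: (@Kinf_id R).1|move=> i; exact: (hp2 i).2.1.1].
have KB : isK B by apply: K_sum; [exact: (@Kinf_id R).1|exact: Kgi].
have Kxi : isKinf (q \o Phi) by exact: Kinf_comp.
have A_ge r (x : X) : `|x| <= r -> \sum_j w j x <= A r.
  move=> xr; have r0 : 0 <= r := le_trans (normr_ge0 _) xr.
  apply: (@le_trans _ _ (\sum_j p2 j r)); last by rewrite /A lerDr.
  apply: ler_sum => j _; apply: le_trans ((hp2 j).2.2 _).2 _.
  apply: K_le (hp2 j).2.1.1 (normr_ge0 _) _; exact: le_trans (submxrow_norm_le _ _) xr.
have B_ge c : 0 <= c -> \sum_j gi j c <= B c by move=> c0; rewrite /B lerDr.
have g0 j c : 0 <= c -> 0 <= gi j c by exact: K_ge0.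
have wbound u x c (r T : R) : (forall t : R, 0 <= t -> `|u t| <= c) -> arc F u x T -> `|x 0| <= r ->
    forall t : R, 0 <= t -> t <= T -> forall i, w i (x t) <= Phi (A r + B c).
  move=> uc ar xr t t0 tT i.
  have c0 : 0 <= c := le_trans (normr_ge0 _) (uc 0 (lexx 0)).
  apply: le_trans (bound u x c T uc ar t t0 tT i) _; apply: K_le KPhi.1 _ _.
    by apply: addr_ge0; apply: sumr_ge0 => j _; [exact: w_ge0|exact: g0].
  by apply: lerD; [exact: A_ge|exact: B_ge].
exists (q \o Phi), A, B; split => //; split => //; split => //; split.
  move=> u x c T uc ar t t0 tT; have c0 : 0 <= c := le_trans (normr_ge0 _) (uc 0 (lexx 0)).
  apply: norm_le; last by move=> i; exact: (wbound u x c `|x 0| T uc ar (lexx _) t t0 tT i).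
  by apply: K_ge0 KPhi.1 _; rewrite addr_ge0 ?K_ge0.
move=> r c e e0.
have [c0|c0] := leP 0 c; last first.
  exists 0 => u x [uc _]; have := le_trans (normr_ge0 _) (uc 0 (lexx 0)).
  by rewrite leNgt c0.
have [r0|r0] := leP 0 r; last first.
  by exists 0 => u x _ xr; have := le_trans (normr_ge0 _) xr; rewrite leNgt r0.
(* One time [T] serves all trajectories with the given [r] and [c], as a KL bound requires. *)
pose E i b := 0 <= b /\ exists T : R, 0 <= T /\ forall u x, sol u x c -> `|x 0| <= r ->
  forall t : R, T <= t -> w i (x t) <= b.
pose R0 := Phi (A r + B c).
have R00 : 0 <= R0 by apply: K_ge0 KPhi.1 _; rewrite addr_ge0 ?K_ge0.
have infE i : has_inf [set b | E i b].
  split; last by exists 0 => b [].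
  exists R0; split => //; exists 0; split => // u x [uc ar] xr t t0.
  exact: (wbound u x c r t uc (ar t t0) xr t t0 (lexx t) i).
pose l i := inf [set b | E i b].
have l0 i : 0 <= l i by apply: lb_le_inf (infE i).1 _ => b [].
have El i (d : R) : 0 < d -> E i (l i + d).
  move=> d0; have [b [b0 [T [T0 hT]]] bl] := inf_adherent d0 (infE i).
  split; first by rewrite addr_ge0// ltW.
  by exists T; split => // u x sx xr t Tt; apply: le_trans (hT u x sx xr t Tt) (ltW bl).
have lB i : l i <= Phi (B c).
  apply: hPhi => // [|{}i]; first exact: K_ge0.
  apply/ler_addgt0Pr => /= e1 e10.
  have e12 : 0 < e1 / 2 by lra.
  have [d [d0 hd]] := gain_rel_cont i (B c) l0 e12.
  set G := gain_rel _ _ _ _ _ in hd.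
  have [T hT] := choice (fun j => (El j d d0).2).
  pose T1 := \sum_j T j.
  have TT j : T j <= T1 by apply: (@le_term_sum R n T) => k; case: (hT k).
  have T10 : 0 <= T1 by apply: sumr_ge0 => j _; case: (hT j).
  have G0 : 0 <= G by apply: le_trans (gain_rel_ge i _ _); [exact: K_ge0|move=> j; rewrite addr_ge0// ltW].
  have [a ha] := rates.
  pose M' := G + e1 / 2; have M0 : 0 < M' by rewrite /M'; lra.
  have [kap [kap0 hk]] := rate_lower R0 (pV i) (ha i).1 M0.
  apply: (@le_trans _ _ M'); last by rewrite /M'; lra.
  apply: (ge_inf (infE i).2); split; first exact: ltW.
  (* After [T1] the gain bound is below [M']; from a value at most [R0], decay at rate [kap] needs
     at most [R0 / kap] to reach [M']. *)
  exists (T1 + R0 / kap); split; first by rewrite addr_ge0// divr_ge0// ltW.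
  move=> u x sx xr t tt; have [uc ar] := sx.
  have Rk : 0 <= R0 / kap by rewrite divr_ge0// ltW.
  have T1t : T1 <= t by lra.
  have t0 : 0 <= t by lra.
  have wR (s : R) : T1 <= s -> s <= t -> w i (x s) <= R0.
    by move=> s1 st; apply: (wbound _ _ _ _ _ uc (ar t t0) xr) => //; lra.
  have gM (s : R) : T1 <= s -> s <= t -> gain_rel isSum gam i (w^~ (x s)) (gi i c) < M'.
    move=> s1 st; apply: le_lt_trans (_ : _ <= G) _; last by rewrite /M'; lra.
    apply: gain_rel_le => // [j|].
      by apply: (hT j).2 sx xr _ _; exact: le_trans (TT j) s1.
    apply: le_trans (B_ge c c0); apply: (@le_term_sum R n (fun j => gi j c)) => j; exact: g0.
  have := arc_decrease (ha i).1 (ha i).2 uc (ar t t0) T10 T1t M0 (ltW kap0) gM wR hk.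
  move=> /le_trans; apply; rewrite ge_max lexx/=.
  have := wR T1 (lexx _) T1t.
  have : R0 <= kap * (t - T1) by rewrite -ler_pdivrMl// mulrC; lra.
  lra.
have PB0 : 0 <= Phi (B c) by apply: K_ge0 KPhi.1 _; exact: K_ge0.
have [d [d0 hd]] := K_cont Kq.1 PB0 e0.
have d2 : 0 < d / 2 by lra.
have [T hT] := choice (fun j => (El j _ d2).2).
pose T1 := \sum_j T j.
have TT j : T j <= T1 by apply: (@le_term_sum R n T) => k; case: (hT k).
exists T1 => u x sx xr t tt.
apply: (@le_trans _ _ (q (Phi (B c) + d / 2))).
  apply: norm_le; first by lra.
  move=> i; apply: le_trans ((hT i).2 u x sx xr t (le_trans (TT i) tt)) _.
  by rewrite lerD2r.
have := hd (Phi (B c) + d / 2); rewrite (addrC (Phi _)) addrK gtr0_norm//.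
by move=> /(_ ltac:(lra) ltac:(lra)); rewrite ler_norml lerBlDl => /andP[].
Qed.

Lemma interconnection_ISS : ISS F.
Proof.
have regF : regular_rhs F by exact: whole_rhs_regular.
have [xi [A [B [Kxi [KA [KB [bound attract]]]]]]] := iss_estimates.
have h2 : 0 < (2 : R) by lra.
have K2 := (Kinf_scale h2).1.
(* The second term comes from splitting [A + B] by the larger summand; the first covers input bounds
   that exceed the initial norm, for which no attraction time is used. *)
pose g (c : R) := xi (A c + B c) + xi (2 * B c).
have Kxi2B : isK (fun c => xi (2 * B c)) by exact: K_comp Kxi.1 (K_comp K2 KB).
have KxiB : isK (fun c => xi (B c)) by exact: K_comp Kxi.1 KB.
have Kg : isK g by apply: K_add Kxi2B; exact: K_comp Kxi.1 (K_add KA KB).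
(* The attraction time may depend on the input bound. Real induction on [c'] makes it uniform on
   [[0, r]]: the time for [c2] serves slightly smaller [c], because [xi (B c)] is continuous in
   [c]. *)
have uniform (r e : R) : 0 < e -> exists T : R, forall c u x, c <= r -> sol u x c -> `|x 0| <= r ->
    forall t : R, T <= t -> `|x t| <= xi (B c) + e.
  move=> e0; have e2 : 0 < e / 2 by lra.
  have [r0|r0] := leP 0 r; last first.
    by exists 0 => c u x _ _ xr; have := le_trans (normr_ge0 _) xr; rewrite leNgt r0.
  have sol_c0 c u x : sol u x c -> 0 <= c.
    by move=> [uc _]; exact: le_trans (normr_ge0 _) (uc 0 (lexx 0)).
  have solW c c' u x : c <= c' -> sol u x c -> sol u x c'.
    by move=> cc [uc ar]; split => // t t0; exact: le_trans (uc t t0) cc.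
  apply: (@real_induction R (fun c' => exists T : R, forall c u x, c <= c' -> sol u x c ->
    `|x 0| <= r -> forall t : R, T <= t -> `|x t| <= xi (B c) + e) 0 r r0).
  - have [T hT] := attract r 0 e e0; exists T => c u x c0 sx.
    have cE : c = 0 by apply/le_anti; rewrite c0 (sol_c0 _ _ _ sx).
    by move: sx; rewrite cE => sx xr; exact: (hT u x sx xr).
  - move=> c1 c10 c1r [T hT]; have [d [d0 hd]] := K_cont KxiB c10 e2.
    exists d; split => // c2 c12 c2d c2r; have [T' hT'] := attract r c2 _ e2.
    exists (Num.max T T') => c u x cc2 sx xr t; rewrite ge_max => /andP[tT tT'].
    have [cc1|c1c] := leP c c1; first exact: (hT _ u x cc1 sx xr t tT).
    apply: le_trans (hT' u x (solW _ _ _ _ cc2 sx) xr t tT') _.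
    have := hd c2; rewrite gtr0_norm; last lra.
    move=> /(_ ltac:(lra) ltac:(lra)); rewrite ler_norml => /andP[_].
    have := K_le KxiB c10 (ltW c1c); lra.
  - move=> c1 c10 c1r IH; have [d [d0 hd]] := K_cont KxiB (ltW c10) e2.
    pose c2 := Num.max 0 (c1 - d / 2).
    have c20 : 0 <= c2 by rewrite le_max lexx.
    have c21 : c2 < c1 by rewrite gt_max c10/=; lra.
    have c2d : c1 - d / 2 <= c2 by rewrite le_max lexx orbT.
    have [T hT] := IH c2 c20 c21; have [T' hT'] := attract r c1 _ e2.
    exists (Num.max T T') => c u x cc1 sx xr t; rewrite ge_max => /andP[tT tT'].
    have [cc2|c2c] := leP c c2; first exact: (hT _ u x cc2 sx xr t tT).
    apply: le_trans (hT' u x (solW _ _ _ _ cc1 sx) xr t tT') _.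
    have := hd c2 c20; rewrite ltr0_norm; last lra.
    move=> /(_ ltac:(lra)); rewrite ler_norml => /andP[+ _].
    have := K_le KxiB c20 (ltW c2c); lra.
(* Triples of initial norm, time and excess over the input gain; a single [beta] must dominate them
   for every input bound. *)
pose S (a s y : R) := exists u x c, [/\ sol u x c, a = `|x 0|, 0 <= s & y = `|x s| - g c].
have Kphi : isK (fun a => xi (2 * A a)) by exact: K_comp Kxi.1 (K_comp K2 KA).
have [||beta [KLb hb]] := @KL_bound R S _ Kphi.
- move=> a s y [u [x [c [sx -> s0 ->]]]]; split => //; split => //.
  have [uc ar] := sx; have c0 : 0 <= c := le_trans (normr_ge0 _) (uc 0 (lexx 0)).
  have := bound u x c s uc (ar s s0) s s0 (lexx s).
  have A0 : 0 <= A `|x 0| by exact: K_ge0.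
  have B0 : 0 <= B c by exact: K_ge0.
  have Ac0 : 0 <= A c by exact: K_ge0.
  have g1 : 0 <= xi (A c + B c) by apply: K_ge0 Kxi.1 _; lra.
  have g2 : 0 <= xi (2 * A `|x 0|) by apply: K_ge0 Kxi.1 _; lra.
  have g3 : 0 <= xi (2 * B c) by apply: K_ge0 Kxi.1 _; lra.
  rewrite /g; have [AB|BA] := leP (A `|x 0|) (B c).
    have : xi (A `|x 0| + B c) <= xi (2 * B c) by apply: K_le Kxi.1 _ _; lra.
    lra.
  have : xi (A `|x 0| + B c) <= xi (2 * A `|x 0|) by apply: K_le Kxi.1 _ _; lra.
  lra.
- move=> r e e0; have [T hT] := uniform r e e0; exists T => a s y [u [x [c [sx -> s0 ->]]]] xr Ts.
  have [uc ar] := sx; have c0 : 0 <= c := le_trans (normr_ge0 _) (uc 0 (lexx 0)).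
  have A0 : 0 <= A `|x 0| by exact: K_ge0.
  have B0 : 0 <= B c by exact: K_ge0.
  have Ac0 : 0 <= A c by exact: K_ge0.
  have g1 : 0 <= xi (A c + B c) by apply: K_ge0 Kxi.1 _; lra.
  have g3 : xi (B c) <= xi (2 * B c) by apply: K_le Kxi.1 _ _; lra.
  have g4 : 0 <= xi (B c) by apply: K_ge0 Kxi.1 _.
  rewrite /g; have [cr|rc] := leP c r; first by have := hT c u x cr sx xr s Ts; lra.
  have AA : A `|x 0| <= A c by apply: K_le KA _ _ => //; lra.
  have : xi (A `|x 0| + B c) <= xi (A c + B c) by apply: K_le Kxi.1 _ _; lra.
  have := bound u x c s uc (ar s s0) s s0 (lexx s); lra.
exists beta, g; split => //; split => // u x0 [mu_ [c0 uc0]]; split.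
  apply: (@solution_exists _ _ _ F u x0 c0 (`|x0| + `|xi (A `|x0| + B c0)|)) => //.
    by rewrite lerDl.
  move=> x T T0 ar xE t t0 tT; have := bound u x c0 T uc0 ar t t0 tT; rewrite xE => h.
  by apply: le_trans h _; apply: le_trans (ler_norm _) _; rewrite lerDr.
move=> x c solx uc t t0.
have := hb `|x0| t (`|x t| - g c) _; rewrite lerBlDr; apply.
exists u, x, c; split => //; last by rewrite solx.1.
by split => // T T0; exact: solution_arc regF.1 uc solx T0.
Qed.

End iss.

Theorem theorem5 (R : realType) (n : nat) (Ni mi : 'I_n -> nat)
    (fs : forall i : 'I_n,
        'rV[R]_(\sum_(j < n) Ni j) -> 'rV[R]_(mi i) -> 'rV[R]_(Ni i))
    (isSum : 'I_n -> bool)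
    (V : forall i : 'I_n, 'rV[R]_(Ni i) -> R)
    (gam : 'I_n -> 'I_n -> R -> R) (gi : 'I_n -> R -> R) :
  (forall i, regular_rhs (fs i)) ->
  (forall i j, isKinf0 (gam i j)) ->
  (forall i, is_zero_gain (gam i i)) ->
  (forall i, isK (gi i)) ->
  (forall i, iss_lyap_sub fs isSum V gam gi i) ->
  irreducible_gains gam ->
  forall alpha : R -> R, isKinf alpha ->
  (forall s : 'I_n -> R, (forall i, 0 <= s i) -> (exists i, s i != 0) ->
     exists i, Gamma_op isSum gam (D_op isSum alpha s) i < s i) ->
  ISS (whole_rhs fs) /\
  (forall sigma sinv : 'I_n -> R -> R,
     omega_path (fun s => D_op isSum alpha (Gamma_op isSum gam s)) sigma sinv ->
     iss_lyap (whole_rhs fs)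
       (fun x => \big[Num.max/0]_(i < n) sinv i (V i (submxrow x i)))).
Proof.
move=> reg Kgam gam0 Kgi lyap _ alpha Kalpha small_gain; split.
  exact: (interconnection_ISS reg Kgam gam0 Kgi lyap Kalpha small_gain).
move=> sigma sinv path.
exact: (omega_path_iss_lyap reg Kgam gam0 Kgi lyap Kalpha path).
Qed.
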